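(* Suppose assumptions (A1)–(A6) listed in the context hold. Let $(\theta_k)_{k\ge 0}\subset\Theta$ be the sequence of parameters generated by $\theta_{k+1}=\theta_k-\alpha_k\,g(\theta_k)$, where $g(\theta_k)$ is the stochastic gradient estimator (built from $M$ samples) defined in the context. Let $A_K:=\sum_{k=0}^{K-1}\alpha_k$, let $\mathbf L>0$ be the Lipschitz constant of $\theta\mapsto\nabla_\theta\mathcal L_L(\theta)$ on $\Theta$ with respect to $\|\cdot\|_2$, and let $\hat S:=4B_\nabla^R\sum_{\ell=1}^L|\beta_\ell u_\ell|$. Then for all $K,M\in\mathbb N$ $$\sum_{k=0}^{K-1}\frac{\alpha_k}{A_K}\,\mathbb E_G\Big[\|\nabla_\theta\mathcal L_L(\theta_k)\|_2^2\Big]\;\le\;\frac{2}{A_K}\mathcal L_L(\theta_0)+\mathbf L\,\hat S^2\,\frac{\sum_{k=0}^{K-1}\alpha_k^2}{A_K}+\frac{\hat S^2}{M^2},$$ and the right-hand side is $O\big(\tfrac1{A_K}\big)+O\big(\tfrac1{M^2}\big)$ as $K,M\to\infty$.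
   Context: **Model.** $T\in\mathbb N$ is a finite horizon; $\mathcal S,\mathcal A\subset\mathbb R$ are Borel state and action spaces; $(\varepsilon_t)$ and $(z_t)$ are independent sequences of i.i.d. standard normal random variables on a complete probability space $(\Omega,\mathcal F,\mathbb P)$; $F:\mathcal S\times\mathcal A\times\mathbb R\to\mathcal S$ and $r:\mathcal S\times\mathcal A\to\mathbb R$ are measurable; $s_0\in\mathcal S$ is a given state. For $\theta\in\Theta\subset\mathbb R^7$: $s_0^\theta=s_0$, $R_0^\theta=0$, and for $t=0,\dots,T-1$: $a_t^\theta=f(\theta,s_t^\theta,R_t^\theta,z_t,t)$, $s_{t+1}^\theta=F(s_t^\theta,a_t^\theta,\varepsilon_{t+1})$, $R_{t+1}^\theta=\sum_{k=0}^{t}r(s_k^\theta,a_k^\theta)$. Here $f$ is the $\mathcal A$-valued neural network $f(\theta,s,R,z,t)=w^2\sigma(w^1_s s+w^1_R R+w^1_z z+w^1_t t+b^1)+b^2$, with $\theta=(w^1_s,w^1_R,w^1_z,w^1_t,w^2,b^1,b^2)$ (superscripts 1, 2 are layer indices, not powers) and activation $\sigma:\mathbb R\to\mathbb R$. **Assumptions.** (A1) The parameter set $\Theta$ is compact, and $\sigma,\sigma'$ are Lipschitz continuous and non-decreasing ($\sigma'$ is allowed not to exist at isolated points). (A2) There are $c_b,d_b\ge0$ such that for $\varepsilon\sim\mathcal N(0,1)$: $\mathbb E[|F(s,a,\varepsilon)|]\le c_b|s|+d_b$ for all $s\in\mathcal S,a\in\mathcal A$. (A3) There is $L_F>0$ with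 $|F(s,a,\varepsilon)-F(s,a,\tilde\varepsilon)|\le L_F|\varepsilon-\tilde\varepsilon|$ for all $s,a,\varepsilon,\tilde\varepsilon$. (A4) There are $L_r,\tilde L_F>0$ with $|r(s,a)-r(\tilde s,\tilde a)|\le L_r(|s-\tilde s|+|a-\tilde a|)$ and $|F(s,a,\varepsilon)-F(\tilde s,\tilde a,\varepsilon)|\le\tilde L_F(|s-\tilde s|+|a-\tilde a|)$ for all $s,\tilde s,a,\tilde a,\varepsilon$. (A5) The partial derivatives $\partial_s r,\partial_a r,\partial_sF,\partial_aF$ exist and for $i=s,a$ there are constants with $|\partial_i r(s,a)-\partial_i r(\tilde s,\tilde a)|\le L_\nabla^{r,i}(|s-\tilde s|+|a-\tilde a|)$ and $|\partial_iF(s,a,\varepsilon)-\partial_iF(\tilde s,\tilde a,\tilde\varepsilon)|\le L_\nabla^{F,i}(|s-\tilde s|+|a-\tilde a|)$ for all $s,\tilde s,a,\tilde a,\varepsilon,\tilde\varepsilon$. (A6) The step sizes satisfy $\alpha_k>0$, $\sum_{k=0}^\infty\alpha_k=\infty$, $\sum_{k=0}^\infty\alpha_k^2<\infty$. **Good event.** For fixed constants $\eta_t>0$ ($t=1,\dots,T$) and $B^z>0$, $G\in\mathcal F$ is the event that $|s_t^\theta-\mathbb E[s_t^\theta]|\le\eta_t$ for all $t=1,\dots,T$ and all $\theta\in\Theta$, and $|z_t|\le B^z$ for $t=0,\dots,T-1$. It is assumed that $\mathbb P(G)\ge1-\gamma$ for a given $\gamma\in(0,1)$. $\mathbb E_G[\cdot]=\mathbb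 E[\cdot\,|\,G]$. **Gradients.** $\nabla_\theta s_t^\theta,\nabla_\theta a_t^\theta,\nabla_\theta R_t^\theta$ are pathwise derivatives obtained by the chain rule (with $\nabla_\theta s_0^\theta=0$, $\nabla_\theta R_0^\theta=0$). $\|\cdot\|$ is the $\ell^1$-norm, $\|\cdot\|_2$ the Euclidean norm. $B_\nabla^R$ is a constant with $\|\nabla_\theta R_t^\theta(\omega)\|\le B_\nabla^R$ for all $t\le T$, $(\theta,\omega)\in\Theta\times G$ (such a constant exists). **Loss.** $\varphi^\star$ is the characteristic function of a target law $\mu^\star$ on $\mathbb R$; $\varphi_\theta(u)=\mathbb E_G[e^{iuR_T^\theta}]$ with $\nabla_\theta\varphi_\theta(u)=\mathbb E_G[iue^{iuR_T^\theta}\nabla_\theta R_T^\theta]$; $u_1,\dots,u_L\in\mathbb R$ are fixed nodes and $\beta_1,\dots,\beta_L\ge0$ fixed weights; $\mathcal L_L(\theta)=\sum_{\ell=1}^L\beta_\ell|\varphi^\star(u_\ell)-\varphi_\theta(u_\ell)|^2$. **Estimator and sampling.** At iteration $k$, independently of the earlier iterations, $M$ i.i.d. noise trajectories are drawn from the law of $(\varepsilon_{t+1},z_t)_{t=0}^{T-1}$ conditioned on $G$, yielding i.i.d. copies $(R_T^{\theta,j},\nabla_\theta R_T^{\theta,j})$, $j=1,\dots,M$, of $(R_T^\theta,\nabla_\theta R_T^\theta)$ on $G$. With $\hat\varphi_\theta(u)=\frac1M\sum_{j=1}^Me^{iuR_T^{\theta,j}}$ and $\widehat{\nabla_\theta\varphi_\theta}(u)=\frac1M\sum_{j=1}^Miue^{iuR_T^{\theta,j}}\nabla_\theta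 R_T^{\theta,j}$, the estimator is the gradient of $\hat{\mathcal L}_L(\theta)=\sum_\ell\beta_\ell|\varphi^\star(u_\ell)-\hat\varphi_\theta(u_\ell)|^2$, i.e. $g(\theta)=2\sum_{\ell=1}^L\beta_\ell\,\mathrm{Re}\big(\overline{(\hat\varphi_\theta(u_\ell)-\varphi^\star(u_\ell))}\,\widehat{\nabla_\theta\varphi_\theta}(u_\ell)\big)$. The initial $\theta_0\in\Theta$ is deterministic. For quantities depending on the samples, $\mathbb E_G$ denotes expectation under this sampling on the good event.
   Formalization: The formal theorem also assumes that, almost surely, the segment between consecutive iterates θ_k and θ_{k+1} lies in Θ (automatic if Θ is convex); without this the claim fails for non-convex Θ. *)

(* Defs.v *)
From HB Require Import structures.
From mathcomp Require Import all_boot all_order all_algebra.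
From mathcomp Require Import all_classical all_reals all_analysis.
From mathcomp Require Import complex.

Set Implicit Arguments.
Unset Strict Implicit.
Unset Printing Implicit Defensive.

Import Order.TTheory GRing.Theory Num.Theory.
Import numFieldNormedType.Exports.

Local Open Scope classical_set_scope.
Local Open Scope ring_scope.
Local Open Scope complex_scope.

(* Mutual independence, as the product rule over every finite subfamily. *)
Definition mutually_independent d d' (W : measurableType d)
    (E : measurableType d') (R : realType) (P : probability W R)
    (I : eqType) (X : I -> W -> E) : Prop :=
  forall (J : seq I) (B : I -> set E), uniq J ->
    (forall i, measurable (B i)) ->
    P (\big[setI/setT]_(i <- J) (X i @^-1` B i)) =
    (\prod_(i <- J) P (X i @^-1` B i))%E.

(* [d] is the derivative at [x] of [f] relative to [D]; since [D] is only a   *)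
(* Borel set, an isolated point of [D] leaves [d] unconstrained.              *)
Definition has_deriv_in (R : realType) (D : set R) (f : R -> R) (x d : R) :=
  (f y - f x) / (y - x) @[y --> within D x^'] --> d.

Definition norm1 (R : realType) n (v : 'rV[R]_n) : R := \sum_i `|v 0 i|.
Definition norm2 (R : realType) n (v : 'rV[R]_n) : R :=
  Num.sqrt (\sum_i v 0 i ^+ 2).

(* The derivative fields carry no property here: they are tied to [reward]    *)
(* and [step] by [assumption5]. Outside [states] and [actions] all the        *)
(* functions are irrelevant.                                                  *)
Record model (R : realType) := Model {
  horizon : nat ;
  states : set R ;
  actions : set R ;
  step : R -> R -> R -> R ;
  reward : R -> R -> R ;
  s_init : R ;
  activation : R -> R ;
  ds_step : R -> R -> R -> R ;
  da_step : R -> R -> R -> R ;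
  ds_reward : R -> R -> R ;
  da_reward : R -> R -> R
}.

Section dynamics.
Context {R : realType} (m : model R).

(* theta = (w1_s, w1_R, w1_z, w1_t, w2, b1, b2) *)
Definition policy (th : 'rV[R]_7) (s Rw z t : R) : R :=
  th 0 4 * activation m (th 0 0 * s + th 0 1 * Rw + th 0 2 * z + th 0 3 * t
                         + th 0 5) + th 0 6.

Definition grad_policy (th : 'rV[R]_7) (s Rw z t : R) : 'rV[R]_7 :=
  \row_i 'D_(delta_mx 0 i) (fun th' : 'rV[R]_7 => policy th' s Rw z t) th.

Definition ds_policy (th : 'rV[R]_7) (s Rw z t : R) : R :=
  derive1 (fun s' => policy th s' Rw z t) s.

Definition dR_policy (th : 'rV[R]_7) (s Rw z t : R) : R :=
  derive1 (fun Rw' => policy th s Rw' z t) Rw.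

(* [om t] is the pair (eps_{t+1}, z_t) used at time [t]. *)
Implicit Types (th : 'rV[R]_7) (om : nat -> R * R).

(* The pair (s_t, R_t), the return being accumulated as a running sum. *)
Fixpoint state_return th om (t : nat) : R * R :=
  if t is k.+1 then
    let: (s, Rw) := state_return th om k in
    let a := policy th s Rw (om k).2 k%:R in
    (step m s a (om k).1, Rw + reward m s a)
  else (s_init m, 0).

Definition state th om t : R := (state_return th om t).1.
Definition ret th om t : R := (state_return th om t).2.
Definition action th om t : R :=
  policy th (state th om t) (ret th om t) (om t).2 t%:R.

(* The pair (nabla s_t, nabla R_t). *)
Fixpoint grad_state_return th om (t : nat) : 'rV[R]_7 * 'rV[R]_7 :=
  if t is k.+1 then
    let: (gs, gR) := grad_state_return th om k in
    let s := state th om k in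
    let Rw := ret th om k in
    let z := (om k).2 in
    let a := action th om k in
    let ga := grad_policy th s Rw z k%:R + ds_policy th s Rw z k%:R *: gs
              + dR_policy th s Rw z k%:R *: gR in
    (ds_step m s a (om k).1 *: gs + da_step m s a (om k).1 *: ga,
     gR + (ds_reward m s a *: gs + da_reward m s a *: ga))
  else (0, 0).

Definition grad_ret th om t : 'rV[R]_7 := (grad_state_return th om t).2.

Definition well_posed (Theta : set 'rV[R]_7) : Prop :=
  [/\ measurable (states m), measurable (actions m) & states m (s_init m)] /\
  [/\ forall s a e, states m s -> actions m a -> states m (step m s a e),
      measurable_fun (states m `*` actions m `*` setT)
        (fun p : R * R * R => step m p.1.1 p.1.2 p.2),
      measurable_fun (states m `*` actions m)
        (fun p : R * R => reward m p.1 p.2) &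
      forall th s Rw z t, Theta th -> states m s -> (t < horizon m)%N ->
        actions m (policy th s Rw z t%:R)].

Definition assumption1 (Theta : set 'rV[R]_7) : Prop :=
  let sigma := activation m in
  let D := [set x : R | derivable sigma x 1] in
  [/\ compact Theta,
      [lipschitz sigma x | x in setT] /\ {homo sigma : x y / x <= y},
      forall x, ~ D x -> \forall y \near x^', D y &
      [lipschitz derive1 sigma x | x in D] /\
      (forall x y, D x -> D y -> x <= y -> derive1 sigma x <= derive1 sigma y)].

Definition assumption2 : Prop :=
  exists cb db : R, [/\ 0 <= cb, 0 <= db &
    forall s a, states m s -> actions m a ->
      (\int[normal_prob 0 1]_e (`|step m s a e|)%:E <=
       (cb * `|s| + db)%:E)%E].

Definition assumption3 : Prop :=
  exists2 L : R, 0 < L & forall s a e e', states m s -> actions m a ->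
    `|step m s a e - step m s a e'| <= L * `|e - e'|.

Definition assumption4 : Prop :=
  exists Lr LF : R, [/\ 0 < Lr, 0 < LF &
    forall s s' a a', states m s -> states m s' -> actions m a ->
      actions m a' ->
      `|reward m s a - reward m s' a'| <= Lr * (`|s - s'| + `|a - a'|) /\
      forall e, `|step m s a e - step m s' a' e| <=
                LF * (`|s - s'| + `|a - a'|)].

Definition assumption5 : Prop :=
  (forall s a e, states m s -> actions m a ->
    [/\ has_deriv_in (states m) (fun y => reward m y a) s (ds_reward m s a),
        has_deriv_in (actions m) (reward m s) a (da_reward m s a),
        has_deriv_in (states m) (fun y => step m y a e) s (ds_step m s a e) &
        has_deriv_in (actions m) (fun y => step m s y e) a
          (da_step m s a e)]) /\
  exists Lrs Lra LFs LFa : R,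
  forall s s' a a' e e', states m s -> states m s' -> actions m a ->
    actions m a' ->
    let dist := `|s - s'| + `|a - a'| in
    [/\ `|ds_reward m s a - ds_reward m s' a'| <= Lrs * dist,
        `|da_reward m s a - da_reward m s' a'| <= Lra * dist,
        `|ds_step m s a e - ds_step m s' a' e'| <= LFs * dist &
        `|da_step m s a e - da_step m s' a' e'| <= LFa * dist].

End dynamics.

Definition assumption6 (R : realType) (alpha : nat -> R) : Prop :=
  [/\ forall k, 0 < alpha k,
      series alpha @ \oo --> +oo &
      cvgn (series (fun k => alpha k ^+ 2))].

Section noise.
Context d {W : measurableType d} {R : realType} (P : probability W R).
Context (m : model R).

Definition noise (eps z : nat -> W -> R) (w : W) (t : nat) : R * R :=
  (eps t.+1 w, z t w).

Definition standard_noise (eps z : nat -> {RV P >-> R}) : Prop :=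
  (forall t (B : set R), measurable B ->
     P (eps t @^-1` B) = normal_prob 0 1 B /\
     P (z t @^-1` B) = normal_prob 0 1 B) /\
  mutually_independent P
    (fun i : nat + nat => match i with inl t => eps t | inr t => z t end).

Definition good_event (eps z : nat -> W -> R) (Theta : set 'rV[R]_7)
    (eta : nat -> R) (Bz : R) : set W :=
  [set w |
    (forall t th, (1 <= t <= horizon m)%N -> Theta th ->
       `|state m th (noise eps z w) t
         - fine 'E_P[fun w' => state m th (noise eps z w') t]| <= eta t) /\
    (forall t, (t < horizon m)%N -> `|z t w| <= Bz)].

Definition cond_prob (G A : set W) : R := fine (P (A `&` G)) / fine (P G).

Definition cond_exp (G : set W) (f : W -> R) : R :=
  (\int[P]_(w in G) f w) / fine (P G).

Definition cond_expC (G : set W) (f : W -> R[i]) : R[i] :=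
  cond_exp G (fun w => complex.Re (f w)) +i* cond_exp G (fun w => complex.Im (f w)).

End noise.

Definition cis (R : realType) (x : R) : R[i] := cos x +i* sin x.

Definition char_fun (R : realType) (mu : probability R R) (u : R) : R[i] :=
  (\int[mu]_x cos (u * x)) +i* (\int[mu]_x sin (u * x)).

Section loss.
Context {R : realType} (L : nat) (u beta : 'I_L -> R) (phi_star : R -> R[i]).

Definition loss_of (phi : R -> R[i]) : R :=
  \sum_l beta l * ComplexField.Normc.normc (phi_star (u l) - phi (u l)) ^+ 2.

(* Gradient of [loss_of phi_theta] in terms of phi_theta and its gradient. *)
Definition grad_loss_of (phi : R -> R[i]) (dphi : R -> 'rV[R[i]]_7) :
    'rV[R]_7 :=
  \row_i (2 * \sum_l beta l *
            complex.Re (conjc (phi (u l) - phi_star (u l)) * dphi (u l) 0 i)).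

End loss.

Section true_loss.
Context d {W : measurableType d} {R : realType} (P : probability W R).
Context (m : model R) (eps z : nat -> W -> R) (G : set W).
Implicit Type th : 'rV[R]_7.

Definition phi th (v : R) : R[i] :=
  cond_expC P G (fun w => cis (v * ret m th (noise eps z w) (horizon m))).

Definition grad_phi th (v : R) : 'rV[R[i]]_7 :=
  \row_i cond_expC P G (fun w =>
    (0 +i* v) * cis (v * ret m th (noise eps z w) (horizon m))
    * (grad_ret m th (noise eps z w) (horizon m) 0 i)%:C).

Definition loss L (u beta : 'I_L -> R) phi_star th : R :=
  loss_of u beta phi_star (phi th).

(* [Theta] need not have interior points, so the gradient of the loss on it   *)
(* is the pathwise one, obtained from [grad_phi] by the chain rule.           *)
Definition grad_loss L (u beta : 'I_L -> R) phi_star th : 'rV[R]_7 :=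
  grad_loss_of u beta phi_star (phi th) (grad_phi th).

End true_loss.

Section sgd.
Context {R : realType} (m : model R) (M : nat).
Implicit Type th : 'rV[R]_7.

(* A trajectory lists the pairs (eps_{t+1}, z_t) for t < horizon. *)
Local Notation trajectory := ((horizon m).-tuple (R * R)).

Definition path_of (x : trajectory) (t : nat) : R * R := nth (0, 0) x t.

Definition phi_hat (x : 'I_M -> trajectory) th (v : R) : R[i] :=
  M%:R^-1 * \sum_j cis (v * ret m th (path_of (x j)) (horizon m)).

Definition grad_phi_hat (x : 'I_M -> trajectory) th (v : R) : 'rV[R[i]]_7 :=
  \row_i (M%:R^-1 * \sum_j
    (0 +i* v) * cis (v * ret m th (path_of (x j)) (horizon m))
    * (grad_ret m th (path_of (x j)) (horizon m) 0 i)%:C).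

Definition estimator L (u beta : 'I_L -> R) phi_star
    (x : 'I_M -> trajectory) th : 'rV[R]_7 :=
  grad_loss_of u beta phi_star (phi_hat x th) (grad_phi_hat x th).

Fixpoint sgd L (u beta : 'I_L -> R) phi_star (alpha : nat -> R)
    (th0 : 'rV[R]_7) (x : nat -> 'I_M -> trajectory) (k : nat) : 'rV[R]_7 :=
  if k is n.+1 then
    let th := sgd u beta phi_star alpha th0 x n in
    th - alpha n *: estimator u beta phi_star (x n) th
  else th0.

(* The trajectories of all iterations are jointly independent, each with the  *)
(* law of the model noise conditioned on [G].                                 *)
Definition conditional_sampling d (W : measurableType d)
    (P : probability W R) (eps z : nat -> W -> R) (G : set W)
    d' (V : measurableType d') (Q : probability V R)
    (xi : nat -> 'I_M -> V -> trajectory) : Prop :=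
  [/\ forall k j, measurable_fun setT (xi k j),
      mutually_independent Q (fun i : nat * 'I_M => xi i.1 i.2) &
      forall k j (B : set trajectory), measurable B ->
        Q (xi k j @^-1` B) =
        (cond_prob P G
          [set w | B [tuple noise eps z w t | t < horizon m]])%:E].

End sgd.

(* Main.v *)
Require Import Defs.
From HB Require Import structures.
From mathcomp Require Import all_boot all_order all_algebra.
From mathcomp Require Import all_classical all_reals all_analysis.
From mathcomp Require Import complex.
From mathcomp Require Import measurable_realfun ring lra.

Set Implicit Arguments.
Unset Strict Implicit.
Unset Printing Implicit Defensive.

Import Order.TTheory GRing.Theory Num.Theory.
Import numFieldNormedType.Exports.

Local Open Scope classical_set_scope.
Local Open Scope ring_scope.

(* Since sigma' is Lipschitz off isolated points, these are removable and     *)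
(* sigma is differentiable everywhere; F and r are differentiated along the   *)
(* continuous curves of states and actions, which fill intervals of the       *)
(* Borel sets they live in. Differentiating the conditional expectation under *)
(* the integral sign shows that the pathwise gradient of the loss is its      *)
(* derivative along curves in Theta, so the Lipschitz bound on it gives       *)
(* the descent inequality along the segment from theta_k to theta_(k+1).      *)
(*   Given theta_k, the M samples of step k are i.i.d. and independent of the *)
(* past. In the products of sample means that make up g the diagonal terms    *)
(* vanish, because Re(conj(e^(iuR)) iu e^(iuR)) = 0; the M(M-1)/M^2 remaining *)
(* ones give E[g | theta_k] = grad L(theta_k) - b/M with |b| <= S, and also   *)
(* |g| <= S. With <x, x - b/M> >= (|x|^2 - S^2/M^2)/2 the descent inequality  *)
(* telescopes to the bound.                                                   *)

(** The argument has an analytic and a probabilistic half, which meet in [sgd_gradient_bound]. On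
    the analytic side the parameter moves along curves that are defined on the whole line and stay
    in [Theta]; this replaces partial derivatives on a set that may have no interior.
    [is_derive_state_ret] shows that the pathwise gradients differentiate states and returns along
    such curves, [is_derive_loss] carries this to the loss, and [descent] gives the quadratic upper
    bound.

    On the probabilistic side [group_fubini] allows averaging over the samples of one step with the
    current iterate frozen. [expect_est] then finds the mean of the estimator to be the true
    gradient minus a bias of order 1/M, and [norm1_est] and [norm1_bias_est] bound estimator and
    bias by the same constant S. Both bounds rest on the fact that multiplication by a phase
    exp(-iuX) leaves the modulus unchanged. [expect_step] bounds the mean inner product of gradient
    and estimator from below, and [expect_descent] telescopes.

    The model functions are controlled only on their domains, the gradient bound holds only on the
    good event, and the iterates lie in [Theta] only almost surely. The computations are therefore
    made for a surrogate that is measurable and bounded everywhere: coefficients extended by zero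
    ([totalize]), gradients cut off at the bound ([clipped_grad]), and a recursion that restarts on
    leaving [Theta] ([projected_sgd]). [ae_sgd_projected] shows that it almost surely agrees with
    the true recursion, and [ge0_le_integral_ae] transfers the bound without asking that the
    original integrand be measurable. *)

(** * Derivatives along curves *)

Lemma is_derive1P (R : realType) (f : R -> R) (x l : R) :
  is_derive x 1 f l <-> h^-1 * (f (h + x) - f x) @[h --> 0^'] --> l.
Proof.
have E : (fun h : R => h^-1 *: (f (h *: 1 + x) - f x)) =
         (fun h => h^-1 * (f (h + x) - f x)).
  by apply/funext => h; rewrite [h *: 1]mulr1.
split=> [[fx <-]|fl].
  by rewrite -E; apply: (@ex_cvg _ _ _ _ _ fx) || exact: fx.
apply: DeriveDef; first by rewrite /derivable E; apply/cvg_ex; exists l.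
by rewrite /derive E; apply/cvg_lim.
Qed.

Lemma derive_line (R : realType) (V : normedModType R) (f : V -> R)
    (a v : V) (l : R) :
  is_derive (0 : R) 1 (fun h => f (h *: v + a)) l -> 'D_v f a = l.
Proof.
move=> /is_derive1P; rewrite scale0r add0r => fl.
rewrite /derive; apply/cvg_lim => //.
apply: cvg_trans fl; apply: near_eq_cvg; apply: nearW => h.
by rewrite addr0.
Qed.

(** By the mean value theorem on either side of an exceptional point, each difference quotient there
    is a value of f' at a nearby point of [D]. The Lipschitz bound makes these values Cauchy as the
    increment tends to 0, and completeness of the reals gives the limit. *)
Lemma derivable_removable (R : realType) (f : R -> R) (L : R) :
  let D := [set x : R | derivable f x 1] in
  continuous f -> (forall x, ~ D x -> \forall y \near x^', D y) ->
  (forall x y, D x -> D y -> `|derive1 f x - derive1 f y| <= L * `|x - y|) ->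
  forall x : R, derivable f x 1.
Proof.
move=> D fc isoD fL x; have [//|/isoD] := pselect (D x).
rewrite near_withinE => -[e /= e0 De].
have DE (y : R) : y != x -> `|x - y| < e -> derivable f y 1.
  by move=> yx xy; exact: De.
have der (y : R) : y != x -> `|x - y| < e -> is_derive y 1 f (derive1 f y).
  by move=> yx xy; apply: DeriveDef; [exact: DE|rewrite derive1E].
have mvt (h : R) : h != 0 -> `|h| < e -> exists2 c, D c &
    `|c - x| <= `|h| /\ h^-1 * (f (h + x) - f x) = derive1 f c.
  move=> h0 he; have [hp|hn|h00] := ltgtP 0 h; last by rewrite -h00 eqxx in h0.
  - have xh : x < h + x by lra.
    rewrite gtr0_norm// in he.
    have inD y : x < y < h + x -> y != x /\ `|x - y| < e.
      by move=> /andP[xy yh]; rewrite gt_eqF// ltr0_norm; lra.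
    have df y : y \in `]x, (h + x)[ -> is_derive y 1 f (derive1 f y).
      by rewrite in_itv/= => /inD[yx ye]; exact: der.
    have [c] := MVT xh df (continuous_subspaceT fc).
    rewrite in_itv/= => cx ->; have [c1 c2] := inD _ cx.
    exists c; first exact: DE.
    case/andP: cx => xc ch.
    split; last by rewrite addrK mulrC mulfK.
    by rewrite !gtr0_norm; lra.
  - have xh : h + x < x by lra.
    rewrite ltr0_norm// in he.
    have inD y : h + x < y < x -> y != x /\ `|x - y| < e.
      by move=> /andP[xy yh]; rewrite lt_eqF// gtr0_norm; lra.
    have df y : y \in `](h + x), x[ -> is_derive y 1 f (derive1 f y).
      by rewrite in_itv/= => /inD[yx ye]; exact: der.
    have [c] := MVT xh df (continuous_subspaceT fc).
    rewrite in_itv/= => cx E; have [c1 c2] := inD _ cx.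
    exists c; first exact: DE.
    case/andP: cx => xc ch.
    split; first by rewrite !ltr0_norm; lra.
    rewrite -opprB E; field; exact: h0.
rewrite /derivable; apply: cauchy_cvg; apply: cauchy_exP => r r0.
pose L' : R := `|L| + 1.
have L'0 : 0 < L' by rewrite ltr_wpDl.
(* Quotients with increment below [dl] are values of f' at points at most 2 [dl] apart, so they
   differ by at most 2 [L'] [dl], which is at most r/2. *)
pose dl : R := Num.min e (r / (4 * L')).
have dl0 : 0 < dl by rewrite lt_min e0 divr_gt0// mulr_gt0.
have dle : dl <= e by rewrite ge_min lexx.
have dlr : dl * (4 * L') <= r.
  by rewrite -ler_pdivlMr ?mulr_gt0// ge_min lexx orbT.
move: dl dl0 dle dlr => dl dl0 dle dlr.
have key : forall h : R, h != 0 /\ `|h| < dl -> exists2 c, D c &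
    `|c - x| <= dl /\ h^-1 * (f (h + x) - f x) = derive1 f c.
  move=> h [h0 hd]; have [|c Dc [cx ce]] := mvt h h0.
    exact: lt_le_trans hd dle.
  by exists c => //; split => //; exact: le_trans cx (ltW hd).
have near0 : \forall h \near (0 : R)^', h != 0 /\ `|h| < dl.
  rewrite near_withinE; apply/nbhs_ballP; exists dl => //= h.
  by rewrite /ball/= sub0r normrN => ? ?; split.
have dl2 : dl / 2 != 0 /\ `|dl / 2| < dl.
  by split; [apply: lt0r_neq0; lra|rewrite gtr0_norm; lra].
have [c Dc [cx ce]] := key _ dl2.
exists (derive1 f c); rewrite /fmap /=; apply: filterS near0 => h /key[c' Dc' [cx' ce']].
rewrite /ball/= ![_ *: 1]mulr1 /GRing.scale/= ce'.
apply: (le_lt_trans (fL _ _ Dc Dc')).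
have cc : `|c - c'| <= 2 * dl.
  rewrite -(subrKA x); apply: (le_trans (ler_normD _ _)).
  by rewrite (distrC x) mulr_natl mulr2n lerD.
have : L * `|c - c'| <= L' * (2 * dl).
  have LL' : L <= L' by rewrite /L'; have := ler_norm L; lra.
  by apply: (le_trans (ler_wpM2r (normr_ge0 _) LL')); rewrite ler_pM2l.
have := mulr_gt0 dl0 L'0; lra.
Qed.

Lemma lipschitz_bound (R : realType) (f : R -> R) (D : set R) :
  [lipschitz f x | x in D] ->
  exists k : R, forall x y, D x -> D y -> `|f x - f y| <= k * `|x - y|.
Proof.
(* The library predicate holds for all constants beyond a threshold [k], and [k + 1] is one of
   them. *)
move=> [k [_ H]]; exists (k + 1) => x y Dx Dy.
by apply: (H (k + 1) _ (x, y)); first by rewrite ltrDl.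
Qed.

Lemma lipschitz_continuous (R : realType) (f : R -> R) (k : R) :
  (forall x y, `|f x - f y| <= k * `|x - y|) -> continuous f.
Proof.
move=> fk x; apply/cvgrPdist_le => e e0.
have k0 : 0 < `|k| + 1 by rewrite ltr_wpDl.
apply/nbhs_ballP; exists (e / (`|k| + 1)) => /=; first by rewrite divr_gt0.
move=> y; rewrite /ball/= ltr_pdivlMr// => xy.
apply: (le_trans (fk _ _)); apply: (@le_trans _ _ ((`|k| + 1) * `|x - y|)).
  by rewrite ler_wpM2r//; have := ler_norm k; lra.
by rewrite mulrC ltW.
Qed.

Lemma assumption1_activation (R : realType) (m : model R) (Theta : set 'rV[R]_7) :
  assumption1 m Theta -> (forall x : R, derivable (activation m) x 1) /\
  measurable_fun setT (derive1 (activation m)).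
Proof.
move=> [_ [/lipschitz_bound[k fk] _] isoD [/lipschitz_bound[k' dk] _]].
have ca : continuous (activation m).
  by apply: (lipschitz_continuous (k := k)) => x y; apply: fk.
have sP : forall x : R, derivable (activation m) x 1.
  exact: (derivable_removable ca isoD dk).
split => //; apply: continuous_measurable_fun.
by apply: (lipschitz_continuous (k := k')) => x y; apply: dk; exact: sP.
Qed.

(** At interior points of the segment, which lies in [D], the derivative relative to [D] is the
    ordinary one, and the Lipschitz bound supplies continuity up to the end points. The bound on c
    is not strict, so that x = y is covered with c = x. *)
Lemma mvt_in (R : realType) (D : set R) (g dg : R -> R) (L : R) (x y : R) :
  (forall u, D u -> has_deriv_in D g u (dg u)) ->
  (forall u v, D u -> D v -> `|g u - g v| <= L * `|u - v|) ->
  (forall u, (x <= u <= y) || (y <= u <= x) -> D u) ->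
  exists2 c, D c & `|c - x| <= `|y - x| /\ g y - g x = dg c * (y - x).
Proof.
move=> dgP gL.
have L0 : 0 <= `|L| by [].
have {}gL u v : D u -> D v -> `|g u - g v| <= `|L| * `|u - v|.
  by move=> Du Dv; apply: (le_trans (gL _ _ Du Dv)); rewrite ler_wpM2r// ler_norm.
have main (a b : R) : a < b -> (forall u, a <= u <= b -> D u) ->
    exists2 c, a < c < b & g b - g a = dg c * (b - a).
  move=> ab Dab.
  have der u : u \in `]a, b[ -> is_derive u 1 g (dg u).
    rewrite in_itv/= => /andP[au ub].
    apply/is_derive1P; have := dgP u (Dab u _).
    rewrite !ltW// => /(_ isT) gu.
    apply/cvgrPdist_lt => e e0; move/cvgrPdist_lt: gu => /(_ e e0).
    rewrite near_withinE => -[r /= r0 Hr].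
    have inD (k : R) : - (u - a) < k -> k < b - u -> D (k + u).
      by move=> ? ?; apply: Dab; lra.
    rewrite near_withinE; apply/nbhs_ballP.
    pose r' := Num.min r (Num.min (u - a) (b - u)).
    exists r'; first by rewrite /= !lt_min; rewrite r0/=; apply/andP; split; lra.
    move=> h; rewrite /ball/= sub0r normrN /r' !lt_min => /and3P[hr ha hb] h0.
    have := Hr (h + u); rewrite /ball_/= opprD addrCA subrr addr0 normrN.
    move=> /(_ hr); rewrite addrK mulrC; apply.
      by rewrite -subr_eq0 addrK.
    by apply: inD; move: ha hb; rewrite !ltr_norml => /andP[? ?] /andP[? ?].
  have gc : {within `[a, b], continuous g}.
    apply/continuous_within_itvP => //; split.
    + by move=> u /der du; apply/differentiable_continuous/derivable1_diffP.
    + apply/cvgrPdist_le => e e0; rewrite near_withinE; apply/nbhs_ballP.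
      exists (Num.min (e / (`|L| + 1)) (b - a)).
        by rewrite /= lt_min subr_gt0 ab andbT divr_gt0// ltr_wpDl.
      move=> u; rewrite /ball/= lt_min => /andP[ue uab] au.
      have u1 : u <= b by move: uab; rewrite ltr0_norm; lra.
      apply: (le_trans (gL _ _ (Dab _ _) (Dab _ _))); [lra..|].
      move: ue; rewrite ltr_pdivlMr ?ltr_wpDl// => ue.
      have := normr_ge0 (a - u); nra.
    + apply/cvgrPdist_le => e e0; rewrite near_withinE; apply/nbhs_ballP.
      exists (Num.min (e / (`|L| + 1)) (b - a)).
        by rewrite /= lt_min subr_gt0 ab andbT divr_gt0// ltr_wpDl.
      move=> u; rewrite /ball/= lt_min => /andP[ue uab] au.
      have u1 : a <= u by move: uab; rewrite gtr0_norm; lra.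
      apply: (le_trans (gL _ _ (Dab _ _) (Dab _ _))); [lra..|].
      move: ue; rewrite ltr_pdivlMr ?ltr_wpDl// => ue.
      have := normr_ge0 (b - u); nra.
  have [c] := MVT ab der gc.
  by rewrite in_itv/= => cab E; exists c.
case: (ltgtP x y) => [xy|yx|<-] Dxy.
- have [|c /andP[xc cy] E] := main x y xy.
    by move=> u uxy; apply: Dxy; rewrite uxy.
  exists c; first by apply: Dxy; apply/orP; left; apply/andP; split; lra.
  by split => //; rewrite !gtr0_norm; lra.
- have [|c /andP[xc cy] E] := main y x yx.
    by move=> u uxy; apply: Dxy; rewrite uxy orbT.
  exists c; first by apply: Dxy; apply/orP; right; apply/andP; split; lra.
  split; first by rewrite !ltr0_norm ?subr_lt0//; lra.
  by rewrite -opprB E; ring.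
- exists x; first by apply: Dxy; rewrite !lexx.
  by rewrite !subrr mulr0.
Qed.

(** Chain rule for a function of two variables whose partial derivatives exist only relative to
    Borel sets. The arguments are changed one at a time; the mean value theorem applies to each
    change because a continuous curve in a set fills the whole interval between two of its values.
    The partial derivatives, being Lipschitz, then converge as the increment shrinks. *)
Lemma is_derive_comp2_in (R : realType) (D1 D2 : set R)
    (F d1 d2 : R -> R -> R) (K L1 L2 : R) :
  (forall x x' y y', D1 x -> D1 x' -> D2 y -> D2 y' ->
    [/\ `|F x y - F x' y'| <= K * (`|x - x'| + `|y - y'|),
        `|d1 x y - d1 x' y'| <= L1 * (`|x - x'| + `|y - y'|) &
        `|d2 x y - d2 x' y'| <= L2 * (`|x - x'| + `|y - y'|)]) ->
  (forall x y, D1 x -> D2 y -> has_deriv_in D1 (F^~ y) x (d1 x y) /\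
                               has_deriv_in D2 (F x) y (d2 x y)) ->
  forall s a : R -> R, continuous s -> continuous a ->
  (forall t, D1 (s t)) -> (forall t, D2 (a t)) ->
  forall t ds da : R, is_derive t 1 s ds -> is_derive t 1 a da ->
  is_derive t 1 (fun x => F (s x) (a x))
    (d1 (s t) (a t) * ds + d2 (s t) (a t) * da).
Proof.
move=> Lip der s a cs ca Ds Da t ds da /is_derive1P sd /is_derive1P ad.
have between (f : R -> R) (D : set R) : continuous f -> (forall t, D (f t)) ->
    forall x y u, (f x <= u <= f y) || (f y <= u <= f x) -> D u.
  move=> cf Df x y u; wlog xy : x y / x <= y.
    move=> H; have [/H//|/ltW yx] := leP x y.
    by rewrite orbC; exact: H.
  move=> uxy; have [|c _ <-] := @IVT R f x y u xy (continuous_subspaceT cf); last exact: Df.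
  have [fxy|fyx] := leP (f x) (f y).
    by move: uxy => /orP[//|/andP[? ?]]; rewrite (_ : u = f x)//; lra.
  by move: uxy => /orP[/andP[? ?]|//]; lra.
(* First [s] moves with [a] held at its new value, then [a] moves with [s] held at its old value. *)
have step1 h : exists ce : R * R, [/\ D1 ce.1, D2 ce.2,
    `|ce.1 - s t| <= `|s (h + t) - s t|, `|ce.2 - a t| <= `|a (h + t) - a t| &
    F (s (h + t)) (a (h + t)) - F (s t) (a t) =
    d1 ce.1 (a (h + t)) * (s (h + t) - s t) + d2 (s t) ce.2 * (a (h + t) - a t)].
  have [|||c Dc [cs1 cE]] := @mvt_in R D1 (F^~ (a (h + t))) (d1^~ (a (h + t))) K
      (s t) (s (h + t)).
  - by move=> u Du; have [] := der u (a (h + t)) Du (Da _).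
  - move=> u v Du Dv; have [+ _ _] := Lip u v _ _ Du Dv (Da (h + t)) (Da (h + t)).
    by rewrite subrr normr0 addr0.
  - by move=> u; exact: between.
  have [|||c' Dc' [cs1' cE']] := @mvt_in R D2 (F (s t)) (d2 (s t)) K
      (a t) (a (h + t)).
  - by move=> u Du; have [] := der (s t) u (Ds _) Du.
  - move=> u v Du Dv; have [+ _ _] := Lip _ _ u v (Ds t) (Ds t) Du Dv.
    by rewrite subrr normr0 add0r.
  - by move=> u; exact: between.
  exists (c, c'); split => //=.
  by rewrite -cE -cE'; ring.
have [ce ceP] := choice step1.
apply/is_derive1P.
have -> : (fun h => h^-1 * (F (s (h + t)) (a (h + t)) - F (s t) (a t))) =
  (fun h => d1 (ce h).1 (a (h + t)) * (h^-1 * (s (h + t) - s t)) +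
            d2 (s t) (ce h).2 * (h^-1 * (a (h + t) - a t))).
  by apply/funext => h; have [_ _ _ _ ->] := ceP h; ring.
have shift (f : R -> R) : continuous f ->
    `|f (h + t) - f t| @[h --> 0^'] --> (0 : R).
  move=> cf.
  have H : (fun h : R => h + t) @ (0 : R) --> (0 + t : R).
    by apply: cvgD; [exact: cvg_id|exact: cvg_cst].
  have {}H : f (h + t) @[h --> (0 : R)^'] --> f t.
    apply: cvg_within_filter; rewrite add0r in H.
    by apply: (cvg_comp _ _ H); exact: cf.
  have {}H : `|f (h + t) - f t| @[h --> (0 : R)^'] --> `|f t - f t|.
    by apply: cvg_norm; apply: cvgB => //; exact: cvg_cst.
  by rewrite subrr normr0 in H.
have sq L (g : R -> R) (l : R) :
    (forall h, `|g h - l| <= L * (`|s (h + t) - s t| + `|a (h + t) - a t|)) ->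
    g h @[h --> 0^'] --> l.
  move=> H.
  have H1 : L * (`|s (h + t) - s t| + `|a (h + t) - a t|) @[h --> (0 : R)^'] -->
      L * (0 + 0).
    by apply: cvgM; [exact: cvg_cst|apply: cvgD; exact: shift].
  rewrite addr0 mulr0 in H1.
  apply/subr_cvg0; apply: norm_cvg0.
  apply: (@squeeze_cvgr _ _ _ _ (cst 0) (fun h => L * (`|s (h + t) - s t| + `|a (h + t) - a t|))) H1.
    by apply: nearW => h; rewrite normr_ge0 H.
  exact: cvg_cst.
have bnd (L p q p' q' : R) : 0 <= p <= p' -> 0 <= q <= q' ->
    L * (p + q) <= `|L| * (p' + q').
  move=> /andP[p0 pp] /andP[q0 qq].
  apply: (@le_trans _ _ (`|L| * (p + q))); first by rewrite ler_wpM2r ?addr_ge0 ?ler_norm.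
  by rewrite ler_wpM2l// lerD.
apply: cvgD; apply: cvgM => //.
- apply: (sq `|L1|) => h; have [D1h D2h h1 h2 _] := ceP h.
  have [_ H _] := Lip _ _ _ _ D1h (Ds t) (Da (h + t)) (Da t).
  by apply: (le_trans H); apply: bnd; rewrite ?normr_ge0 /=.
- apply: (sq `|L2|) => h; have [D1h D2h h1 h2 _] := ceP h.
  have [_ _ H] := Lip _ _ _ _ (Ds t) (Ds t) D2h (Da t).
  by apply: (le_trans H); apply: bnd; rewrite ?normr_ge0 //= subrr normr0.
Qed.

Section derive_rules.
Context {R : realType}.
Implicit Types (f g : R -> R) (x a b : R).

Lemma is_derive_add f g x a b : is_derive x 1 f a -> is_derive x 1 g b ->
  is_derive x 1 (fun y => f y + g y) (a + b).
Proof. exact: is_deriveD. Qed.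

Lemma is_derive_mul f g x a b : is_derive x 1 f a -> is_derive x 1 g b ->
  is_derive x 1 (fun y => f y * g y) (a * g x + f x * b).
Proof.
move=> fx gx; have H := is_deriveM fx gx.
by apply: (is_derive_eq H); rewrite addrC [_ *: a]mulrC.
Qed.

Lemma is_derive_const c x : is_derive x 1 (fun=> c) (0 : R).
Proof. exact: is_derive_cst. Qed.

Lemma is_derive_continuous f x a : is_derive x 1 f a -> {for x, continuous f}.
Proof. by move=> fx; apply/differentiable_continuous/derivable1_diffP. Qed.

Lemma is_derive_bigsum (I : Type) (r : seq I) (F : I -> R -> R) (dF : I -> R) x :
  (forall i, is_derive x 1 (F i) (dF i)) ->
  is_derive x 1 (fun y => \sum_(i <- r) F i y) (\sum_(i <- r) dF i).
Proof.
move=> dFP; elim: r => [|i r IH].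
  rewrite big_nil; apply: is_derive_eq (erefl 0).
  by under eq_fun do rewrite big_nil; exact: is_derive_const.
rewrite big_cons; under eq_fun do rewrite big_cons.
exact: is_derive_add.
Qed.

End derive_rules.

Section chain_rule.
Context {R : realType} (m : model R).
Context (sigmaP : forall x : R, derivable (activation m) x 1).
Implicit Types (th : R -> 'rV[R]_7) (s r : R -> R) (z k t ds dr : R).

Let sigma' := derive1 (activation m).

Definition preact (th : 'rV[R]_7) (s Rw z t : R) : R :=
  th 0 0 * s + th 0 1 * Rw + th 0 2 * z + th 0 3 * t + th 0 5.

(** One explicit derivative serves every purpose: constant and straight-line choices of the curves
    give [grad_policy], [ds_policy] and [dR_policy], and regrouping by these three gives the chain
    rule [is_derive_policy]. *)
Lemma is_derive_policy_expr th (dth : 'rV[R]_7) s r z k t ds dr :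
  (forall i, is_derive t 1 (fun x => th x 0 i) (dth 0 i)) ->
  is_derive t 1 s ds -> is_derive t 1 r dr ->
  is_derive t 1 (fun x => policy m (th x) (s x) (r x) z k)
    (dth 0 4 * activation m (preact (th t) (s t) (r t) z k)
     + th t 0 4 * (sigma' (preact (th t) (s t) (r t) z k) *
        (dth 0 0 * s t + th t 0 0 * ds + (dth 0 1 * r t + th t 0 1 * dr)
         + dth 0 2 * z + dth 0 3 * k + dth 0 5))
     + dth 0 6).
Proof.
move=> dthP sP rP; rewrite /policy.
have pre : is_derive t 1 (fun x => preact (th x) (s x) (r x) z k)
  (dth 0 0 * s t + th t 0 0 * ds + (dth 0 1 * r t + th t 0 1 * dr)
         + dth 0 2 * z + dth 0 3 * k + dth 0 5).
  rewrite /preact.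
  have cz c i : is_derive t 1 (fun x => th x 0 i * c) (dth 0 i * c).
    have H := is_derive_mul (dthP i) (is_derive_const c t).
    by apply: (is_derive_eq H); rewrite mulr0 addr0.
  by do !apply: is_derive_add => //; apply: is_derive_mul.
apply: is_derive_add => //; apply: is_derive_mul => //.
apply: is_derive1_comp pre; apply: DeriveDef => //.
by rewrite /sigma' derive1E.
Qed.

Lemma grad_policyE (th : 'rV[R]_7) (s r z k : R) i :
  let y := preact th s r z k in
  grad_policy m th s r z k 0 i =
  (i == 4)%:R * activation m y + th 0 4 * (sigma' y *
    ((i == 0)%:R * s + (i == 1)%:R * r + (i == 2)%:R * z + (i == 3)%:R * k
     + (i == 5)%:R)) + (i == 6)%:R.
Proof.
have lineP j : is_derive (0 : R) 1
    (fun x : R => (x *: (delta_mx 0 i : 'rV[R]_7) + th) 0 j)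
    ((delta_mx 0 i : 'rV[R]_7) 0 j).
  have -> : (fun x : R => (x *: (delta_mx 0 i : 'rV[R]_7) + th) 0 j) =
            (fun x => x * (delta_mx 0 i : 'rV[R]_7) 0 j + th 0 j).
    by apply/funext => x; rewrite !mxE.
  have H := is_derive_add (is_derive_mul (is_derive_id (0 : R) 1)
    (is_derive_const ((delta_mx 0 i : 'rV[R]_7) 0 j) 0)) (is_derive_const (th 0 j) 0).
  by apply: (is_derive_eq H); rewrite mul1r mulr0 !addr0.
have H := is_derive_policy_expr z k lineP (is_derive_const s 0) (is_derive_const r 0).
rewrite /= mxE; apply: derive_line; apply: (is_derive_eq H).
rewrite scale0r add0r !mxE !eqxx /= !mulr0 !addr0.
by rewrite ![_ == i]eq_sym.
Qed.

Lemma ds_policyE (th : 'rV[R]_7) (s r z k : R) :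
  ds_policy m th s r z k = th 0 4 * (sigma' (preact th s r z k) * th 0 0).
Proof.
have constP i : is_derive s 1 (fun=> th 0 i) ((0 : 'rV[R]_7) 0 i).
  by rewrite mxE; exact: is_derive_const.
rewrite /ds_policy derive1E.
have H := is_derive_policy_expr z k constP (is_derive_id s 1) (is_derive_const r s).
rewrite (@derive_val _ _ _ _ _ _ _ H) !mxE.
by rewrite !mul0r mulr1 mulr0 !addr0 !add0r.
Qed.

Lemma dR_policyE (th : 'rV[R]_7) (s r z k : R) :
  dR_policy m th s r z k = th 0 4 * (sigma' (preact th s r z k) * th 0 1).
Proof.
have constP i : is_derive r 1 (fun=> th 0 i) ((0 : 'rV[R]_7) 0 i).
  by rewrite mxE; exact: is_derive_const.
rewrite /dR_policy derive1E.
have H := is_derive_policy_expr z k constP (is_derive_const s r) (is_derive_id r 1).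
rewrite (@derive_val _ _ _ _ _ _ _ H) !mxE.
by rewrite !mul0r mulr1 mulr0 !addr0 !add0r.
Qed.

Lemma is_derive_policy th (dth : 'rV[R]_7) s r z k t ds dr :
  (forall i, is_derive t 1 (fun x => th x 0 i) (dth 0 i)) ->
  is_derive t 1 s ds -> is_derive t 1 r dr ->
  is_derive t 1 (fun x => policy m (th x) (s x) (r x) z k)
    (\sum_i grad_policy m (th t) (s t) (r t) z k 0 i * dth 0 i
     + ds_policy m (th t) (s t) (r t) z k * ds
     + dR_policy m (th t) (s t) (r t) z k * dr).
Proof.
move=> dthP sP rP; have H := is_derive_policy_expr z k dthP sP rP.
apply: (is_derive_eq H).
under eq_bigr do rewrite grad_policyE.
rewrite ds_policyE dR_policyE; set y := preact _ _ _ _ _.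
have e (j : 'I_7) : \sum_(i < 7) (i == j)%:R * dth 0 i = dth 0 j.
  rewrite (bigD1 j)//= eqxx mul1r big1 ?addr0// => i /negbTE ->.
  by rewrite mul0r.
set A := activation m y; set B := th t 0 4 * sigma' y.
rewrite (eq_bigr (fun i : 'I_7 => (i == 4)%:R * dth 0 i * A +
    ((i == 0)%:R * dth 0 i * (B * s t) + ((i == 1)%:R * dth 0 i * (B * r t) +
    ((i == 2)%:R * dth 0 i * (B * z) + ((i == 3)%:R * dth 0 i * (B * k) +
    ((i == 5)%:R * dth 0 i * B + (i == 6)%:R * dth 0 i))))))); last first.
  by move=> i _; rewrite /B; ring.
by rewrite !big_split/= -!mulr_suml !e /B; ring.
Qed.

Context (Theta : set 'rV[R]_7) (wp : well_posed m Theta).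
Context (A4 : assumption4 m) (A5 : assumption5 m).

Lemma state_in (th : 'rV[R]_7) (om : nat -> R * R) (t : nat) : Theta th -> (t <= horizon m)%N ->
  states m (state m th om t).
Proof.
move=> thT; elim: t => [|t IH] tT; first by case: wp => -[].
have {}IH := IH (ltnW tT); case: wp => _ [stepP _ _ polP].
rewrite /state /=; case E: (state_return _ _ _ _) => [s r] /=.
rewrite /state E /= in IH.
by apply: stepP => //; exact: polP.
Qed.

Lemma action_in (th : 'rV[R]_7) (om : nat -> R * R) (t : nat) : Theta th -> (t < horizon m)%N ->
  actions m (action m th om t).
Proof.
move=> thT tT; case: wp => _ [_ _ _ polP]; apply: polP => //.
by apply: state_in => //; exact: ltnW.
Qed.

(** Induction on time: one step of the recursion for the gradients is the chain rule applied to one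
    step of the dynamics. The curve lies in [Theta] at every real x, so states and actions stay in
    their domains and [is_derive_comp2_in] applies. *)
Lemma is_derive_state_ret (th : R -> 'rV[R]_7) (dth : R -> 'rV[R]_7)
    (om : nat -> R * R) :
  (forall x, Theta (th x)) ->
  (forall (x : R) i, is_derive x 1 (fun y => th y 0 i) (dth x 0 i)) ->
  forall k : nat, (k <= horizon m)%N -> forall x : R,
  is_derive x 1 (fun y => state m (th y) om k)
    (\sum_i (grad_state_return m (th x) om k).1 0 i * dth x 0 i) /\
  is_derive x 1 (fun y => ret m (th y) om k)
    (\sum_i grad_ret m (th x) om k 0 i * dth x 0 i).
Proof.
move=> thT dthP; elim=> [|k IH] kT x.
  rewrite /grad_ret /= !big1; [|by move=> i _; rewrite mxE mul0r..].
  by split; exact: is_derive_const.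
have kT' := ltnW kT.
have sP y := (IH kT' y).1.
have rP y := (IH kT' y).2.
have aP y := is_derive_policy (om k).2 k%:R (dthP y) (sP y) (rP y).
have sc : continuous (fun y => state m (th y) om k).
  by move=> y; exact: is_derive_continuous (sP y).
have ac : continuous (fun y => action m (th y) om k).
  by move=> y; exact: is_derive_continuous (aP y).
have sD y : states m (state m (th y) om k) by exact: state_in.
have aD y : actions m (action m (th y) om k) by exact: action_in.
have [Lr [LF [_ _ LP]]] := A4.
have [derP [Lrs [Lra [LFs [LFa L5]]]]] := A5.
have LF5 : forall (s s' a a' : R), states m s -> states m s' -> actions m a ->
    actions m a' ->
    [/\ `|step m s a (om k).1 - step m s' a' (om k).1| <= LF * (`|s - s'| + `|a - a'|),
      `|ds_step m s a (om k).1 - ds_step m s' a' (om k).1| <= LFs * (`|s - s'| + `|a - a'|) &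
      `|da_step m s a (om k).1 - da_step m s' a' (om k).1| <= LFa * (`|s - s'| + `|a - a'|)].
  move=> s s' a a' Ds Ds' Da Da'; have [_ H1] := LP _ _ _ _ Ds Ds' Da Da'.
  by have [_ _ H2 H3] := L5 _ _ _ _ (om k).1 (om k).1 Ds Ds' Da Da'.
have Lr5 : forall (s s' a a' : R), states m s -> states m s' -> actions m a ->
    actions m a' ->
    [/\ `|reward m s a - reward m s' a'| <= Lr * (`|s - s'| + `|a - a'|),
      `|ds_reward m s a - ds_reward m s' a'| <= Lrs * (`|s - s'| + `|a - a'|) &
      `|da_reward m s a - da_reward m s' a'| <= Lra * (`|s - s'| + `|a - a'|)].
  move=> s s' a a' Ds Ds' Da Da'; have [H1 _] := LP _ _ _ _ Ds Ds' Da Da'.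
  by have [H2 H3 _ _] := L5 _ _ _ _ 0 0 Ds Ds' Da Da'.
have stepD := is_derive_comp2_in LF5
  (fun (s a : R) Ds Da => let: And4 _ _ p q := derP s a (om k).1 Ds Da in conj p q)
  sc ac sD aD (sP x) (aP x).
(* The reward does not see the noise; 0 is an arbitrary value for the noise argument of [derP]. *)
have rewD := is_derive_comp2_in Lr5
  (fun (s a : R) Ds Da => let: And4 p q _ _ := derP s a 0 Ds Da in conj p q)
  sc ac sD aD (sP x) (aP x).
have E1 y : state m (th y) om k.+1 =
    step m (state m (th y) om k) (action m (th y) om k) (om k).1.
  by rewrite /action /state /ret /=; case: (state_return _ _ _ _).
have E2 y : ret m (th y) om k.+1 =
    ret m (th y) om k + reward m (state m (th y) om k) (action m (th y) om k).
  by rewrite /action /state /ret /=; case: (state_return _ _ _ _).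
under eq_fun do rewrite E1.
under [X in _ /\ is_derive _ _ X _]eq_fun do rewrite E2.
rewrite /grad_ret /=.
case E : (grad_state_return m (th x) om k) => [gs gR] /=.
rewrite /grad_ret E /= in stepD rewD rP; rewrite -/(action m (th x) om k) in stepD rewD.
split.
  apply: (is_derive_eq stepD); rewrite !mulr_sumr -!big_split/= !mulr_sumr -!big_split/=.
  by apply: eq_bigr => i _; rewrite !mxE; ring.
have := rP x; rewrite E /= => rPx.
apply: (is_derive_eq (is_derive_add rPx rewD)).
rewrite !mulr_sumr -!big_split/= !mulr_sumr -!big_split/=.
by apply: eq_bigr => i _; rewrite !mxE; ring.
Qed.

End chain_rule.

(** * The gradient of the loss and descent *)

Section row_norms.
Context {R : realType} (n : nat).
Implicit Types a b : 'rV[R]_n.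

Definition dot a b : R := \sum_i a 0 i * b 0 i.

Lemma norm2_ge0 a : 0 <= norm2 a. Proof. exact: sqrtr_ge0. Qed.

Lemma norm2_sqr a : norm2 a ^+ 2 = dot a a.
Proof.
rewrite sqr_sqrtr; first by apply: eq_bigr => i _; rewrite expr2.
by apply: sumr_ge0 => i _; exact: sqr_ge0.
Qed.

Lemma norm2Z (c : R) a : norm2 (c *: a) = `|c| * norm2 a.
Proof.
rewrite /norm2 -sqrtr_sqr -sqrtrM ?sqr_ge0// mulr_sumr.
by congr Num.sqrt; apply: eq_bigr => i _; rewrite mxE exprMn.
Qed.

Lemma norm2_eq0 a i : norm2 a = 0 -> a 0 i = 0.
Proof.
move=> a0; have := norm2_sqr a; rewrite a0 expr0n/= => /esym/eqP.
rewrite psumr_eq0 => [/allP /(_ i)|j _]; last by rewrite -expr2 sqr_ge0.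
by rewrite mem_index_enum mulf_eq0 orbb => /(_ isT)/eqP.
Qed.

(** Cauchy-Schwarz: expand the sum of the squared entries of |b| a - |a| b and divide by |a| |b|,
    which is why vanishing norms are treated apart. *)
Lemma dot_le_norm2 a b : dot a b <= norm2 a * norm2 b.
Proof.
have [a0|a0] := eqVneq (norm2 a) 0.
  by rewrite a0 mul0r /dot big1// => i _; rewrite norm2_eq0// mul0r.
have [b0|b0] := eqVneq (norm2 b) 0.
  by rewrite b0 mulr0 /dot big1// => i _; rewrite (norm2_eq0 _ b0) mulr0.
have na : 0 < norm2 a by rewrite lt0r a0 norm2_ge0.
have nb : 0 < norm2 b by rewrite lt0r b0 norm2_ge0.
have H : 0 <= \sum_i (norm2 b * a 0 i - norm2 a * b 0 i) ^+ 2.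
  by apply: sumr_ge0 => i _; exact: sqr_ge0.
have E : \sum_i (norm2 b * a 0 i - norm2 a * b 0 i) ^+ 2 =
    norm2 b ^+ 2 * dot a a + norm2 a ^+ 2 * dot b b
    - 2 * norm2 a * norm2 b * dot a b.
  rewrite /dot !mulr_sumr -sumrN -!big_split/=; apply: eq_bigr => i _; ring.
rewrite E -!norm2_sqr in H.
rewrite -(ler_pM2l (mulr_gt0 na nb)); lra.
Qed.

(** Termwise, the square of an entry is at most its absolute value times the sum of all of them. *)
Lemma norm2_le_norm1 a : norm2 a <= norm1 a.
Proof.
have n1 : 0 <= norm1 a by apply: sumr_ge0 => i _; exact: normr_ge0.
rewrite -(ler_pXn2r (_ : 0 < 2)%N) ?nnegrE ?norm2_ge0// norm2_sqr /dot /norm1.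
rewrite expr2 mulr_suml; apply: ler_sum => i _.
apply: (le_trans (ler_norm _)); rewrite normrM ler_wpM2l//.
by rewrite (bigD1 i)//= lerDl; apply: sumr_ge0.
Qed.

End row_norms.

Section bounded_integrals.
Context d (T : measurableType d) {R : realType} (P : probability T R).

Lemma bounded_integrable (G : set T) (f : T -> R) (C : R) :
  measurable G -> measurable_fun G f -> (forall x, G x -> `|f x| <= C) ->
  P.-integrable G (EFin \o f).
Proof.
move=> mG mf fC; apply: measurable_bounded_integrable => //.
  by apply: (le_lt_trans (probability_le1 P mG)); rewrite ltry.
by exists C; split; [exact: num_real|move=> x Cx y /fC/le_trans; apply; exact: ltW].
Qed.

(** Differentiation under the integral: on a set of finite measure the constant |[C]| is an
    integrable majorant of the derivatives, here on the interval of radius 1 around [x]. *)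
Lemma is_derive_cond_exp (G : set T) (f df : R -> T -> R) (C : R) (x : R) :
  measurable G ->
  (forall y, measurable_fun G (f y)) ->
  (forall y w, G w -> `|f y w| <= C) ->
  (forall (y : R) w, G w -> is_derive y 1 (f^~ w) (df y w)) ->
  (forall y w, G w -> `|df y w| <= C) ->
  is_derive x 1 (fun y => cond_exp P G (f y)) (cond_exp P G (df x)).
Proof.
move=> mG mf fC fP dfC.
have dE w : G w -> partial1of2 f x w = df x w.
  by move=> Gw; rewrite partial1of2E; have H := fP x w Gw; rewrite derive_val.
have D : is_derive x 1 (fun y => \int[P]_(w in G) f y w) (\int[P]_(w in G) df x w).
  apply/is_derive1P.
  have -> : \int[P]_(w in G) df x w = \int[P]_(w in G) partial1of2 f x w.
    by apply: eq_Rintegral => w; rewrite inE => /dE.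
  apply: (@cvg_differentiation_under_integral _ _ _ _ _ _ mG x (x - 1) (x + 1)
    _ _ _ (fun=> `|C|)) => //=.
  - by rewrite in_itv/=; lra.
  - by move=> y _; exact: bounded_integrable (mf y) (fC y).
  - by move=> y w _ Gw; have := fP y w Gw.
  - apply: (bounded_integrable (C := `|C|)) => //; by move=> w _; rewrite normr_id.
  - move=> y w _ Gw; rewrite partial1of2E; have H := fP y w Gw.
    by rewrite derive_val; apply: le_trans (dfC _ _ Gw) (ler_norm _).
have H := is_derive_mul D (is_derive_const (fine (P G))^-1 x).
by apply: (is_derive_eq H); rewrite mulr0 addr0.
Qed.

Lemma cond_exp_sum (G : set T) (C : R) n (f : 'I_n -> T -> R) (c : 'I_n -> R) :
  measurable G -> (forall i, measurable_fun G (f i)) ->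
  (forall i w, G w -> `|f i w| <= C) ->
  cond_exp P G (fun w => \sum_i f i w * c i) = \sum_i cond_exp P G (f i) * c i.
Proof.
move=> mG mf fC.
have int i : P.-integrable G (EFin \o f i) by exact: bounded_integrable (mf i) (fC i).
have H (r : seq 'I_n) : P.-integrable G (EFin \o (fun w => \sum_(i <- r) f i w * c i)) /\
    \int[P]_(w in G) (\sum_(i <- r) f i w * c i) =
    \sum_(i <- r) (\int[P]_(w in G) f i w) * c i.
  elim: r => [|i r [IH1 IH2]].
    rewrite big_nil; split.
      apply: (bounded_integrable (C := 0)) => //.
        by under eq_fun do rewrite big_nil; exact: measurable_cst.
      by move=> w _; rewrite big_nil normr0.
    by under eq_Rintegral do rewrite big_nil; rewrite Rintegral_cst// mul0r.
  have ii : P.-integrable G (EFin \o (fun w => f i w * c i)).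
    have := integrableZr mG (c i) (int i); apply: eq_integrable => // w _.
  split.
    have := integrableD mG ii IH1; apply: eq_integrable => // w _.
    by rewrite /= big_cons EFinD.
  rewrite big_cons -IH2 -RintegralZr//.
  under eq_Rintegral do rewrite big_cons.
  by rewrite RintegralD.
rewrite /cond_exp (H _).2 mulr_suml; apply: eq_bigr => i _.
by rewrite mulrAC.
Qed.

End bounded_integrals.

Lemma grad_loss_ofE (R : realType) L (u beta : 'I_L -> R) (phi_star : R -> R[i])
    (phi : R -> R[i]) (dphi : R -> 'rV[R[i]]_7) i :
  grad_loss_of u beta phi_star phi dphi 0 i =
  2 * \sum_l beta l *
    ((complex.Re (phi (u l)) - complex.Re (phi_star (u l)))
       * complex.Re (dphi (u l) 0 i)
     + (complex.Im (phi (u l)) - complex.Im (phi_star (u l)))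
       * complex.Im (dphi (u l) 0 i)).
Proof.
rewrite mxE; congr (_ * _); apply: eq_bigr => l _; congr (_ * _).
case: (phi (u l)) (phi_star (u l)) (dphi (u l) 0 i) => [a b] [c e] [f g] /=.
by ring.
Qed.

Lemma loss_ofE (R : realType) L (u beta : 'I_L -> R) (phi_star : R -> R[i])
    (phi : R -> R[i]) :
  loss_of u beta phi_star phi =
  \sum_l beta l *
    ((complex.Re (phi_star (u l)) - complex.Re (phi (u l))) ^+ 2
     + (complex.Im (phi_star (u l)) - complex.Im (phi (u l))) ^+ 2).
Proof.
apply: eq_bigr => l _; congr (_ * _).
case: (phi (u l)) (phi_star (u l)) => [a b] [c e] /=.
by rewrite sqr_sqrtr // addr_ge0 ?sqr_ge0.
Qed.

Lemma measurable_fun_cos d (T : measurableType d) (R : realType) (D : set T)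
  (f : T -> R) : measurable_fun D f -> measurable_fun D (fun x => cos (f x)).
Proof.
move=> mf; apply: (measurableT_comp _ mf).
by apply: continuous_measurable_fun; apply: continuous_cos.
Qed.

Lemma measurable_fun_sin d (T : measurableType d) (R : realType) (D : set T)
  (f : T -> R) : measurable_fun D f -> measurable_fun D (fun x => sin (f x)).
Proof.
move=> mf; apply: (measurableT_comp _ mf).
by apply: continuous_measurable_fun; apply: continuous_sin.
Qed.

Section loss_derivative.
Context {R : realType} d (W : measurableType d) (P : probability W R).
Context (m : model R) (eps z : nat -> W -> R) (G : set W).
Implicit Types th : 'rV[R]_7.

Let X th w := ret m th (noise eps z w) (horizon m).
Let dX th w := grad_ret m th (noise eps z w) (horizon m).

Lemma Re_grad_phi th v i :
  complex.Re (grad_phi P m eps z G th v 0 i) =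
  cond_exp P G (fun w => - v * sin (v * X th w) * dX th w 0 i).
Proof.
rewrite mxE /=; congr (cond_exp _ _ _); apply/funext => w /=.
by rewrite /X /dX; ring.
Qed.

Lemma Im_grad_phi th v i :
  complex.Im (grad_phi P m eps z G th v 0 i) =
  cond_exp P G (fun w => v * cos (v * X th w) * dX th w 0 i).
Proof.
rewrite mxE /=; congr (cond_exp _ _ _); apply/funext => w /=.
by rewrite /X /dX; ring.
Qed.

Context (Theta : set 'rV[R]_7) (BR : R) (mG : measurable G).
Context (mX : forall th, Theta th -> measurable_fun G (X th)).
Context (mdX : forall th i, Theta th -> measurable_fun G (fun w => dX th w 0 i)).
Context (dX_le : forall th w, Theta th -> G w -> norm1 (dX th w) <= BR).
Context (XP : forall (th dth : R -> 'rV[R]_7) w,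
  (forall x, Theta (th x)) ->
  (forall (x : R) i, is_derive x 1 (fun y => th y 0 i) (dth x 0 i)) ->
  forall x : R, is_derive x 1 (fun y => X (th y) w) (dot (dX (th x) w) (dth x))).
Context (L : nat) (u beta : 'I_L -> R) (phi_star : R -> R[i]).

Let lossL := loss P m eps z G u beta phi_star.
Let grad_lossL := grad_loss P m eps z G u beta phi_star.

Lemma dX_comp_le th w i : Theta th -> G w -> `|dX th w 0 i| <= BR.
Proof.
move=> thT Gw; apply: le_trans (dX_le thT Gw).
by rewrite /norm1 (bigD1 i)//= lerDl; apply: sumr_ge0.
Qed.

Context (th dth : R -> 'rV[R]_7) (D : R).
Context (thT : forall x, Theta (th x)).
Context (dthP : forall (x : R) i, is_derive x 1 (fun y => th y 0 i) (dth x 0 i)).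
Context (dthD : forall x i, `|dth x 0 i| <= D).

Lemma dot_dX_le x w : G w -> `|dot (dX (th x) w) (dth x)| <= BR * D.
Proof.
move=> Gw; have D0 : 0 <= D by exact: le_trans (dthD x 0).
apply: (@le_trans _ _ (\sum_i `|dX (th x) w 0 i| * D)).
  apply: (le_trans (ler_norm_sum _ _ _)); apply: ler_sum => i _.
  by rewrite normrM ler_wpM2l.
by rewrite -mulr_suml ler_wpM2r//; exact: dX_le.
Qed.

Lemma is_derive_phi (v x : R) :
  is_derive x 1 (fun y => complex.Re (phi P m eps z G (th y) v))
    (\sum_i complex.Re (grad_phi P m eps z G (th x) v 0 i) * dth x 0 i) /\
  is_derive x 1 (fun y => complex.Im (phi P m eps z G (th y) v))
    (\sum_i complex.Im (grad_phi P m eps z G (th x) v 0 i) * dth x 0 i).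
Proof.
have D0 : 0 <= D by exact: le_trans (dthD 0 0).
have arg (y : R) w : is_derive y 1 (fun y => v * X (th y) w)
    (v * dot (dX (th y) w) (dth y)).
  have H := is_derive_mul (is_derive_const v y) (XP w thT dthP y).
  by apply: (is_derive_eq H); rewrite mul0r add0r.
have marg y : measurable_fun G (fun w => v * X (th y) w).
  by apply: measurable_funM; [exact: measurable_cst|exact: mX].
have msin y : measurable_fun G (fun w => sin (v * X (th y) w)).
  exact: measurable_fun_sin.
have mcos y : measurable_fun G (fun w => cos (v * X (th y) w)).
  exact: measurable_fun_cos.
(* [is_derive_cond_exp] takes one constant for a function and its derivative: 1 bounds cosine and
   sine, the other term bounds their derivatives. *)
pose C := Num.max 1 (`|v| * (BR * D)).
have dle y w (e : R) : `|e| <= 1 -> G w ->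
    `|e * (v * dot (dX (th y) w) (dth y))| <= C.
  move=> e1 Gw; rewrite le_max; apply/orP; right.
  rewrite normrM -[leRHS]mul1r ler_pM// normrM ler_wpM2l//.
  exact: dot_dX_le.
have gle i y w (e : R) : `|e| <= 1 -> G w -> `|v * e * dX (th y) w 0 i| <= `|v| * BR.
  move=> e1 Gw; rewrite normrM; apply: ler_pM => //.
    by rewrite normrM -[leRHS]mulr1 ler_wpM2l.
  by apply: dX_comp_le.
split.
- have H := @is_derive_cond_exp _ _ _ P G (fun y w => cos (v * X (th y) w))
    (fun y w => - sin (v * X (th y) w) * (v * dot (dX (th y) w) (dth y))) C x mG mcos.
  have {}H : is_derive x 1 (fun y => complex.Re (phi P m eps z G (th y) v))
      (cond_exp P G (fun w => - sin (v * X (th x) w) * (v * dot (dX (th x) w) (dth x)))).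
    refine (H _ _ _).
    + by move=> y w _; rewrite le_max cos_max.
    + by move=> y w Gw; apply: dle => //; rewrite normrN sin_max.
  apply: (is_derive_eq H).
  under [RHS]eq_bigr do rewrite Re_grad_phi.
  rewrite -(@cond_exp_sum _ _ _ P G (`|v| * BR))//; last 2 first.
  + move=> i; apply: measurable_funM; last exact: mdX.
    by apply: measurable_funM; [exact: measurable_cst|exact: msin].
  + by move=> i w Gw; rewrite mulNr -mulrN; apply: gle => //; rewrite normrN sin_max.
  congr cond_exp; apply/funext => w; rewrite /dot !mulr_sumr; apply: eq_bigr => i _.
  by ring.
- have H := @is_derive_cond_exp _ _ _ P G (fun y w => sin (v * X (th y) w))
    (fun y w => cos (v * X (th y) w) * (v * dot (dX (th y) w) (dth y))) C x mG msin.
  have {}H : is_derive x 1 (fun y => complex.Im (phi P m eps z G (th y) v))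
      (cond_exp P G (fun w => cos (v * X (th x) w) * (v * dot (dX (th x) w) (dth x)))).
    refine (H _ _ _).
    + by move=> y w _; rewrite le_max sin_max.
    + by move=> y w Gw; apply: dle => //; rewrite cos_max.
  apply: (is_derive_eq H).
  under [RHS]eq_bigr do rewrite Im_grad_phi.
  rewrite -(@cond_exp_sum _ _ _ P G (`|v| * BR))//; last 2 first.
  + move=> i; apply: measurable_funM; last exact: mdX.
    by apply: measurable_funM; [exact: measurable_cst|exact: mcos].
  + by move=> i w Gw; apply: gle => //; rewrite cos_max.
  congr cond_exp; apply/funext => w; rewrite /dot !mulr_sumr; apply: eq_bigr => i _.
  by ring.
Qed.

(** Along the curve |phi_star - phi|^2 has derivative 2 Re(conj(phi - phi_star) phi'), and phi' is
    the gradient of phi paired with the velocity. *)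
Lemma is_derive_loss (x : R) :
  is_derive x 1 (fun y => lossL (th y)) (dot (grad_lossL (th x)) (dth x)).
Proof.
have -> : (fun y => lossL (th y)) = (fun y => \sum_l beta l *
    ((complex.Re (phi_star (u l)) - complex.Re (phi P m eps z G (th y) (u l))) ^+ 2
     + (complex.Im (phi_star (u l)) - complex.Im (phi P m eps z G (th y) (u l))) ^+ 2)).
  by apply/funext => y; exact: loss_ofE.
have sq (c : R) (f : R -> R) (a : R) : is_derive x 1 f a ->
    is_derive x 1 (fun y => (c - f y) ^+ 2) (2 * (f x - c) * a).
  move=> fx.
  have H1 : is_derive x 1 (fun y => c + (-1) * f y) (- a).
    have H := is_derive_add (is_derive_const c x) (is_derive_mul (is_derive_const (-1) x) fx).
    by apply: (is_derive_eq H); ring.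
  have -> : (fun y => (c - f y) ^+ 2) = (fun y => (c + (-1) * f y) * (c + (-1) * f y)).
    by apply/funext => y; ring.
  by apply: (is_derive_eq (is_derive_mul H1 H1)); ring.
have H l := is_derive_mul (is_derive_const (beta l) x)
  (is_derive_add (sq (complex.Re (phi_star (u l))) _ _ (is_derive_phi (u l) x).1)
                 (sq (complex.Im (phi_star (u l))) _ _ (is_derive_phi (u l) x).2)).
apply: (is_derive_eq (is_derive_bigsum (index_enum 'I_L) H)).
rewrite /dot; under [RHS]eq_bigr do rewrite grad_loss_ofE mulr_sumr mulr_suml.
rewrite exchange_big/=; apply: eq_bigr => l _.
rewrite !mulr_sumr -!big_split/= mulr_sumr mul0r add0r.
by apply: eq_bigr => i _; ring.
Qed.

End loss_derivative.

Section descent.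
Context {R : realType} (Theta : set 'rV[R]_7) (f : 'rV[R]_7 -> R).
Context (g : 'rV[R]_7 -> 'rV[R]_7) (Lip : R).
Context (gL : forall th th', Theta th -> Theta th' ->
       norm2 (g th - g th') <= Lip * norm2 (th - th')).
Context (fP : forall (th dth : R -> 'rV[R]_7) D, (forall x, Theta (th x)) ->
  (forall (x : R) i, is_derive x 1 (fun y => th y 0 i) (dth x 0 i)) ->
  (forall x i, `|dth x 0 i| <= D) -> forall x : R,
  is_derive x 1 (fun y => f (th y)) (dot (g (th x)) (dth x))).

(* The segment is run through by [(1 - cos x) / 2], a smooth map of the whole *)
(* line onto [0, 1], so that no one-sided derivative at its ends is needed.   *)
Lemma descent (a b : 'rV[R]_7) :
  (forall t : R, 0 <= t <= 1 -> Theta (a + t *: (b - a))) ->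
  f b <= f a + dot (g a) (b - a) + Lip / 2 * norm2 (b - a) ^+ 2.
Proof.
move=> ab; set v := b - a in ab *.
pose c (x : R) : R := (1 - cos x) / 2.
pose dc (x : R) : R := sin x / 2.
have cP (x : R) : is_derive x 1 c (dc x).
  have -> : c = (fun x => (1 + (-1) * cos x) * 2^-1).
    by apply/funext => y; rewrite /c; ring.
  have H := is_derive_mul (is_derive_add (is_derive_const 1 x)
    (is_derive_mul (is_derive_const (-1) x) (is_derive_cos x))) (is_derive_const 2^-1 x).
  by apply: (is_derive_eq H); rewrite /dc; ring.
have c01 x : 0 <= c x <= 1.
  by have := cos_max x; rewrite ler_norml /c; lra.
pose th x := a + c x *: v; pose dth x := dc x *: v.
have thT x : Theta (th x) by apply: ab.
have dthP (x : R) i : is_derive x 1 (fun y => th y 0 i) (dth x 0 i).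
  have -> : (fun y => th y 0 i) = (fun y => a 0 i + c y * v 0 i).
    by apply/funext => y; rewrite !mxE.
  have H := is_derive_add (is_derive_const (a 0 i) x)
    (is_derive_mul (cP x) (is_derive_const (v 0 i) x)).
  by apply: (is_derive_eq H); rewrite [dth x 0 i]mxE; ring.
have dthD x i : `|dth x 0 i| <= norm1 v.
  rewrite mxE normrM; apply: (@le_trans _ _ (1 * `|v 0 i|)).
    apply: ler_wpM2r => //.
    by have := sin_max x; rewrite /dc !ler_norml; lra.
  by rewrite mul1r /norm1 (bigD1 i)//= lerDl; apply: sumr_ge0.
have fD := fP thT dthP dthD.
(* The claim is q(pi) <= q(0), since [c] runs from 0 to 1; the mean value theorem reduces it to the
   sign of the derivative on ]0, pi[. *)
pose q x := f (th x) - c x * dot (g a) v - c x ^+ 2 * (Lip / 2 * norm2 v ^+ 2).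
pose dq x := dot (g (th x)) (dth x) - dc x * dot (g a) v
  - 2 * c x * dc x * (Lip / 2 * norm2 v ^+ 2).
have qP (x : R) : is_derive x 1 q (dq x).
  have -> : q = fun x => f (th x) + c x * (- dot (g a) v)
      + c x * c x * (- (Lip / 2 * norm2 v ^+ 2)).
    by apply/funext => y; rewrite /q; ring.
  have H := is_derive_add (is_derive_add (fD x)
    (is_derive_mul (cP x) (is_derive_const (- dot (g a) v) x)))
    (is_derive_mul (is_derive_mul (cP x) (cP x))
      (is_derive_const (- (Lip / 2 * norm2 v ^+ 2)) x)).
  by apply: (is_derive_eq H); rewrite /dq; ring.
have qc : continuous q by move=> x; exact: is_derive_continuous (qP x).
have [x] := MVT (pi_gt0 R) (fun x _ => qP x) (continuous_subspaceT qc).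
rewrite in_itv/= => xpi qE.
have dq0 : dq x <= 0.
  have dc0 : 0 <= dc x by rewrite /dc divr_ge0// ltW// sin_gt0_pi.
  (* The first factor is nonnegative on ]0, pi[. The Lipschitz bound between [th x] and [a], whose
     distance is c(x) |v|, together with Cauchy-Schwarz makes the second one nonpositive. *)
  have -> : dq x = dc x * (dot (g (th x) - g a) v - c x * Lip * norm2 v ^+ 2).
    rewrite /dq.
    have -> : dot (g (th x) - g a) v = dot (g (th x)) v - dot (g a) v.
      by rewrite /dot -sumrB; apply: eq_bigr => i _; rewrite !mxE mulrBl.
    have -> : dot (g (th x)) (dth x) = dc x * dot (g (th x)) v.
      by rewrite /dot mulr_sumr; apply: eq_bigr => i _; rewrite !mxE; ring.
    by field.
  rewrite mulr_ge0_le0// subr_le0.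
  apply: (le_trans (dot_le_norm2 _ _)).
  have Ta : Theta a by have := ab 0; rewrite scale0r addr0; apply; rewrite lexx ler01.
  have E : th x - a = c x *: v by rewrite /th addrAC subrr add0r.
  have := gL (thT x) Ta; rewrite E norm2Z ger0_norm; last by case/andP: (c01 x).
  by move=> H; have := ler_wpM2r (norm2_ge0 v) H; lra.
have : q pi <= q 0 by rewrite -subr_le0 qE mulr_le0_ge0// subr0 pi_ge0.
have c0 : c 0 = 0 by rewrite /c cos0; lra.
have cpi : c pi = 1 by rewrite /c cospi; lra.
rewrite /q /th c0 cpi scale0r scale1r addr0 (_ : a + v = b); last by rewrite /v addrC subrK.
lra.
Qed.

End descent.

(** * Measurability *)

(** Superlevel sets of a continuous function are relatively open in [D], hence traces on [D] of
    countable unions of rational boxes. *)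
Lemma lipschitz_measurable2 (R : realType) (D : set (R * R)) (g : R -> R -> R)
    (K : R) : measurable D ->
  (forall x y, D x -> D y ->
    `|g x.1 x.2 - g y.1 y.2| <= K * (`|x.1 - y.1| + `|x.2 - y.2|)) ->
  measurable_fun D (fun p => g p.1 p.2).
Proof.
move=> mD gK; apply: (measurability _ (RGenOInfty.measurableE R)) => _ [_ [c ->] <-].
pose box (q : rat * rat * (rat * rat)) : set (R * R) :=
  `]ratr q.1.1, ratr q.1.2[%classic `*` `]ratr q.2.1, ratr q.2.2[%classic.
pose good (q : rat * rat * (rat * rat)) :=
  forall p, box q p -> D p -> c < g p.1 p.2.
have -> : D `&` (fun p => g p.1 p.2) @^-1` `]c, +oo[%classic =
    D `&` \bigcup_q (if `[< good q >] then box q else set0).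
  apply/seteqP; split=> [[x y] [Dxy]|p [Dp [q _]]] /=; last first.
    case: asboolP => // gq bp; split => //.
    by rewrite in_itv/= andbT; exact: gq.
  rewrite in_itv/= andbT => cg; split => //.
  pose K' : R := `|K| + 1.
  have K'0 : 0 < K' by rewrite ltr_wpDl.
  (* Within r of (x, y) in each coordinate the function drops by at most 2 r K' = (g x y - c) / 2,
     so it stays above c. *)
  pose r : R := (g x y - c) / (4 * K').
  have r0 : 0 < r by rewrite divr_gt0 ?mulr_gt0 ?subr_gt0.
  have near_rat (t : R) : exists q : rat * rat,
      [/\ t - r < ratr q.1, ratr q.1 < t, t < ratr q.2 & ratr q.2 < t + r].
    have [q1] := @rat_in_itvoo R (t - r) t ltac:(lra).
    have [q2] := @rat_in_itvoo R t (t + r) ltac:(lra).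
    by rewrite !in_itv/= => /andP[? ?] /andP[? ?]; exists (q1, q2).
  have [qx [x1 x2 x3 x4]] := near_rat x.
  have [qy [y1 y2 y3 y4]] := near_rat y.
  exists (qx, qy) => //; case: asboolP => [_|[]].
    by rewrite /box/= !in_itv/= x2 x3 y2 y3.
  move=> [x' y']; rewrite /box/= !in_itv/= => -[/andP[a1 a2] /andP[b1 b2]] Dxy'.
  have /= H := gK _ _ Dxy Dxy'.
  have Hx : `|x - x'| <= r by rewrite ler_norml; lra.
  have Hy : `|y - y'| <= r by rewrite ler_norml; lra.
  have KK : K <= K' by rewrite /K'; have := ler_norm K; lra.
  have rE : r * (4 * K') = g x y - c by rewrite /r divfK// gt_eqF// mulr_gt0.
  have : K * (`|x - x'| + `|y - y'|) <= K' * (2 * r).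
    apply: (@le_trans _ _ (K' * (`|x - x'| + `|y - y'|))).
      by apply: ler_wpM2r => //; exact: addr_ge0.
    by rewrite ler_pM2l//; lra.
  have := ler_norm (g x y - g x' y'); have := mulr_gt0 r0 K'0; lra.
apply: measurableI => //; apply: countable_bigcupT_measurable.
  by apply: countableP.
move=> q; case: ifP => // _; apply: measurableX; exact: measurable_itv.
Qed.

Lemma grad_state_returnS (R : realType) (m : model R) th om k :
  grad_state_return m th om k.+1 =
  let s := state m th om k in
  let Rw := ret m th om k in
  let a := action m th om k in
  let gs := (grad_state_return m th om k).1 in
  let gR := (grad_state_return m th om k).2 in
  let ga := grad_policy m th s Rw (om k).2 k%:R
    + ds_policy m th s Rw (om k).2 k%:R *: gs
    + dR_policy m th s Rw (om k).2 k%:R *: gR in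
  (ds_step m s a (om k).1 *: gs + da_step m s a (om k).1 *: ga,
   gR + (ds_reward m s a *: gs + da_reward m s a *: ga)).
Proof. by move=> /=; case: (grad_state_return m th om k). Qed.

Section totalized_model.
Context {R : realType} (m : model R).

Let D : set (R * R) := states m `*` actions m.

Definition on_domain (f : R -> R -> R) (s a : R) : R :=
  if (s, a) \in D then f s a else 0.

(* Agrees with [m] on trajectories with parameters in [Theta], and its *)
(* coefficients are measurable on the whole space.                     *)
Definition totalize : model R :=
  Model (horizon m) (states m) (actions m)
    (fun s a e => on_domain (fun s a => step m s a e) s a)
    (on_domain (reward m)) (s_init m) (activation m)
    (fun s a e => on_domain (fun s a => ds_step m s a e) s a)
    (fun s a e => on_domain (fun s a => da_step m s a e) s a)
    (on_domain (ds_reward m)) (on_domain (da_reward m)).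

Lemma on_domainE (f : R -> R -> R) s a : states m s -> actions m a ->
  on_domain f s a = f s a.
Proof. by move=> Ds Da; rewrite /on_domain mem_set. Qed.

Lemma measurable_on_domain (f : R -> R -> R) : measurable D ->
  measurable_fun D (fun p => f p.1 p.2) ->
  measurable_fun setT (fun p => on_domain f p.1 p.2).
Proof.
by move=> mD /(measurable_restrictT _ mD).
Qed.

Context (Theta : set 'rV[R]_7) (wp : well_posed m Theta).

Lemma measurable_domain : measurable D.
Proof. by case: wp => -[? ? _] _; exact: measurableX. Qed.

Lemma measurable_step_totalize :
  measurable_fun setT (fun p : R * R * R => step totalize p.1.1 p.1.2 p.2).
Proof.
have [_ [_ + _ _]] := wp.
move=> /(measurable_restrictT _ (measurableX measurable_domain measurableT)).
congr (measurable_fun _ _).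
apply/funext => -[[s a] e]; rewrite /patch /= /on_domain.
congr (if _ then _ else _); apply/idP/idP; rewrite !inE; first by case.
by move=> ?; split.
Qed.

Lemma measurable_reward_totalize :
  measurable_fun setT (fun p : R * R => reward totalize p.1 p.2).
Proof.
have [_ [_ _ + _]] := wp.
by move=> /(measurable_on_domain measurable_domain).
Qed.

Context (A5 : assumption5 m).

(* [assumption5] makes the derivatives of [step] independent of the noise. *)
Lemma measurable_dstep_totalize :
  measurable_fun setT (fun p : R * R * R => ds_step totalize p.1.1 p.1.2 p.2) /\
  measurable_fun setT (fun p : R * R * R => da_step totalize p.1.1 p.1.2 p.2).
Proof.
have [_ [Lrs [Lra [LFs [LFa L5]]]]] := A5.
have L x y e e' : D x -> D y ->
   `|ds_step m x.1 x.2 e - ds_step m y.1 y.2 e'| <= LFs * (`|x.1 - y.1| + `|x.2 - y.2|)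
   /\ `|da_step m x.1 x.2 e - da_step m y.1 y.2 e'| <= LFa * (`|x.1 - y.1| + `|x.2 - y.2|).
  move=> [x1 x2] [y1 y2].
  by have [] := L5 x.1 y.1 x.2 y.2 e e' x1 y1 x2 y2.
have indep (f : R -> R -> R -> R) (K : R) :
    (forall x y e e', D x -> D y ->
      `|f x.1 x.2 e - f y.1 y.2 e'| <= K * (`|x.1 - y.1| + `|x.2 - y.2|)) ->
    measurable_fun setT (fun p : R * R * R =>
      on_domain (fun s a => f s a p.2) p.1.1 p.1.2).
  move=> fK.
  have -> : (fun p : R * R * R => on_domain (fun s a => f s a p.2) p.1.1 p.1.2) =
      (fun p => on_domain (fun s a => f s a 0) p.1 p.2) \o fst.
    apply/funext => -[[s a] e] /=; rewrite /on_domain; case: ifP => //.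
    rewrite inE => Dsa; apply/eqP; rewrite -subr_eq0 -normr_le0.
    by have := fK _ _ e 0 Dsa Dsa; rewrite /= !subrr normr0 addr0 mulr0.
  apply: (measurableT_comp _ measurable_fst).
  apply: (@measurable_on_domain (fun s a => f s a 0) measurable_domain).
  apply: (@lipschitz_measurable2 _ _ (fun s a => f s a 0) K) => [|x y Dx Dy].
    exact: measurable_domain.
  exact: fK.
split; [apply: (indep (ds_step m) LFs)|apply: (indep (da_step m) LFa)] => x y e e' Dx Dy;
  by have [] := L x y e e' Dx Dy.
Qed.

Lemma measurable_dreward_totalize :
  measurable_fun setT (fun p : R * R => ds_reward totalize p.1 p.2) /\
  measurable_fun setT (fun p : R * R => da_reward totalize p.1 p.2).
Proof.
have [_ [Lrs [Lra [LFs [LFa L5]]]]] := A5.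
split.
- apply: (@measurable_on_domain (ds_reward m) measurable_domain).
  apply: (@lipschitz_measurable2 _ _ (ds_reward m) Lrs) => [|x y [x1 x2] [y1 y2]].
    exact: measurable_domain.
  by have [] := L5 x.1 y.1 x.2 y.2 0 0 x1 y1 x2 y2.
- apply: (@measurable_on_domain (da_reward m) measurable_domain).
  apply: (@lipschitz_measurable2 _ _ (da_reward m) Lra) => [|x y [x1 x2] [y1 y2]].
    exact: measurable_domain.
  by have [] := L5 x.1 y.1 x.2 y.2 0 0 x1 y1 x2 y2.
Qed.

Lemma state_return_totalize th om k : Theta th -> (k <= horizon m)%N ->
  state_return totalize th om k = state_return m th om k.
Proof.
move=> thT; elim: k => [//|k IH] kT.
have sD := state_in wp om thT (ltnW kT).
have aD := action_in wp om thT kT.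
rewrite /= IH 1?ltnW//; rewrite /action /state /ret in sD aD.
case: (state_return m th om k) sD aD => s r /= sD aD.
by rewrite !on_domainE.
Qed.

Lemma grad_state_return_totalize th om k : Theta th -> (k <= horizon m)%N ->
  grad_state_return totalize th om k = grad_state_return m th om k.
Proof.
move=> thT; elim: k => [//|k IH] kT.
have sD := state_in wp om thT (ltnW kT).
have aD := action_in wp om thT kT.
have E := state_return_totalize om thT (ltnW kT).
rewrite !grad_state_returnS (IH (ltnW kT)).
have -> : state totalize th om k = state m th om k by rewrite /state E.
have -> : ret totalize th om k = ret m th om k by rewrite /ret E.
have -> : action totalize th om k = action m th om k.
  by rewrite /action /state /ret E.
have -> : grad_policy totalize = grad_policy m by [].
have -> : ds_policy totalize = ds_policy m by [].
have -> : dR_policy totalize = dR_policy m by [].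
cbv zeta; move: (state m th om k) (action m th om k) sD aD => s a sD aD.
by rewrite /= !on_domainE.
Qed.

End totalized_model.

Section noise_dependence.
Context {R : realType} (m : model R).

(** A trajectory records only finitely many noise values; this lets the noise sequence of the model
    be exchanged for its recorded tuple. *)
Lemma state_return_ext th om om' k : (forall i, (i < k)%N -> om i = om' i) ->
  state_return m th om k = state_return m th om' k.
Proof.
elim: k => [//|k IH] E /=; rewrite IH => [|i ik]; last exact/E/ltnW.
by rewrite E.
Qed.

Lemma grad_state_return_ext th om om' k : (forall i, (i < k)%N -> om i = om' i) ->
  grad_state_return m th om k = grad_state_return m th om' k.
Proof.
elim: k => [//|k IH] E; rewrite !grad_state_returnS IH => [|i ik]; last exact/E/ltnW.
have S : state_return m th om k = state_return m th om' k.
  by apply: state_return_ext => i ik; exact/E/ltnW.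
by rewrite /action /state /ret S E.
Qed.

End noise_dependence.

Section measurable_trajectories.
Context {R : realType} (m : model R).
Context (sigmaP : forall x : R, derivable (activation m) x 1).
Context (mdsigma : measurable_fun setT (derive1 (activation m))).
Context (mstep : measurable_fun setT (fun p : R * R * R => step m p.1.1 p.1.2 p.2)).
Context (mreward : measurable_fun setT (fun p : R * R => reward m p.1 p.2)).
Context (mds_step : measurable_fun setT (fun p : R * R * R => ds_step m p.1.1 p.1.2 p.2)).
Context (mda_step : measurable_fun setT (fun p : R * R * R => da_step m p.1.1 p.1.2 p.2)).
Context (mds_reward : measurable_fun setT (fun p : R * R => ds_reward m p.1 p.2)).
Context (mda_reward : measurable_fun setT (fun p : R * R => da_reward m p.1 p.2)).
Context d (T : measurableType d) (th : T -> 'rV[R]_7) (om : T -> nat -> R * R).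
Context (mth : forall i, measurable_fun setT (fun x => th x 0 i)).
Context (mom : forall k, measurable_fun setT (fun x => (om x k).1) /\
                         measurable_fun setT (fun x => (om x k).2)).

Lemma measurable_activation : measurable_fun setT (activation m).
Proof.
apply: continuous_measurable_fun => x.
exact/differentiable_continuous/derivable1_diffP.
Qed.

Lemma measurable_comp2 (f : R -> R -> R) (s a : T -> R) :
  measurable_fun setT (fun p => f p.1 p.2) ->
  measurable_fun setT s -> measurable_fun setT a ->
  measurable_fun setT (fun x => f (s x) (a x)).
Proof.
move=> mf ms ma.
exact: (measurableT_comp mf (measurable_fun_pair ms ma)).
Qed.

Lemma measurable_comp3 (f : R -> R -> R -> R) (s a e : T -> R) :
  measurable_fun setT (fun p : R * R * R => f p.1.1 p.1.2 p.2) ->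
  measurable_fun setT s -> measurable_fun setT a -> measurable_fun setT e ->
  measurable_fun setT (fun x => f (s x) (a x) (e x)).
Proof.
move=> mf ms ma me.
exact: (measurableT_comp mf (measurable_fun_pair (measurable_fun_pair ms ma) me)).
Qed.

Lemma measurable_preact (s r z : T -> R) k : measurable_fun setT s ->
  measurable_fun setT r -> measurable_fun setT z ->
  measurable_fun setT (fun x => preact (th x) (s x) (r x) (z x) k).
Proof.
by move=> ms mr mz; rewrite /preact; do !apply: measurable_funD => //;
  apply: measurable_funM.
Qed.

Lemma measurable_policy (s r z : T -> R) k : measurable_fun setT s ->
  measurable_fun setT r -> measurable_fun setT z ->
  measurable_fun setT (fun x => policy m (th x) (s x) (r x) (z x) k).
Proof.
move=> ms mr mz; apply: measurable_funD => //; apply: measurable_funM => //.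
by apply: (measurableT_comp measurable_activation); exact: measurable_preact.
Qed.

(** Measurability is joint in the parameter and the noise, since later the parameter is itself
    random, an iterate of the descent. *)
Lemma measurable_state_ret k : measurable_fun setT (fun x => state m (th x) (om x) k) /\
  measurable_fun setT (fun x => ret m (th x) (om x) k).
Proof.
elim: k => [|k [IHs IHr]]; first by split; exact: measurable_cst.
have [mom1 mom2] := mom k.
have ma := measurable_policy k%:R IHs IHr mom2.
rewrite /state /ret /=; split.
- have := measurable_comp3 mstep IHs ma mom1; congr (measurable_fun _ _).
  by apply/funext => x; rewrite /state /ret; case: (state_return _ _ _ _).
- have := measurable_funD IHr (measurable_comp2 mreward IHs ma).
  congr (measurable_fun _ _).
  by apply/funext => x; rewrite /= /state /ret; case: (state_return _ _ _ _).
Qed.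

Lemma measurable_grad k i :
  measurable_fun setT (fun x => (grad_state_return m (th x) (om x) k).1 0 i) /\
  measurable_fun setT (fun x => (grad_state_return m (th x) (om x) k).2 0 i).
Proof.
elim: k => [|k [IHs IHr]].
  by split; under eq_fun do rewrite mxE; exact: measurable_cst.
have [mom1 mom2] := mom k.
have [ms mr] := measurable_state_ret k.
have ma := measurable_policy k%:R ms mr mom2.
have mp := measurable_preact k%:R ms mr mom2.
have msig := measurableT_comp measurable_activation mp.
have mdsig := measurableT_comp mdsigma mp.
pose ga x := grad_policy m (th x) (state m (th x) (om x) k) (ret m (th x) (om x) k) (om x k).2 k%:R 0 i
  + ds_policy m (th x) (state m (th x) (om x) k) (ret m (th x) (om x) k) (om x k).2 k%:R
    * (grad_state_return m (th x) (om x) k).1 0 i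
  + dR_policy m (th x) (state m (th x) (om x) k) (ret m (th x) (om x) k) (om x k).2 k%:R
    * (grad_state_return m (th x) (om x) k).2 0 i.
have combE (a b c e : R) (p q r s : 'rV[R]_7) :
    ((a *: q + b *: (p + c *: r + e *: s)) 0 i =
      a * q 0 i + b * (p 0 i + c * r 0 i + e * s 0 i)) /\
    ((s + (a *: q + b *: (p + c *: r + e *: s))) 0 i =
      s 0 i + (a * q 0 i + b * (p 0 i + c * r 0 i + e * s 0 i))).
  by rewrite !mxE.
have mga : measurable_fun setT ga.
  rewrite /ga; under eq_fun do rewrite grad_policyE// ds_policyE// dR_policyE//.
  by do ?[apply: measurable_funD => //|apply: measurable_funM => //].
split.
- have := measurable_funD
    (measurable_funM (measurable_comp3 mds_step ms ma mom1) IHs)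
    (measurable_funM (measurable_comp3 mda_step ms ma mom1) mga).
  congr (measurable_fun _ _); apply/funext => x.
  by rewrite [in RHS]grad_state_returnS /= (combE _ _ _ _ _ _ _ _).1.
- have := measurable_funD IHr (measurable_funD
    (measurable_funM (measurable_comp2 mds_reward ms ma) IHs)
    (measurable_funM (measurable_comp2 mda_reward ms ma) mga)).
  congr (measurable_fun _ _); apply/funext => x.
  by rewrite [in RHS]grad_state_returnS /= (combE _ _ _ _ _ _ _ _).2.
Qed.

End measurable_trajectories.

(** * Independence and conditional law *)

Lemma bounded_integrableT d (T : measurableType d) (R : realType)
    (P : probability T R) (f : T -> R) (C : R) :
  measurable_fun setT f -> (forall x, `|f x| <= C) ->
  P.-integrable setT (EFin \o f).
Proof. by move=> mf fC; apply: (@bounded_integrable _ _ _ P setT f C). Qed.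

Section independent_fubini.
Context d d1 d2 (V : measurableType d) (E1 : measurableType d1)
  (E2 : measurableType d2) (R : realType) (Q : probability V R).
Context (X : V -> E1) (Y : V -> E2).
Context (mX : measurable_fun setT X) (mY : measurable_fun setT Y).
Context (indep : forall A B, measurable A -> measurable B ->
  Q (X @^-1` A `&` Y @^-1` B) = (Q (X @^-1` A) * Q (Y @^-1` B))%E).
Context (h : E1 * E2 -> R) (C : R) (mh : measurable_fun setT h).
Context (hC : forall p, `|h p| <= C).

Let X' : {mfun V >-> E1} := HB.pack X (isMeasurableFun.Build _ _ _ _ X mX).
Let Y' : {mfun V >-> E2} := HB.pack Y (isMeasurableFun.Build _ _ _ _ Y mY).
Let XY : {mfun V >-> (E1 * E2)%type} :=
  HB.pack (fun v => (X v, Y v)) (isMeasurableFun.Build _ _ _ _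
    (fun v => (X v, Y v)) (measurable_fun_pair mX mY)).

Let mEh : measurable_fun setT (EFin \o h).
Proof. exact/measurable_EFinP. Qed.

Let mEhx x : measurable_fun setT (EFin \o (fun y => h (x, y))).
Proof.
apply/measurable_EFinP; apply: (measurableT_comp mh).
by apply: measurable_fun_pair => //; exact: measurable_cst.
Qed.

Let section x : \int[Q]_v h (x, Y v) = fine (\int[distribution Q Y']_y (h (x, y))%:E).
Proof.
rewrite (integral_distribution (P := Q) (X := Y') (mEhx x))//.
apply: (@bounded_integrableT _ _ _ Q _ C) => //.
by apply: (measurableT_comp mh); apply: measurable_fun_pair => //; exact: measurable_cst.
Qed.

Let sectionE x : (\int[Q]_v h (x, Y v))%:E = fubini_F (distribution Q Y') (EFin \o h) x.
Proof.
rewrite section fineK//; apply: integrable_fin_num => //.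
apply: (@bounded_integrableT _ _ _ (distribution Q Y') _ C) => //.
by apply: (measurableT_comp mh); apply: measurable_fun_pair => //; exact: measurable_cst.
Qed.

Let prodE Z : measurable Z ->
  (distribution Q X' \x distribution Q Y')%E Z = distribution Q XY Z.
Proof.
apply: product_measure_unique => A B mA mB.
exact: indep.
Qed.

Let inth : (distribution Q X' \x distribution Q Y')%E.-integrable setT (EFin \o h).
Proof.
exact: (@bounded_integrableT _ _ _ (distribution Q X' \x distribution Q Y')%E h C).
Qed.

(** Independence says that the law of (X, Y) is the product of the laws of X and Y, so Fubini
    applies on the product space; the integrals are then pulled back to [Q]. *)
Lemma independent_fubini :
  \int[Q]_v h (X v, Y v) = \int[Q]_v (\int[Q]_w h (X v, Y w)) /\
  measurable_fun setT (fun x => \int[Q]_w h (x, Y w)).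
Proof.
have E : (fun x => (\int[Q]_w h (x, Y w))%:E) = fubini_F (distribution Q Y') (EFin \o h).
  by apply/funext => x; rewrite sectionE.
have mF : measurable_fun setT (fun x => (\int[Q]_w h (x, Y w))%:E).
  by rewrite E; exact: measurable_fubini_F inth.
split; last exact/measurable_EFinP.
congr fine.
transitivity (\int[distribution Q XY]_z (h z)%:E)%E.
  rewrite (integral_distribution (P := Q) (X := XY) mEh)//.
  apply: (@bounded_integrableT _ _ _ Q _ C) => //.
  by apply: (measurableT_comp mh); exact: measurable_fun_pair.
transitivity (\int[distribution Q X' \x distribution Q Y']_z (h z)%:E)%E.
  by apply: eq_measure_integral => Z mZ _; exact: (esym (prodE mZ)).
rewrite -(integral12_prod_meas1 inth) -E.
rewrite (integral_distribution (P := Q) (X := X') mF)//.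
have /integrableP[_] := integrable_fubini_F inth; rewrite -E => fin.
apply/integrableP; split; first exact: (measurableT_comp mF mX).
move: fin; rewrite (ge0_integral_distribution X')//.
exact: measurableT_comp.
Qed.

End independent_fubini.

Lemma bigsetIP (I : eqType) (V : Type) (J : seq I) (F : I -> set V) v :
  (\big[setI/setT]_(i <- J) F i) v <-> (forall i, i \in J -> F i v).
Proof.
elim: J => [|i J IH]; first by rewrite big_nil; split.
rewrite big_cons; split => [[Fi /IH FJ] j|FJ].
  by rewrite inE => /predU1P[->//|]; exact: FJ.
split; first by apply: FJ; rewrite mem_head.
by apply/IH => j jJ; apply: FJ; rewrite inE jJ orbT.
Qed.

(** The finite measures that send A to Q(A and C) and to Q(A) Q(C) agree on the generating class,
    which is stable under intersection and contains the whole space; so they agree on the generated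
    sigma-algebra. *)
Lemma independent_sigma d (V : measurableType d) (R : realType)
    (Q : probability V R) (G : set (set V)) (C : set V) :
  G `<=` measurable -> setI_closed G -> G setT -> measurable C ->
  (forall A, G A -> Q (A `&` C) = (Q A * Q C)%E) ->
  forall A, <<s G >> A -> Q (A `&` C) = (Q A * Q C)%E.
Proof.
move=> mG IG GT mC GC A sA.
have QC : (0 <= fine (Q C))%R by rewrite fine_ge0.
have QCE : ((NngNum QC)%:num)%:E = Q C.
  by rewrite /= fineK// fin_num_measure.
pose m1 := mrestr Q mC.
pose m2 := mscale (NngNum QC) Q.
have m2E B : m2 B = (Q B * Q C)%E by rewrite -QCE muleC.
have := @g_sigma_algebra_measure_unique _ _ _ G mG (fun=> setT) (fun=> GT) _ m1 m2 IG.
move=> H; have {}H : m1 A = m2 A.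
  apply: H => //.
  - by rewrite bigcup_const.
  - move=> B GB; transitivity (Q B * Q C)%E; first exact: GC.
    exact: (esym (m2E B)).
  - move=> _; apply: (@le_lt_trans _ _ (Q (setT `&` C))); first by [].
    by rewrite setTI (le_lt_trans (probability_le1 Q mC))// ltry.
by rewrite -m2E; exact: H.
Qed.

Section independent_groups.
Context d d' (V : measurableType d) (E : measurableType d') (R : realType).
Context (Q : probability V R) (I : eqType) (X : I -> V -> E).
Context (mX : forall i, measurable_fun setT (X i)).
Context (indep : mutually_independent Q X).

(** A generating class, stable under intersection, for the sigma-algebra of the variables indexed by
    [S]. *)
Definition cylinder (S : set I) : set (set V) :=
  [set A | exists J (B : I -> set E), [/\ uniq J, (forall i, i \in J -> S i),
    (forall i, measurable (B i)) & A = \big[setI/setT]_(i <- J) (X i @^-1` B i)]].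

Lemma cylinder_measurable S : cylinder S `<=` measurable.
Proof.
move=> _ [J [B [_ _ mB ->]]]; elim: J => [|i J IH]; first by rewrite big_nil.
rewrite big_cons; apply: measurableI => //.
by rewrite -[X in measurable X]setTI; exact: mX.
Qed.

Lemma cylinderT S : cylinder S setT.
Proof. by exists [::], (fun=> setT); split => //; rewrite big_nil. Qed.

Lemma cylinderI S : setI_closed (cylinder S).
Proof.
move=> _ _ [J1 [B1 [u1 S1 m1 ->]]] [J2 [B2 [u2 S2 m2 ->]]].
exists (undup (J1 ++ J2)).
(* An index absent from one of the lists is constrained there by the whole space, that is, not at
   all. *)
exists (fun i => (if i \in J1 then B1 i else setT) `&`
                 (if i \in J2 then B2 i else setT)); split.
- exact: undup_uniq.
- by move=> i; rewrite mem_undup mem_cat => /orP[/S1|/S2].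
- by move=> i; apply: measurableI; case: ifP.
- apply/seteqP; split=> v.
    move=> [/bigsetIP v1 /bigsetIP v2]; apply/bigsetIP => i _; split => /=.
      by case: ifP => // /v1.
    by case: ifP => // /v2.
  move=> /bigsetIP H; split; apply/bigsetIP => i iJ.
    have [|/= + _] := H i; last by rewrite iJ.
    by rewrite mem_undup mem_cat iJ.
  have [|/= _ +] := H i; last by rewrite iJ.
  by rewrite mem_undup mem_cat iJ orbT.
Qed.

Lemma cylinder_independent S1 S2 A B : (forall i, S1 i -> ~ S2 i) ->
  cylinder S1 A -> cylinder S2 B -> Q (A `&` B) = (Q A * Q B)%E.
Proof.
move=> S12 [J1 [B1 [u1 s1 m1 ->]]] [J2 [B2 [u2 s2 m2 ->]]].
pose B' i := if i \in J1 then B1 i else B2 i.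
have J12 i : i \in J2 -> i \notin J1.
  by move=> /s2 Si; apply/negP => /s1 /S12.
have E1 : \big[setI/setT]_(i <- J1) (X i @^-1` B1 i) =
          \big[setI/setT]_(i <- J1) (X i @^-1` B' i).
  by apply: eq_big_seq => i iJ; rewrite /B' iJ.
have E2 : \big[setI/setT]_(i <- J2) (X i @^-1` B2 i) =
          \big[setI/setT]_(i <- J2) (X i @^-1` B' i).
  by apply: eq_big_seq => i iJ; rewrite /B' (negbTE (J12 i iJ)).
have mB' i : measurable (B' i) by rewrite /B'; case: ifP.
rewrite E1 E2 -big_cat/= !indep ?big_cat//.
rewrite cat_uniq u1 u2 andbT /=.
by apply/hasPn => i; exact: J12.
Qed.

(** [independent_sigma] is used twice, extending one event at a time from cylinders to the generated
    sigma-algebra. *)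
Lemma sigma_independent S1 S2 A B : (forall i, S1 i -> ~ S2 i) ->
  <<s cylinder S1 >> A -> <<s cylinder S2 >> B -> Q (A `&` B) = (Q A * Q B)%E.
Proof.
move=> S12 sA sB.
have sm S Z : <<s cylinder S >> Z -> measurable Z.
  by apply: smallest_sub; [exact: sigma_algebra_measurable|exact: cylinder_measurable].
apply: (independent_sigma (@cylinder_measurable S1) (@cylinderI S1) (@cylinderT S1)
  (sm _ _ sB)) sA => A' cA'.
rewrite setIC muleC.
apply: (independent_sigma (@cylinder_measurable S2) (@cylinderI S2) (@cylinderT S2)
  (cylinder_measurable cA')) sB => B' cB'.
by rewrite setIC muleC; exact: cylinder_independent cA' cB'.
Qed.

(** The space [V] itself with the coarser sigma-algebra generated by the group; a real function
    measurable for it depends on the sample only through the variables of that group. *)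
Definition group_sigma (S : set I) := g_sigma_algebraType (cylinder S).

Lemma measurable_group_sigma (S : set I) i : S i ->
  measurable_fun setT (X i : group_sigma S -> E).
Proof.
move=> Si _ B mB; rewrite setTI; apply: sub_sigma_algebra.
exists [:: i], (fun=> B); split => //.
- by move=> j; rewrite inE => /eqP ->.
- by rewrite big_seq1.
Qed.

Lemma measurable_to_group_sigma (S : set I) :
  measurable_fun setT (id : V -> group_sigma S).
Proof.
move=> _ B mB; rewrite setTI.
by apply: smallest_sub mB; [exact: sigma_algebra_measurable|exact: cylinder_measurable].
Qed.

(** Both random elements are the identity of [V], seen in two coarser spaces that are independent. A
    functional of two disjoint groups can thus be averaged over one with the other frozen, without
    splitting [V] into a product. *)
Lemma group_fubini S1 S2 (h : group_sigma S1 * group_sigma S2 -> R) (C : R) :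
  (forall i, S1 i -> ~ S2 i) -> measurable_fun setT h -> (forall p, `|h p| <= C) ->
  \int[Q]_v h (v, v) = \int[Q]_v (\int[Q]_w h (v, w)) /\
  measurable_fun setT (fun v : group_sigma S1 => \int[Q]_w h (v, w)).
Proof.
move=> S12 mh hC.
apply: (@independent_fubini _ _ _ V (group_sigma S1) (group_sigma S2) R Q id id
  (@measurable_to_group_sigma S1) (@measurable_to_group_sigma S2) _ h C mh hC).
by move=> A B mA mB; exact: (@sigma_independent S1 S2).
Qed.

End independent_groups.

Section conditional_law.
Context d (W : measurableType d) (R : realType) (P : probability W R).
Context (G : set W) (mG : measurable G) (PG0 : (0 < P G)%E).

Let pg : R := fine (P G).

Let pgE : pg%:E = P G.
Proof. by rewrite fineK// fin_num_measure. Qed.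

Let pg0 : 0 < pg.
Proof. by rewrite -lte_fin pgE. Qed.

Let pgV0 : 0 <= pg^-1.
Proof. by rewrite invr_ge0 ltW. Qed.

Definition cond_measure : set W -> \bar R := mscale (NngNum pgV0) (mrestr P mG).

HB.instance Definition _ := Measure.on cond_measure.

Lemma cond_measureE A : cond_measure A = ((pg^-1)%:E * P (A `&` G))%E.
Proof. by []. Qed.

Lemma cond_measureT : cond_measure setT = 1%E.
Proof. by rewrite cond_measureE setTI -pgE -EFinM mulVf// gt_eqF. Qed.

HB.instance Definition _ := Measure_isProbability.Build _ _ _ cond_measure
  cond_measureT.

Let ge0_cond_measure (f : W -> \bar R) : measurable_fun setT f ->
  (forall w, (0 <= f w)%E) ->
  (\int[cond_measure]_w f w = (pg^-1)%:E * \int[P]_(w in G) f w)%E.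
Proof.
move=> mf f0; rewrite [LHS]ge0_integral_mscale//; congr (_ * _)%E.
rewrite (@ge0_negligible_integral _ _ _ _ setT (~` G))//; last 2 first.
- exact: measurableC.
- by rewrite /= /mrestr setICl measure0.
rewrite setTD setCK; apply: eq_measure_integral => A mA AG.
by rewrite /= /mrestr setIidl.
Qed.

Lemma cond_expE (f : W -> R) (C : R) : measurable_fun setT f ->
  (forall w, `|f w| <= C) -> cond_exp P G f = \int[cond_measure]_w f w.
Proof.
move=> mf fC.
have mfG : measurable_fun G f by exact: measurable_funTS.
have intG : P.-integrable G (EFin \o f).
  by apply: (@bounded_integrable _ _ _ P G f C).
have intT : cond_measure.-integrable setT (EFin \o f).
  exact: (@bounded_integrableT _ _ _ cond_measure f C).
(* Scaling and restriction of the measure are handled for nonnegative integrands, so [f] is shifted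
   by its bound [C]; the constant is cancelled at the end. *)
have mfC : measurable_fun setT (fun w => f w + C).
  by apply: measurable_funD.
have f0 w : (0 <= (f w + C)%:E)%E.
  by rewrite lee_fin; have := fC w; rewrite ler_norml; lra.
have := ge0_cond_measure (f := fun w => (f w + C)%:E) _ f0.
move=> /(_ ((measurable_EFinP _ _).2 mfC)) H.
have H1 : \int[cond_measure]_w (f w + C) = pg^-1 * \int[P]_(w in G) (f w + C).
  rewrite /Rintegral H fineM//.
  apply: integrable_fin_num => //.
  apply: (@bounded_integrable _ _ _ P G (fun w => f w + C) (C + `|C|)) => //.
    exact: measurable_funTS.
  by move=> w _; apply: (le_trans (ler_normD _ _)); rewrite lerD2r.
have intCG : P.-integrable G (EFin \o (cst C)).
  by apply: (@bounded_integrable _ _ _ P G (cst C) `|C|).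
have intCT : cond_measure.-integrable setT (EFin \o (cst C)).
  by apply: (@bounded_integrableT _ _ _ cond_measure (cst C) `|C|).
move: H1; rewrite (@RintegralD _ _ _ cond_measure setT f (cst C))//.
rewrite (@RintegralD _ _ _ P G f (cst C))//.
rewrite (Rintegral_cst cond_measure)// (Rintegral_cst P)//.
rewrite [X in _ + C * X = _](_ : _ = 1); last by rewrite [X in fine X](_ : _ = 1%E)//; exact: cond_measureT.
rewrite -/pg mulr1 mulrDr [_ * (C * _)]mulrCA mulVf ?gt_eqF// mulr1.
by move=> /addIr; rewrite /cond_exp -/pg mulrC => ->.
Qed.

Context d' (T : measurableType d') (N : W -> T) (mN : measurable_fun setT N).
Context dV (V : measurableType dV) (Q : probability V R) (xi : V -> T).
Context (mxi : measurable_fun setT xi).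
Context (law : forall B, measurable B ->
  Q (xi @^-1` B) = (cond_prob P G (N @^-1` B))%:E).

(** Both sides integrate [f] against the same law on [T]: that of [xi], and the image under [N] of
    [P] conditioned on [G]. *)
Lemma expectation_law (f : T -> R) (C : R) : measurable_fun setT f ->
  (forall t, `|f t| <= C) ->
  \int[Q]_v f (xi v) = cond_exp P G (fun w => f (N w)).
Proof.
move=> mf fC.
have mfN : measurable_fun setT (fun w => f (N w)) by exact: measurableT_comp.
have mfx : measurable_fun setT (fun v => f (xi v)) by exact: measurableT_comp.
rewrite (@cond_expE _ C)//.
pose xi' : {mfun V >-> T} := HB.pack xi (isMeasurableFun.Build _ _ _ _ xi mxi).
pose N' : {mfun W >-> T} := HB.pack N (isMeasurableFun.Build _ _ _ _ N mN).
have mEf : measurable_fun setT (EFin \o f) by exact/measurable_EFinP.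
congr fine.
transitivity (\int[distribution Q xi']_t (f t)%:E)%E.
  rewrite (integral_distribution (P := Q) (X := xi') mEf)//.
  exact: (@bounded_integrableT _ _ _ Q _ C).
transitivity (\int[distribution cond_measure N']_t (f t)%:E)%E; last first.
  rewrite (integral_distribution (P := cond_measure) (X := N') mEf)//.
  exact: (@bounded_integrableT _ _ _ cond_measure _ C).
apply: eq_measure_integral => B mB _.
transitivity (cond_prob P G (N @^-1` B))%:E; first exact: law.
transitivity (cond_measure (N @^-1` B)); last by [].
rewrite cond_measureE /cond_prob -/pg mulrC EFinM fineK// fin_num_measure//.
apply: measurableI => //.
by rewrite -[X in measurable X]setTI; exact: mN.
Qed.

End conditional_law.

(** * Mean and bias of the estimator *)

Section bounded_measurable.
Context d (V : measurableType d) (R : realType).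
Implicit Types f g : V -> R.

Definition bounded_measurable f :=
  measurable_fun setT f /\ exists C, forall v, `|f v| <= C.

Lemma bm_cst c : bounded_measurable (fun=> c).
Proof. by split; [exact: measurable_cst|exists `|c|]. Qed.

Lemma bmD f g : bounded_measurable f -> bounded_measurable g ->
  bounded_measurable (fun v => f v + g v).
Proof.
move=> [mf [C fC]] [mg [D gD]]; split; first exact: measurable_funD.
by exists (C + D) => v; apply: (le_trans (ler_normD _ _)); exact: lerD.
Qed.

Lemma bmM f g : bounded_measurable f -> bounded_measurable g ->
  bounded_measurable (fun v => f v * g v).
Proof.
move=> [mf [C fC]] [mg [D gD]]; split; first exact: measurable_funM.
by exists (C * D) => v; rewrite normrM; apply: ler_pM.
Qed.

Lemma bm_sum (I : Type) (r : seq I) (F : I -> V -> R) :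
  (forall i, bounded_measurable (F i)) ->
  bounded_measurable (fun v => \sum_(i <- r) F i v).
Proof.
move=> FP; elim: r => [|i r IH].
  by under eq_fun do rewrite big_nil; exact: bm_cst.
by under eq_fun do rewrite big_cons; exact: bmD.
Qed.

Lemma bm_norm f : bounded_measurable f -> bounded_measurable (fun v => `|f v|).
Proof.
move=> [mf [C fC]]; split; first exact: measurableT_comp.
by exists C => v; rewrite normr_id.
Qed.

Context (Q : probability V R).

Lemma bm_integrable f : bounded_measurable f -> Q.-integrable setT (EFin \o f).
Proof. by move=> [mf [C fC]]; exact: (@bounded_integrableT _ _ _ Q f C). Qed.

Lemma expectD f g : bounded_measurable f -> bounded_measurable g ->
  \int[Q]_v (f v + g v) = \int[Q]_v f v + \int[Q]_v g v.
Proof. by move=> ? ?; rewrite RintegralD//; exact: bm_integrable. Qed.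

Lemma expectZ c f : bounded_measurable f ->
  \int[Q]_v (c * f v) = c * \int[Q]_v f v.
Proof. by move=> ?; rewrite RintegralZl//; exact: bm_integrable. Qed.

Lemma expect_cst c : \int[Q]_v c = c.
Proof.
transitivity (c * fine (Q setT)); first exact: Rintegral_cst.
by rewrite probability_setT mulr1.
Qed.

Lemma expect_sum (I : Type) (r : seq I) (F : I -> V -> R) :
  (forall i, bounded_measurable (F i)) ->
  \int[Q]_v (\sum_(i <- r) F i v) = \sum_(i <- r) \int[Q]_v F i v.
Proof.
move=> FP; elim: r => [|i r IH].
  by rewrite big_nil; under eq_Rintegral do rewrite big_nil; exact: expect_cst.
under eq_Rintegral do rewrite big_cons.
by rewrite expectD ?big_cons ?IH//; exact: bm_sum.
Qed.

Lemma le_expect f g : bounded_measurable f -> bounded_measurable g ->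
  (forall v, f v <= g v) -> \int[Q]_v f v <= \int[Q]_v g v.
Proof. by move=> ? ? fg; apply: le_Rintegral => //; exact: bm_integrable. Qed.

Lemma norm_expect f : bounded_measurable f ->
  `|\int[Q]_v f v| <= \int[Q]_v `|f v|.
Proof. by move=> ?; apply: le_normr_Rintegral => //; exact: bm_integrable. Qed.

Lemma norm_expect_le f C : bounded_measurable f -> (forall v, `|f v| <= C) ->
  `|\int[Q]_v f v| <= C.
Proof.
move=> bf fC; apply: (le_trans (norm_expect bf)); rewrite -[leRHS](expect_cst C).
by apply: le_expect => //; [exact: bm_norm|exact: bm_cst].
Qed.

(** The quantity is Im(exp(-ia) E exp(if)), which equals E sin(f - a). *)
Lemma norm_cis_expect_le (f : V -> R) (a : R) : measurable_fun setT f ->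
  `|(\int[Q]_v cos (f v)) * - sin a + (\int[Q]_v sin (f v)) * cos a| <= 1.
Proof.
move=> mf.
have bc : bounded_measurable (fun v => cos (f v)).
  by split; [exact: measurable_fun_cos|exists 1 => v; exact: cos_max].
have bs : bounded_measurable (fun v => sin (f v)).
  by split; [exact: measurable_fun_sin|exists 1 => v; exact: sin_max].
have -> : (\int[Q]_v cos (f v)) * - sin a + (\int[Q]_v sin (f v)) * cos a =
    \int[Q]_v sin (f v - a).
  rewrite mulrC [X in _ + X]mulrC -!expectZ// -expectD; last 2 first.
  - by apply: bmM => //; exact: bm_cst.
  - by apply: bmM => //; exact: bm_cst.
  by apply: eq_Rintegral => v _; rewrite sinB; ring.
apply: norm_expect_le => [|v]; last exact: sin_max.
split; last by exists 1 => v; exact: sin_max.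
by apply: measurable_fun_sin; apply: measurable_funB.
Qed.

End bounded_measurable.

Lemma bm_comp d d' (V : measurableType d) (T : measurableType d') (R : realType)
    (f : T -> R) (x : V -> T) : measurable_fun setT x ->
  bounded_measurable f -> bounded_measurable (fun v => f (x v)).
Proof.
move=> mx [mf [C fC]]; split; first exact: measurableT_comp.
by exists C.
Qed.

(* The estimator in real form: [X] and [D] stand for the return and its *)
(* gradient, [p l + i q l] for the target characteristic function.      *)
Section estimator.
Context {R : realType} (n L : nat) (u beta p q : 'I_L -> R).
Context (T : Type) (X : T -> R) (D : T -> 'rV[R]_n).

Definition d_cos l i t := - u l * sin (u l * X t) * D t 0 i.
Definition d_sin l i t := u l * cos (u l * X t) * D t 0 i.

Definition est M (y : 'I_M -> T) : 'rV[R]_n :=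
  \row_i (2 * \sum_l beta l *
    ((M%:R^-1 * (\sum_j cos (u l * X (y j))) - p l) *
       (M%:R^-1 * \sum_j d_cos l i (y j))
     + (M%:R^-1 * (\sum_j sin (u l * X (y j))) - q l) *
       (M%:R^-1 * \sum_j d_sin l i (y j)))).

Context (BR : R) (DB : forall t, norm1 (D t) <= BR).
Context (pq : forall l a, `|p l * - sin a + q l * cos a| <= 1).

(** Grouped by the sample k whose gradient enters, the weight of that gradient is Im(exp(-iuX_k)
    (phi_hat - phi_star)), at most 2 in modulus; with the factor 2 in front of the sum this makes
    4. *)
Lemma norm1_est M (y : 'I_M -> T) : (0 < M)%N ->
  norm1 (est y) <= 4 * BR * \sum_l `|beta l * u l|.
Proof.
move=> M0; have MR : (0 : R) < M%:R by rewrite ltr0n.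
pose bra l k := ((M%:R^-1 * (\sum_j cos (u l * X (y j))) - p l) * - sin (u l * X (y k))
  + (M%:R^-1 * (\sum_j sin (u l * X (y j))) - q l) * cos (u l * X (y k))).
have braP l k : `|bra l k| <= 2.
  have -> : bra l k = M%:R^-1 * (\sum_j sin (u l * X (y j) - u l * X (y k)))
      - (p l * - sin (u l * X (y k)) + q l * cos (u l * X (y k))).
    under eq_bigr do rewrite sinB.
    rewrite sumrB -!mulr_suml /bra; ring.
  apply: (le_trans (ler_normB _ _)); rewrite -[leRHS]/(1 + 1 : R) lerD// normrM.
  rewrite ger0_norm ?invr_ge0// mulrC ler_pdivrMr// mul1r.
  apply: (le_trans (ler_norm_sum _ _ _)).
  apply: (@le_trans _ _ (\sum_(j < M) 1)); last by rewrite sumr_const card_ord.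
  by apply: ler_sum => j _; exact: sin_max.
have estE i : est y 0 i =
    2 * \sum_l beta l * u l * (M%:R^-1 * \sum_k bra l k * D (y k) 0 i).
  rewrite mxE; congr (_ * _); apply: eq_bigr => l _.
  rewrite -mulrA; congr (_ * _).
  rewrite !mulr_sumr -big_split/=; apply: eq_bigr => k _.
  by rewrite /d_cos /d_sin /bra !mulr_sumr; ring.
have le_i i : `|est y 0 i| <=
    \sum_l `|beta l * u l| * (4 * (M%:R^-1 * \sum_k `|D (y k) 0 i|)).
  rewrite estE normrM ger0_norm//.
  apply: (@le_trans _ _ (2 * \sum_l `|beta l * u l| *
      (2 * (M%:R^-1 * \sum_k `|D (y k) 0 i|)))).
    rewrite ler_pM2l//; apply: (le_trans (ler_norm_sum _ _ _)).
    apply: ler_sum => l _; rewrite normrM ler_wpM2l// normrM.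
    rewrite (ger0_norm (_ : 0 <= M%:R^-1)) ?invr_ge0//.
    rewrite mulrCA ler_wpM2l ?invr_ge0//; apply: (le_trans (ler_norm_sum _ _ _)).
    rewrite mulr_sumr; apply: ler_sum => k _.
    by rewrite normrM ler_wpM2r.
  by rewrite mulr_sumr; apply: ler_sum => l _; rewrite le_eqVlt; apply/orP; left;
    apply/eqP; ring.
apply: (@le_trans _ _ (\sum_i \sum_l `|beta l * u l| *
    (4 * (M%:R^-1 * \sum_k `|D (y k) 0 i|)))).
  by apply: ler_sum => i _; exact: le_i.
rewrite exchange_big/= mulr_sumr; apply: ler_sum => l _.
rewrite -mulr_sumr mulrC ler_wpM2r// -mulr_sumr ler_pM2l// -mulr_sumr.
rewrite mulrC ler_pdivrMr// exchange_big/=.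
apply: (@le_trans _ _ (\sum_(k < M) BR)); first by apply: ler_sum => k _; exact: DB.
by rewrite sumr_const card_ord mulr_natr.
Qed.

End estimator.

Section estimator_mean.
Context d d' (V : measurableType d) (T : measurableType d') (R : realType).
Context (Q : probability V R) (M : nat) (x : 'I_M -> V -> T) (j0 : 'I_M).
Context (mx : forall j, measurable_fun setT (x j)).
Context (same : forall (f : T -> R) j, bounded_measurable f ->
  \int[Q]_v f (x j v) = \int[Q]_v f (x j0 v)).
Context (indep : forall (f g : T -> R) j k, j != k ->
  bounded_measurable f -> bounded_measurable g ->
  \int[Q]_v (f (x j v) * g (x k v)) =
  (\int[Q]_v f (x j v)) * (\int[Q]_v g (x k v))).
Context (n L : nat) (u beta p q : 'I_L -> R).
Context (X : T -> R) (D : T -> 'rV[R]_n) (BR : R).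
Context (mX : measurable_fun setT X).
Context (mD : forall i, measurable_fun setT (fun t => D t 0 i)).
Context (DB : forall t, norm1 (D t) <= BR).

Let E (f : T -> R) : R := \int[Q]_v f (x j0 v).

Let c l := E (fun t => cos (u l * X t)).
Let s l := E (fun t => sin (u l * X t)).
Let dc l i := E (d_cos u X D l i).
Let ds l i := E (d_sin u X D l i).

Definition mean_est : 'rV[R]_n :=
  \row_i (2 * \sum_l beta l * ((c l - p l) * dc l i + (s l - q l) * ds l i)).

(** The expression of [mean_est] with the target removed, p = q = 0. It is M times the gap between
    [mean_est] and the expected estimator. *)
Definition bias_est : 'rV[R]_n :=
  \row_i (2 * \sum_l beta l * (c l * dc l i + s l * ds l i)).

Let muX l : measurable_fun setT (fun t => u l * X t).
Proof. by apply: measurable_funM. Qed.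

Let bcos l : bounded_measurable (fun t => cos (u l * X t)).
Proof.
by split; [exact: measurable_fun_cos|exists 1 => t; exact: cos_max].
Qed.

Let bsin l : bounded_measurable (fun t => sin (u l * X t)).
Proof.
by split; [exact: measurable_fun_sin|exists 1 => t; exact: sin_max].
Qed.

Let bD i : bounded_measurable (fun t => D t 0 i).
Proof.
split=> //; exists BR => t; apply: le_trans (DB t).
by rewrite /norm1 (bigD1 i)//= lerDl; apply: sumr_ge0.
Qed.

Let bdc l i : bounded_measurable (d_cos u X D l i).
Proof. by apply: bmM => //; apply: bmM => //; exact: bm_cst. Qed.

Let bds l i : bounded_measurable (d_sin u X D l i).
Proof. by apply: bmM => //; apply: bmM => //; exact: bm_cst. Qed.

Let bx (f : T -> R) j : bounded_measurable f -> bounded_measurable (fun v => f (x j v)).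
Proof. exact: bm_comp. Qed.

(** Of the M products, M - 1 are of independent samples and factor; the one with j = k is left as it
    stands. *)
Let cross (f g : T -> R) k : bounded_measurable f -> bounded_measurable g ->
  \int[Q]_v (\sum_j f (x j v) * g (x k v)) =
  M.-1%:R * (E f * E g) + \int[Q]_v (f (x k v) * g (x k v)).
Proof.
move=> bf bg; rewrite expect_sum; last by move=> j; apply: bmM; exact: bx.
rewrite (bigD1 k)//= addrC; congr (_ + _).
rewrite (eq_bigr (fun=> E f * E g)) => [|j jk].
  by rewrite sumr_const cardC1 card_ord mulr_natl.
by rewrite indep// same// [X in _ * X]same.
Qed.

(** The products of sample means have M(M - 1) off-diagonal terms over M^2, hence the factor 1 - 1/M
    on the quadratic part; the part linear in p and q is unbiased. *)
Lemma expect_est i : (0 < M)%N ->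
  \int[Q]_v (est u beta p q X D (fun j => x j v) 0 i) =
  mean_est 0 i - M%:R^-1 * bias_est 0 i.
Proof.
move=> M0; have MR : (M%:R : R) != 0 by rewrite pnatr_eq0 -lt0n.
have estE v : est u beta p q X D (fun j => x j v) 0 i =
  \sum_l (2 * beta l) * (\sum_k (M%:R^-1 * M%:R^-1) *
     ((\sum_j cos (u l * X (x j v)) * d_cos u X D l i (x k v))
      + (\sum_j sin (u l * X (x j v)) * d_sin u X D l i (x k v)))
   + \sum_k ((- p l * M%:R^-1) * d_cos u X D l i (x k v)
      + (- q l * M%:R^-1) * d_sin u X D l i (x k v))).
  rewrite mxE mulr_sumr; apply: eq_bigr => l _; rewrite mulrA; congr (_ * _).
  rewrite -mulr_sumr !big_split/=.
  under [X in _ = _ * (X + _) + _]eq_bigr do rewrite -mulr_suml.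
  under [X in _ = _ * (_ + X) + _]eq_bigr do rewrite -mulr_suml.
  by rewrite -!mulr_sumr; ring.
under eq_Rintegral do rewrite estE.
have b1 l k : bounded_measurable (fun v => \sum_j cos (u l * X (x j v)) * d_cos u X D l i (x k v)).
  by apply: bm_sum => j; apply: bmM; [exact: bx (bcos l)|exact: bx (bdc l i)].
have b2 l k : bounded_measurable (fun v => \sum_j sin (u l * X (x j v)) * d_sin u X D l i (x k v)).
  by apply: bm_sum => j; apply: bmM; [exact: bx (bsin l)|exact: bx (bds l i)].
have bZ a (f : V -> R) : bounded_measurable f -> bounded_measurable (fun v => a * f v).
  by move=> ?; apply: bmM => //; exact: bm_cst.
have bdcx l k := bx k (bdc l i); have bdsx l k := bx k (bds l i).
rewrite expect_sum; last first.
  move=> l; apply: (bZ); apply: bmD; apply: bm_sum => k.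
    by apply: (bZ); exact: bmD.
  by apply: bmD; exact: bZ.
have E1 l k : \int[Q]_v ((M%:R^-1 * M%:R^-1) *
     ((\sum_j cos (u l * X (x j v)) * d_cos u X D l i (x k v))
      + (\sum_j sin (u l * X (x j v)) * d_sin u X D l i (x k v)))) =
    M%:R^-1 * M%:R^-1 * (M.-1%:R * (c l * dc l i + s l * ds l i)).
  rewrite expectZ; last exact: bmD.
  rewrite expectD//.
  have /= -> := cross k (bcos l) (bdc l i).
  have /= -> := cross k (bsin l) (bds l i).
  rewrite addrACA -expectD; last 2 first.
  - by apply: bmM; [exact: bx (bcos l)|exact: bdcx].
  - by apply: bmM; [exact: bx (bsin l)|exact: bdsx].
  (* The diagonal terms cancel pointwise: cosine times [d_cos] and sine times [d_sin] are
     opposite. *)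
  rewrite [X in _ + X](_ : _ = 0) ?addr0 ?mulrDr//.
  rewrite -[RHS](expect_cst Q); apply: eq_Rintegral => v _.
  by rewrite /d_cos /d_sin; ring.
have E2 l k : \int[Q]_v ((- p l * M%:R^-1) * d_cos u X D l i (x k v)
      + (- q l * M%:R^-1) * d_sin u X D l i (x k v)) =
    - p l * M%:R^-1 * dc l i + - q l * M%:R^-1 * ds l i.
  rewrite expectD; [|exact: bZ..].
  by rewrite !expectZ//; congr (_ * _ + _ * _); exact: same.
have E3 l : \int[Q]_v ((2 * beta l) * (\sum_k (M%:R^-1 * M%:R^-1) *
     ((\sum_j cos (u l * X (x j v)) * d_cos u X D l i (x k v))
      + (\sum_j sin (u l * X (x j v)) * d_sin u X D l i (x k v)))
   + \sum_k ((- p l * M%:R^-1) * d_cos u X D l i (x k v)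
      + (- q l * M%:R^-1) * d_sin u X D l i (x k v)))) =
   2 * beta l * (M%:R * (M%:R^-1 * M%:R^-1 * (M.-1%:R * (c l * dc l i + s l * ds l i)))
     + M%:R * (- p l * M%:R^-1 * dc l i + - q l * M%:R^-1 * ds l i)).
  rewrite expectZ; last first.
    apply: bmD; apply: bm_sum => k; first by apply: (bZ); exact: bmD.
    by apply: bmD; exact: bZ.
  rewrite expectD; last 2 first.
  - by apply: bm_sum => k; apply: (bZ); exact: bmD.
  - by apply: bm_sum => k; apply: bmD; exact: bZ.
  rewrite expect_sum; last by move=> k; apply: (bZ); exact: bmD.
  rewrite expect_sum; last by move=> k; apply: bmD; exact: bZ.
  under eq_bigr do rewrite E1.
  under [X in _ + X]eq_bigr do rewrite E2.
  by rewrite !sumr_const card_ord !mulr_natl.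
under eq_bigr do rewrite E3.
rewrite !mxE mulrA [_ * 2]mulrC -mulrA -mulrBr mulr_sumr -sumrB mulr_sumr.
apply: eq_bigr => l _; rewrite -subn1 natrB//.
by field.
Qed.

Context (pq : forall l a, `|p l * - sin a + q l * cos a| <= 1).

(** As for the estimator, but the weight of the gradient, Im(exp(-iuX) (c + is)), contains no target
    and is at most 1 in modulus. *)
Lemma norm1_bias_est : norm1 bias_est <= 4 * BR * \sum_l `|beta l * u l|.
Proof.
have bDx i := bx j0 (bD i).
have bcx l := bx j0 (bcos l); have bsx l := bx j0 (bsin l).
pose bra l v := c l * - sin (u l * X (x j0 v)) + s l * cos (u l * X (x j0 v)).
have bbra l : bounded_measurable (bra l).
  apply: bmD; apply: bmM; try exact: bm_cst; last exact: bcx.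
  rewrite (_ : (fun v => _) = (fun v => -1 * sin (u l * X (x j0 v)))); last first.
    by apply/funext => v; rewrite mulN1r.
  by apply: bmM; [exact: bm_cst|exact: bsx].
have bra1 l v : `|bra l v| <= 1.
  by apply: norm_cis_expect_le; apply: measurable_funM => //; exact: measurableT_comp.
have Hl l i : c l * dc l i + s l * ds l i = u l * \int[Q]_v (bra l v * D (x j0 v) 0 i).
  rewrite -expectZ; last exact: bmM.
  rewrite -(@expectZ _ _ _ Q (c l) (fun v => d_cos u X D l i (x j0 v))); last exact: bx.
  rewrite -(@expectZ _ _ _ Q (s l) (fun v => d_sin u X D l i (x j0 v))); last exact: bx.
  rewrite -expectD; last 2 first.
  - by apply: bmM; [exact: bm_cst|exact: bx (bdc l i)].
  - by apply: bmM; [exact: bm_cst|exact: bx (bds l i)].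
  by apply: eq_Rintegral => v _; rewrite /d_cos /d_sin /bra; ring.
have le_i i : `|bias_est 0 i| <=
    \sum_l `|beta l * u l| * (4 * \int[Q]_v `|D (x j0 v) 0 i|).
  rewrite mxE normrM ger0_norm//.
  apply: (@le_trans _ _ (\sum_l 2 * `|beta l * (c l * dc l i + s l * ds l i)|)).
    by rewrite -mulr_sumr ler_pM2l//; exact: ler_norm_sum.
  apply: ler_sum => l _; rewrite Hl mulrA normrM mulrCA ler_wpM2l//.
  (* The factor 2 is relaxed to 4, so that bias and estimator share one constant. *)
  apply: (@le_trans _ _ (2 * \int[Q]_v `|D (x j0 v) 0 i|)); last first.
    by rewrite ler_wpM2r ?Rintegral_ge0// ler_nat.
  rewrite ler_pM2l//; apply: (le_trans (norm_expect Q _)); first exact: bmM.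
  apply: le_expect => [||v]; [by apply: bm_norm; exact: bmM|exact: bm_norm|].
  by rewrite normrM ler_piMl.
apply: (@le_trans _ _ (\sum_i \sum_l `|beta l * u l| *
    (4 * \int[Q]_v `|D (x j0 v) 0 i|))).
  by apply: ler_sum => i _; exact: le_i.
rewrite exchange_big/= mulr_sumr; apply: ler_sum => l _.
rewrite -mulr_sumr mulrC ler_wpM2r// -mulr_sumr ler_pM2l//.
rewrite -expect_sum; last by move=> i; exact: bm_norm.
rewrite -[leRHS](expect_cst Q); apply: le_expect => [||v]; last exact: DB.
- by apply: bm_sum => i; exact: bm_norm.
- exact: bm_cst.
Qed.

End estimator_mean.

(** * Stochastic gradient descent *)

(** The complement of F is a countable union of cubes with rational centres and radii 1/(n+1), and
    the preimage of a cube is measurable coordinate by coordinate. This makes the test for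
    membership in [Theta] measurable. *)
Lemma measurable_closed_preimage d (V : measurableType d) (R : realType) n
    (F : set 'rV[R]_n) (y : V -> 'rV[R]_n) : closed F ->
  (forall i, measurable_fun setT (fun v => y v 0 i)) -> measurable (y @^-1` F).
Proof.
move=> cF my.
pose box (q : 'rV[rat]_n * nat) : set 'rV[R]_n :=
  [set a | forall i, `|ratr (q.1 0 i) - a 0 i| < q.2.+1%:R^-1].
have near_rat (x e : R) : 0 < e -> exists r : rat, `|ratr r - x| < e.
  move=> e0; have [|r] := @rat_in_itvoo R x (x + e); first by rewrite ltrDl.
  by rewrite in_itv/= => /andP[r1 r2]; exists r; rewrite ltr_norml; lra.
pose good q := forall a, box q a -> ~ F a.
have -> : y @^-1` F = ~` \bigcup_q (if `[< good q >] then y @^-1` box q else set0).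
  apply/seteqP; split=> v /=.
    by move=> Fv [q _]; case: asboolP => // gq /gq.
  move=> H; apply: contrapT => NFv; apply: H.
  have /= := closed_openC cF; rewrite openE => /(_ (y v) NFv).
  rewrite /interior /= => /nbhs_ballP[e /= e0 He].
  (* A cube of radius 1/(k+1) that contains y(v) has all its points within 2/(k+1) < e of y(v), so
     it misses F. *)
  pose k := Num.truncn (2 / e).
  have ke : 2 * k.+1%:R^-1 < e :> R.
    have := truncnS_gt (2 / e); rewrite -/k => H.
    by rewrite ltr_pdivrMr// mulrC -ltr_pdivrMr.
  have k0 : 0 < k.+1%:R^-1 :> R by rewrite invr_gt0.
  have [q Hq] : exists q : 'rV[rat]_n, forall i, `|ratr (q 0 i) - y v 0 i| < k.+1%:R^-1.
    have ex (i : 'I_n) : exists r : rat, `|ratr r - y v 0 i| < k.+1%:R^-1.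
      exact: near_rat.
    have [f fP] := choice ex.
    by exists (\row_i f i) => i; rewrite mxE.
  exists (q, k) => //; case: asboolP => // -[] a Ha; apply: He.
  split => // i j; rewrite ord1 /ball/=.
  have /= := Ha j; have /= := Hq j.
  move: (k.+1%:R^-1 : R) ke => ik ke; rewrite !ltr_norml; lra.
apply: measurableC; apply: countable_bigcupT_measurable; first exact: countableP.
move=> q; case: ifP => // _.
have -> : y @^-1` box q =
    \bigcap_i [set v | `|ratr (q.1 0 i) - y v 0 i| < q.2.+1%:R^-1].
  by apply/seteqP; split=> v /= H i => [_|]; exact: H.
apply: fin_bigcap_measurable => // i _.
rewrite -[X in measurable X]setTI.
have : measurable_fun setT (fun v => `|ratr (q.1 0 i) - y v 0 i| < q.2.+1%:R^-1).
  apply: measurable_fun_ltr; last exact: measurable_cst.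
  apply: measurableT_comp => //; apply: measurable_funB => //; exact: measurable_cst.
by move=> /(_ measurableT [set true]); rewrite preimage_true; apply.
Qed.

Section integral_nonmeasurable.
Import HBNNSimple.

(* No measurability is required of [f]: its integral is a supremum over the *)
(* simple functions below it, all of which are below [g] almost everywhere. *)
Lemma ge0_le_integral_ae d (V : measurableType d) (R : realType)
    (Q : probability V R) (f g : V -> R) :
  (forall v, 0 <= f v) -> (forall v, 0 <= g v) -> bounded_measurable g ->
  {ae Q, forall v, f v = g v} ->
  (\int[Q]_v (f v)%:E <= (\int[Q]_v g v)%:E)%E.
Proof.
move=> f0 g0 bg fg.
have -> : (\int[Q]_v g v)%:E = (\int[Q]_v (g v)%:E)%E.
  rewrite /Rintegral fineK//; apply: integrable_fin_num => //.
  exact: (bm_integrable Q bg).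
rewrite [X in (X <= _)%E]ge0_integralE; last by move=> v _; rewrite lee_fin.
apply: ge_ereal_sup => _ [h hf <-].
rewrite -integralT_nnsfun.
apply: ae_ge0_le_integral => //.
- by move=> v _; rewrite lee_fin; exact: fun_ge0.
- by apply/measurable_EFinP; exact: measurable_funPT.
- by move=> v _; rewrite lee_fin.
- by apply/measurable_EFinP; case: bg.
- apply: filterS fg => v fgv _; rewrite -fgv.
  by have := hf v; rewrite patch_setT.
Qed.

End integral_nonmeasurable.

Section sampled_paths.
Context {R : realType} (m : model R) (Theta : set 'rV[R]_7).
Context (wp : well_posed m Theta) (A5 : assumption5 m).
Context (sigmaP : forall x : R, derivable (activation m) x 1).
Context (mdsigma : measurable_fun setT (derive1 (activation m))).
Context (BR : R) (BR0 : 0 <= BR).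

Local Notation traj := ((horizon m).-tuple (R * R)).

Definition path_ret (th : 'rV[R]_7) (x : traj) : R :=
  ret (totalize m) th (path_of x) (horizon m).

Definition path_grad (th : 'rV[R]_7) (x : traj) : 'rV[R]_7 :=
  grad_ret (totalize m) th (path_of x) (horizon m).

(* Cut off where the bound [BR], valid on the good event, fails. *)
Definition clipped_grad (th : 'rV[R]_7) (x : traj) : 'rV[R]_7 :=
  if norm1 (path_grad th x) <= BR then path_grad th x else 0.

Lemma norm1_clipped_grad th x : norm1 (clipped_grad th x) <= BR.
Proof.
rewrite /clipped_grad; case: ifP => // _.
by rewrite /norm1 big1// => i _; rewrite mxE normr0.
Qed.

Lemma path_retE th x : Theta th ->
  path_ret th x = ret m th (path_of x) (horizon m).
Proof. by move=> thT; rewrite /path_ret /ret (state_return_totalize wp). Qed.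

Lemma path_gradE th x : Theta th ->
  path_grad th x = grad_ret m th (path_of x) (horizon m).
Proof. by move=> thT; rewrite /path_grad /grad_ret (grad_state_return_totalize wp). Qed.

Section measurability.
Context d (V : measurableType d) (th : V -> 'rV[R]_7) (x : V -> traj).
Context (mth : forall i, measurable_fun setT (fun v => th v 0 i)).
Context (mx : measurable_fun setT x).

Let mpath k : measurable_fun setT (fun v => (path_of (x v) k).1) /\
  measurable_fun setT (fun v => (path_of (x v) k).2).
Proof.
have mk : measurable_fun setT (fun v => path_of (x v) k).
  have [kT|Tk] := ltnP k (horizon m); last first.
    under eq_fun do rewrite /path_of nth_default ?size_tuple//.
    exact: measurable_cst.
  have := measurableT_comp (measurable_tnth (Ordinal kT)) mx.
  congr (measurable_fun _ _); apply/funext => v /=.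
  by rewrite (tnth_nth (0, 0)).
by split; [exact: (measurableT_comp measurable_fst mk)|
           exact: (measurableT_comp measurable_snd mk)].
Qed.

Lemma measurable_path_ret : measurable_fun setT (fun v => path_ret (th v) (x v)).
Proof.
have [_] := @measurable_state_ret _ (totalize m) sigmaP
  (measurable_step_totalize wp) (measurable_reward_totalize wp)
  _ V th (fun v => path_of (x v)) mth mpath (horizon m).
exact.
Qed.

Lemma measurable_path_grad i :
  measurable_fun setT (fun v => path_grad (th v) (x v) 0 i).
Proof.
have [_] := @measurable_grad _ (totalize m) sigmaP mdsigma
  (measurable_step_totalize wp) (measurable_reward_totalize wp)
  (measurable_dstep_totalize wp A5).1 (measurable_dstep_totalize wp A5).2
  (measurable_dreward_totalize wp A5).1 (measurable_dreward_totalize wp A5).2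
  _ V th (fun v => path_of (x v)) mth mpath (horizon m) i.
exact.
Qed.

Lemma measurable_grad_bounded :
  measurable_fun setT (fun v => norm1 (path_grad (th v) (x v)) <= BR).
Proof.
apply: measurable_fun_ler; last exact: measurable_cst.
by apply: measurable_sum => i; apply: measurableT_comp => //; exact: measurable_path_grad.
Qed.

Lemma measurable_clipped_grad i :
  measurable_fun setT (fun v => clipped_grad (th v) (x v) 0 i).
Proof.
have -> : (fun v => clipped_grad (th v) (x v) 0 i) =
    (fun v => if norm1 (path_grad (th v) (x v)) <= BR
              then path_grad (th v) (x v) 0 i else 0).
  by apply/funext => v; rewrite /clipped_grad; case: ifP => // _; rewrite mxE.
apply: measurable_fun_ifT; [exact: measurable_grad_bounded|
  exact: measurable_path_grad|exact: measurable_cst].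
Qed.

End measurability.

Context (L : nat) (u beta : 'I_L -> R) (phi_star : R -> R[i]).

Let p l := complex.Re (phi_star (u l)).
Let q l := complex.Im (phi_star (u l)).

Definition clipped_estimator M (x : 'I_M -> traj) (th : 'rV[R]_7) : 'rV[R]_7 :=
  est u beta p q (path_ret th) (clipped_grad th) x.

Lemma estimatorE M (x : 'I_M -> traj) th : (0 < M)%N -> Theta th ->
  (forall j, norm1 (path_grad th (x j)) <= BR) ->
  estimator u beta phi_star x th = clipped_estimator x th.
Proof.
move=> M0 thT xB; apply/rowP => i; rewrite grad_loss_ofE mxE.
have ReM (c : R) (a : R[i]) : complex.Re (c%:C%C * a) = c * complex.Re a.
  by case: a => a b /=; rewrite mul0r subr0.
have ImM (c : R) (a : R[i]) : complex.Im (c%:C%C * a) = c * complex.Im a.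
  by case: a => a b /=; rewrite mul0r addr0.
have Msum I (r : seq I) (F : I -> R[i]) :
    complex.Re (\sum_(j <- r) F j) = \sum_(j <- r) complex.Re (F j) /\
    complex.Im (\sum_(j <- r) F j) = \sum_(j <- r) complex.Im (F j).
  elim: r => [|j r [IH1 IH2]]; first by rewrite !big_nil.
  by rewrite !big_cons -IH1 -IH2; case: (F j) (\sum_(j <- r) F j) => [a b] [c e].
have Minv : (M%:R^-1 : R[i]) = (M%:R^-1)%:C%C.
  by rewrite fmorphV /= rmorph_nat.
congr (_ * _); apply: eq_bigr => l _; congr (_ * _).
rewrite /phi_hat /grad_phi_hat !mxE Minv !ReM !ImM !(Msum _ _ _).1 !(Msum _ _ _).2 /=.
have Dj j : clipped_grad th (x j) = grad_ret m th (path_of (x j)) (horizon m).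
  by rewrite /clipped_grad xB path_gradE.
congr (_ * _ + _ * _); congr (_ * _ - _) || congr (_ * _); apply: eq_bigr => j _;
  rewrite ?/d_cos ?/d_sin ?path_retE// ?Dj; ring.
Qed.

End sampled_paths.

Section projected_process.
Context {R : realType} (m : model R) (Theta : set 'rV[R]_7).
Context (wp : well_posed m Theta) (A5 : assumption5 m) (cTheta : closed Theta).
Context (sigmaP : forall x : R, derivable (activation m) x 1).
Context (mdsigma : measurable_fun setT (derive1 (activation m))).
Context (BR : R).
Context (L : nat) (u beta : 'I_L -> R) (phi_star : R -> R[i]).

Local Notation traj := ((horizon m).-tuple (R * R)).
Local Notation cest := (clipped_estimator BR u beta phi_star).

Lemma measurable_clipped_estimator d (V : measurableType d) M
    (th : V -> 'rV[R]_7) (x : 'I_M -> V -> traj) i :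
  (forall i, measurable_fun setT (fun v => th v 0 i)) ->
  (forall j, measurable_fun setT (x j)) ->
  measurable_fun setT (fun v => cest (fun j => x j v) (th v) 0 i).
Proof.
move=> mth mx.
have mX j := measurable_path_ret wp sigmaP mth (mx j).
have mD j := measurable_clipped_grad wp A5 sigmaP mdsigma BR mth (mx j) i.
rewrite /clipped_estimator; under eq_fun do rewrite mxE.
apply: measurable_funM; first exact: measurable_cst.
apply: measurable_sum => l; apply: measurable_funM; first exact: measurable_cst.
have muX j : measurable_fun setT (fun v => u l * path_ret (th v) (x j v)).
  by apply: measurable_funM => //; exact: measurable_cst.
have mS (F : 'I_M -> V -> R) : (forall j, measurable_fun setT (F j)) ->
    measurable_fun setT (fun v => M%:R^-1 * \sum_j F j v).
  move=> mF; apply: measurable_funM; first exact: measurable_cst.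
  exact: measurable_sum.
have mdc : measurable_fun setT (fun v => M%:R^-1 *
    \sum_j d_cos u (path_ret (th v)) (clipped_grad BR (th v)) l i (x j v)).
  apply: (mS (fun j v => d_cos u (path_ret (th v)) (clipped_grad BR (th v)) l i (x j v))) => j.
  apply: measurable_funM => //; apply: measurable_funM; first exact: measurable_cst.
  exact: measurable_fun_sin.
have mds : measurable_fun setT (fun v => M%:R^-1 *
    \sum_j d_sin u (path_ret (th v)) (clipped_grad BR (th v)) l i (x j v)).
  apply: (mS (fun j v => d_sin u (path_ret (th v)) (clipped_grad BR (th v)) l i (x j v))) => j.
  apply: measurable_funM => //; apply: measurable_funM; first exact: measurable_cst.
  exact: measurable_fun_cos.
apply: measurable_funD; apply: measurable_funM => //; apply: measurable_funB;
  try exact: measurable_cst.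
- by apply: (mS (fun j v => cos (u l * path_ret (th v) (x j v)))) => j; exact: measurable_fun_cos.
- by apply: (mS (fun j v => sin (u l * path_ret (th v) (x j v)))) => j; exact: measurable_fun_sin.
Qed.

Context (M : nat) (M0 : (0 < M)%N) (alpha : nat -> R) (th0 : 'rV[R]_7).
Context (th0T : Theta th0).

(* The recursion restarted at [th0] should it leave [Theta]; its values lie *)
(* in [Theta] surely, those of [sgd] only almost surely.                    *)
Fixpoint projected_sgd (x : nat -> 'I_M -> traj) (k : nat) : 'rV[R]_7 :=
  if k is n.+1 then
    let th := projected_sgd x n in
    let th' := th - alpha n *: cest (x n) th in
    if `[< Theta th' >] then th' else th0
  else th0.

Lemma projected_sgd_in x k : Theta (projected_sgd x k).
Proof. by case: k => //= k; case: asboolP. Qed.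

(** Only the samples of iterations before k are assumed measurable, so the lemma also applies with
    the sigma-algebra of the past. *)
Lemma measurable_projected_sgd d (V : measurableType d)
    (xi : nat -> 'I_M -> V -> traj) k :
  (forall i j, (i < k)%N -> measurable_fun setT (xi i j)) ->
  forall c, measurable_fun setT (fun v => projected_sgd (fun n j => xi n j v) k 0 c).
Proof.
elim: k => [|k IH] mxi c; first exact: measurable_cst.
have mth : forall i, measurable_fun setT (fun v =>
    projected_sgd (fun n j => xi n j v) k 0 i).
  by move=> i; apply: IH => a b ak; exact/mxi/ltnW.
pose y v := projected_sgd (fun n j => xi n j v) k
  - alpha k *: cest (fun j => xi k j v) (projected_sgd (fun n j => xi n j v) k).
have my i : measurable_fun setT (fun v => y v 0 i).
  have -> : (fun v => y v 0 i) = (fun v =>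
      projected_sgd (fun n j => xi n j v) k 0 i
      - alpha k * cest (fun j => xi k j v) (projected_sgd (fun n j => xi n j v) k) 0 i).
    by apply/funext => v; rewrite /y [LHS]mxE; congr (_ + _); rewrite mxE; congr (- _);
      rewrite [LHS]mxE.
  apply: measurable_funB; first exact: mth.
  apply: (@measurable_funM _ _ _ _ (cst (alpha k)) (fun v =>
    cest (fun j => xi k j v) (projected_sgd (fun n j => xi n j v) k) 0 i)).
    exact: measurable_cst.
  by apply: measurable_clipped_estimator => // j; exact: mxi.
have -> : (fun v => projected_sgd (fun n j => xi n j v) k.+1 0 c) =
    (fun v => if `[< Theta (y v) >] then y v 0 c else th0 0 c).
  by apply/funext => v /=; rewrite -/(y v); case: ifP.
apply: measurable_fun_ifT => //.
apply: (measurable_fun_bool true).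
rewrite (_ : _ `&` _ = y @^-1` Theta); first exact: measurable_closed_preimage.
by rewrite setTI; apply/seteqP; split=> v /= /asboolP.
Qed.

(** As long as the iterates stay in [Theta] and the gradient bound holds along them, neither the
    restart nor the cut-off is triggered. *)
Lemma sgd_projected (x : nat -> 'I_M -> traj) :
  (forall k, Theta (sgd u beta phi_star alpha th0 x k)) ->
  (forall k j, norm1 (path_grad (projected_sgd x k) (x k j)) <= BR) ->
  forall k, sgd u beta phi_star alpha th0 x k = projected_sgd x k.
Proof.
move=> thT xB; elim=> //= k IH.
have := thT k.+1; rewrite /= IH (estimatorE (BR := BR) wp)//.
- by move=> Tk; rewrite asboolT.
- exact: projected_sgd_in.
Qed.

End projected_process.

(** The maximum of f and c dominates f everywhere and equals c almost everywhere. *)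
Lemma ae_le_expect d (V : measurableType d) (R : realType) (Q : probability V R)
    (f : V -> R) (c : R) : bounded_measurable f ->
  {ae Q, forall v, f v <= c} -> \int[Q]_v f v <= c.
Proof.
move=> bf fc.
have bm : bounded_measurable (fun v => Num.max (f v) c).
  case: bf => mf [C fC]; split; first by apply: measurable_maxr => //; exact: measurable_cst.
  by exists (Num.max C `|c|) => v; rewrite /Num.max; case: ifP => _; rewrite le_max ?fC ?lexx ?orbT.
apply: (@le_trans _ _ (\int[Q]_v Num.max (f v) c)).
  by apply: le_expect => // v; rewrite le_max lexx.
rewrite -[leRHS](expect_cst Q) le_eqVlt; apply/orP; left; apply/eqP; congr fine.
apply: ae_eq_integral => //.
- by apply/measurable_EFinP; case: bm.
- by apply: filterS fc => v fv _; rewrite max_r.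
Qed.

Section convergence.
Context {R : realType} d (W : measurableType d) (P : probability W R).
Context (m : model R) (Theta : set 'rV[R]_7) (wp : well_posed m Theta).
Context (A4 : assumption4 m) (A5 : assumption5 m) (cTheta : closed Theta).
Context (sigmaP : forall x : R, derivable (activation m) x 1).
Context (mdsigma : measurable_fun setT (derive1 (activation m))).
Context (eps z : nat -> W -> R).
Context (meps : forall t, measurable_fun setT (eps t)).
Context (mz : forall t, measurable_fun setT (z t)).
Context (G : set W) (mG : measurable G) (PG0 : (0 < P G)%E).
Context (BR : R) (BR0 : 0 <= BR).
Context (BR_bound : forall th w, Theta th -> G w ->
  norm1 (grad_ret m th (noise eps z w) (horizon m)) <= BR).
Context (L : nat) (u beta : 'I_L -> R) (phi_star : R -> R[i]).
Context (beta_ge0 : forall l, 0 <= beta l).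
Context (phi_star_le : forall v a,
  `|complex.Re (phi_star v) * - sin a + complex.Im (phi_star v) * cos a| <= 1).

Local Notation traj := ((horizon m).-tuple (R * R)).
Let lossL := loss P m eps z G u beta phi_star.
Let grad_lossL := grad_loss P m eps z G u beta phi_star.
Let p l := complex.Re (phi_star (u l)).
Let q l := complex.Im (phi_star (u l)).
Let X := @path_ret R m.
Let D := @clipped_grad R m BR.

Let N (w : W) : traj := [tuple noise eps z w t | t < horizon m].

Let mN : measurable_fun setT N.
Proof.
apply/measurable_fun_tnthP => i.
have -> : (@tnth _ _)^~ i \o N = fun w => (eps i.+1 w, z i w).
  by apply/funext => w /=; rewrite tnth_mktuple.
exact: measurable_fun_pair.
Qed.

Let pathN w t : (t < horizon m)%N -> path_of (N w) t = noise eps z w t.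
Proof.
by move=> tT; rewrite /path_of -(tnth_nth _ _ (Ordinal tT)) tnth_mktuple.
Qed.

Let XN th w : Theta th -> X th (N w) = ret m th (noise eps z w) (horizon m).
Proof.
move=> thT; rewrite /X (path_retE wp)// /ret; congr (_.2).
by apply: state_return_ext => i; exact: pathN.
Qed.

Let gradN th w : Theta th ->
  path_grad th (N w) = grad_ret m th (noise eps z w) (horizon m).
Proof.
move=> thT; rewrite (path_gradE wp)// /grad_ret; congr (_.2).
by apply: grad_state_return_ext => i; exact: pathN.
Qed.

Let DN th w : Theta th -> G w -> D th (N w) = grad_ret m th (noise eps z w) (horizon m).
Proof. by move=> thT Gw; rewrite /D /clipped_grad gradN// BR_bound. Qed.

Let mX th : measurable_fun setT (X th).
Proof.
apply: (measurable_path_ret wp sigmaP (th := fun=> th)) => //.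
Qed.

Let mD th i : measurable_fun setT (fun t => D th t 0 i).
Proof.
apply: (measurable_clipped_grad wp A5 sigmaP mdsigma BR (th := fun=> th)) => //.
Qed.

Let dD th t : norm1 (D th t) <= BR.
Proof. exact: norm1_clipped_grad. Qed.

Let bcos th l : bounded_measurable (fun t => cos (u l * X th t)).
Proof.
split; last by exists 1 => t; exact: cos_max.
by apply: measurable_fun_cos; apply: measurable_funM.
Qed.

Let bsin th l : bounded_measurable (fun t => sin (u l * X th t)).
Proof.
split; last by exists 1 => t; exact: sin_max.
by apply: measurable_fun_sin; apply: measurable_funM.
Qed.

Let bD th i : bounded_measurable (fun t => D th t 0 i).
Proof.
split => //; exists BR => t; apply: le_trans (dD th t).
by rewrite /norm1 (bigD1 i)//= lerDl; apply: sumr_ge0.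
Qed.

Let bdc th l i : bounded_measurable (d_cos u (X th) (D th) l i).
Proof. by apply: bmM => //; apply: bmM => //; exact: bm_cst. Qed.

Let bds th l i : bounded_measurable (d_sin u (X th) (D th) l i).
Proof. by apply: bmM => //; apply: bmM => //; exact: bm_cst. Qed.

Lemma is_derive_loss_curve (th dth : R -> 'rV[R]_7) C : (forall x, Theta (th x)) ->
  (forall (x : R) i, is_derive x 1 (fun y => th y 0 i) (dth x 0 i)) ->
  (forall x i, `|dth x 0 i| <= C) -> forall x : R,
  is_derive x 1 (fun y => lossL (th y)) (dot (grad_lossL (th x)) (dth x)).
Proof.
move=> thT dthP dthC x.
have mX' t : Theta t ->
    measurable_fun G (fun w => ret m t (noise eps z w) (horizon m)).
  move=> tT; apply: measurable_funTS.
  have := measurableT_comp (mX t) mN; congr (measurable_fun _ _).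
  by apply/funext => w /=; rewrite XN.
have mD' t i : Theta t ->
    measurable_fun G (fun w => grad_ret m t (noise eps z w) (horizon m) 0 i).
  move=> tT; apply: measurable_funTS.
  have := measurableT_comp (measurable_path_grad wp A5 sigmaP mdsigma (th := fun=> t)
    (x := id) (fun=> @measurable_cst _ _ _ _ _ _) (@measurable_id _ _ _) i) mN.
  congr (measurable_fun _ _).
  by apply/funext => w /=; rewrite gradN.
have XP (t dt : R -> 'rV[R]_7) w : (forall x, Theta (t x)) ->
    (forall (x : R) i, is_derive x 1 (fun y => t y 0 i) (dt x 0 i)) -> forall x : R,
    is_derive x 1 (fun y => ret m (t y) (noise eps z w) (horizon m))
      (dot (grad_ret m (t x) (noise eps z w) (horizon m)) (dt x)).
  move=> tT dtP y.
  by have [] := is_derive_state_ret sigmaP wp A4 A5 (noise eps z w) tT dtP (leqnn _) y.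
exact: (is_derive_loss P mG mX' mD' BR_bound XP u beta phi_star thT dthP dthC x).
Qed.

Context (Lip : R) (Lip0 : 0 <= Lip).
Context (LipP : forall th th', Theta th -> Theta th' ->
       norm2 (grad_lossL th - grad_lossL th') <= Lip * norm2 (th - th')).

Lemma loss_descent th th' :
  (forall t : R, 0 <= t <= 1 -> Theta (th + t *: (th' - th))) ->
  lossL th' <= lossL th + dot (grad_lossL th) (th' - th)
    + Lip / 2 * norm2 (th' - th) ^+ 2.
Proof. exact: (descent LipP is_derive_loss_curve). Qed.

Lemma loss_ge0 th : 0 <= lossL th.
Proof.
rewrite /lossL /loss loss_ofE; apply: sumr_ge0 => l _.
by rewrite mulr_ge0// addr_ge0// sqr_ge0.
Qed.

Context (M : nat) (M0 : (0 < M)%N) (dV : measure_display) (V : measurableType dV).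
Context (Q : probability V R) (xi : nat -> 'I_M -> V -> traj).
Context (sampling : conditional_sampling P eps z G Q xi).

Let mxi k j : measurable_fun setT (xi k j).
Proof. by case: sampling. Qed.

Let law k j (f : traj -> R) : bounded_measurable f ->
  \int[Q]_v f (xi k j v) = cond_exp P G (fun w => f (N w)).
Proof.
move=> [mf [C fC]]; case: sampling => _ _ lawP.
exact: (expectation_law mG PG0 mN (mxi k j) (lawP k j) mf fC).
Qed.

Let x0 : 'I_M := Ordinal M0.

(** A sample has the law of the noise given the good event, where the cut-off and the extension by
    zero change nothing; so conditional expectations are plain means over a sample of any iteration
    k. *)
Lemma grad_lossE k th : Theta th ->
  grad_lossL th = mean_est Q (xi k) x0 u beta p q (X th) (D th).
Proof.
move=> thT; apply/rowP => i; rewrite grad_loss_ofE mxE.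
congr (_ * _); apply: eq_bigr => l _; congr (_ * _).
rewrite Re_grad_phi Im_grad_phi.
have E f g : bounded_measurable f -> (forall w, G w -> f (N w) = g w) ->
    \int[Q]_v f (xi k x0 v) = cond_exp P G g.
  move=> bf fg; rewrite law//; congr (_ / _).
  by apply: eq_Rintegral => w; rewrite inE => /fg.
congr ((_ - _) * _ + (_ - _) * _); apply/esym.
- by apply: (E (fun t => cos (u l * X th t))) => // w Gw; rewrite XN.
- by apply: (E (d_cos u (X th) (D th) l i)) => // w Gw; rewrite /d_cos XN// DN.
- by apply: (E (fun t => sin (u l * X th t))) => // w Gw; rewrite XN.
- by apply: (E (d_sin u (X th) (D th) l i)) => // w Gw; rewrite /d_sin XN// DN.
Qed.

Let same k (f : traj -> R) j : bounded_measurable f ->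
  \int[Q]_v f (xi k j v) = \int[Q]_v f (xi k x0 v).
Proof. by move=> bf; rewrite !law. Qed.

Let xi2 (i : nat * 'I_M) := xi i.1 i.2.

Let xi2_indep : mutually_independent Q xi2.
Proof. by case: sampling. Qed.

Let mxi2 i : measurable_fun setT (xi2 i). Proof. exact: mxi. Qed.

Let fubini S1 S2 := @group_fubini _ _ V traj R Q _ xi2 mxi2 xi2_indep S1 S2.

Let mfst S1 S2 i : S1 i -> measurable_fun setT
  (fun vw : group_sigma xi2 S1 * group_sigma xi2 S2 => xi2 i vw.1).
Proof.
by move=> Si; exact: (measurableT_comp (@measurable_group_sigma _ _ _ _ _ xi2 S1 i Si)
  measurable_fst).
Qed.

Let msnd S1 S2 i : S2 i -> measurable_fun setT
  (fun vw : group_sigma xi2 S1 * group_sigma xi2 S2 => xi2 i vw.2).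
Proof.
by move=> Si; exact: (measurableT_comp (@measurable_group_sigma _ _ _ _ _ xi2 S2 i Si)
  measurable_snd).
Qed.

Let indep k (f g : traj -> R) j j' : j != j' ->
  bounded_measurable f -> bounded_measurable g ->
  \int[Q]_v (f (xi k j v) * g (xi k j' v)) =
  (\int[Q]_v f (xi k j v)) * (\int[Q]_v g (xi k j' v)).
Proof.
move=> jj' [mf [C fC]] [mg [C' gC]].
pose S1 : set (nat * 'I_M) := [set (k, j)].
pose S2 : set (nat * 'I_M) := [set (k, j')].
pose h (vw : group_sigma xi2 S1 * group_sigma xi2 S2) :=
  f (xi2 (k, j) vw.1) * g (xi2 (k, j') vw.2).
have mh : measurable_fun setT h.
  apply: measurable_funM.
  - exact: (measurableT_comp mf (@mfst S1 S2 (k, j) erefl)).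
  - exact: (measurableT_comp mg (@msnd S1 S2 (k, j') erefl)).
have [|||-> _] := @fubini S1 S2 h (C * C').
- by move=> i -> [] /eqP; rewrite (negbTE jj').
- exact: mh.
- by move=> vw; rewrite normrM; apply: ler_pM.
rewrite /h /xi2 /=.
transitivity (\int[Q]_v ((\int[Q]_w g (xi k j' w)) * f (xi k j v))).
  apply: eq_Rintegral => v _; rewrite [RHS]mulrC -expectZ//.
  by apply: bm_comp; [exact: mxi|split => //; exists C'].
rewrite expectZ; first by rewrite mulrC.
by apply: bm_comp; [exact: mxi|split => //; exists C].
Qed.

Context (alpha : nat -> R) (alpha_gt0 : forall k, 0 < alpha k).
Context (th0 : 'rV[R]_7) (th0T : Theta th0).

Let proj k (v : V) : 'rV[R]_7 :=
  projected_sgd Theta BR u beta phi_star alpha th0 (fun n j => xi n j v) k.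

Let projT k v : Theta (proj k v).
Proof. exact: projected_sgd_in. Qed.

(** The iterate [proj k] is a function of the past, and the estimator at step k adds only present
    samples; Fubini between these two groups plays the role of conditioning on the iterate. *)
Let past k : set (nat * 'I_M) := [set i | (i.1 < k)%N].
Let present k : set (nat * 'I_M) := [set i | i.1 = k].

Let past_present k i : past k i -> ~ present k i.
Proof. by rewrite /past /present /= => + E; rewrite E ltnn. Qed.

Let mproj k c :
  measurable_fun setT (fun v : group_sigma xi2 (past k) => proj k v 0 c).
Proof.
apply: (@measurable_projected_sgd _ _ _ wp A5 cTheta sigmaP mdsigma BR _ u beta
  phi_star M alpha th0 _ (group_sigma xi2 (past k)) xi k) => i j ik.
exact: (@measurable_group_sigma _ _ _ _ _ xi2 (past k) (i, j) ik).
Qed.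

Let mproj1 k c : measurable_fun setT
  (fun vw : group_sigma xi2 (past k) * group_sigma xi2 (present k) => proj k vw.1 0 c).
Proof. exact: (measurableT_comp (@mproj k c) measurable_fst). Qed.

Let mxi_present k j : measurable_fun setT
  (fun vw : group_sigma xi2 (past k) * group_sigma xi2 (present k) => xi k j vw.2).
Proof. exact: (@msnd (past k) (present k) (k, j) erefl). Qed.

(** With the iterate frozen in [Theta], a fresh sample has the noise law conditioned on [G], where
    the bound holds; so the indicator of a violation has mean zero. *)
Lemma ae_path_grad_le k j :
  {ae Q, forall v, norm1 (path_grad (proj k v) (xi k j v)) <= BR}.
Proof.
pose bad (th : 'rV[R]_7) (x : traj) : R := if norm1 (path_grad th x) <= BR then 0 else 1.
pose h (vw : group_sigma xi2 (past k) * group_sigma xi2 (present k)) :=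
  bad (proj k vw.1) (xi k j vw.2).
have bad1 th x : `|bad th x| <= 1.
  by rewrite /bad; case: ifP; rewrite ?normr0 ?normr1.
have mh : measurable_fun setT h.
  apply: measurable_fun_ifT; try exact: measurable_cst.
  exact: (measurable_grad_bounded wp A5 sigmaP mdsigma BR (@mproj1 k) (@mxi_present k j)).
have bbad th : bounded_measurable (bad th).
  split; last by exists 1.
  apply: measurable_fun_ifT; try exact: measurable_cst.
  exact: (measurable_grad_bounded wp A5 sigmaP mdsigma BR (th := fun=> th)
    (x := id) (fun=> @measurable_cst _ _ _ _ _ _) (@measurable_id _ _ _)).
have [h0 _] := @fubini (past k) (present k) h 1 (@past_present k) mh (fun vw => bad1 _ _).
have {h0} : \int[Q]_v bad (proj k v) (xi k j v) = 0.
  rewrite [LHS]h0 -[RHS](expect_cst Q); apply: eq_Rintegral => v _.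
  rewrite /h /= (law k j (bbad (proj k v))) /cond_exp.
  rewrite (_ : \int[P]_(w in G) _ = 0) ?mul0r//.
  rewrite -[RHS](mul0r (fine (P G))) -(Rintegral_cst P mG).
  apply: eq_Rintegral => w; rewrite inE => Gw.
  by rewrite /bad gradN// BR_bound.
have bh : bounded_measurable (fun v => bad (proj k v) (xi k j v)).
  split; last by exists 1.
  exact: (measurableT_comp mh (measurable_fun_pair
    (@measurable_to_group_sigma _ _ _ _ _ xi2 mxi2 (past k))
    (@measurable_to_group_sigma _ _ _ _ _ xi2 mxi2 (present k)))).
move=> int0.
have : (\int[Q]_v `|(bad (proj k v) (xi k j v))%:E| = 0)%E.
  have -> : (\int[Q]_v `|(bad (proj k v) (xi k j v))%:E|)%E =
      (\int[Q]_v (bad (proj k v) (xi k j v))%:E)%E.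
    apply: eq_integral => v _; rewrite gee0_abs// lee_fin.
    by rewrite /bad; case: ifP.
  rewrite -[LHS]fineK; last by apply: integrable_fin_num => //; exact: (bm_integrable Q bh).
  by move: int0; rewrite /Rintegral => ->.
move=> /(ae_eq_integral_abs Q measurableT _).1 H.
have {}H := H _; apply: filterS (H _) => [v /(_ I)|].
  by rewrite /bad; case: ifP => // _ [] /eqP; rewrite oner_eq0.
by apply/measurable_EFinP; case: bh.
Qed.

Let S : R := 4 * BR * \sum_l `|beta l * u l|.

Let S0 : 0 <= S.
Proof. by rewrite mulr_ge0// ?mulr_ge0//; apply: sumr_ge0. Qed.

Let cest (x : 'I_M -> traj) th := clipped_estimator BR u beta phi_star x th.

Let pq l a : `|p l * - sin a + q l * cos a| <= 1.
Proof. exact: phi_star_le. Qed.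

Let entry_le_norm1 (a : 'rV[R]_7) i : `|a 0 i| <= norm1 a.
Proof. by rewrite /norm1 (bigD1 i)//= lerDl; apply: sumr_ge0. Qed.

Let norm1_cest x th : norm1 (cest x th) <= S.
Proof. exact: (norm1_est u beta (X th) (dD th) pq x M0). Qed.

Let bias k th := bias_est Q (xi k) x0 u beta (X th) (D th).

Let norm1_bias k th : norm1 (bias k th) <= S.
Proof. exact: (norm1_bias_est Q x0 (mxi k) u beta (mX th) (mD th) (dD th)). Qed.

Let bcest k th i : bounded_measurable (fun v => cest (fun j => xi k j v) th 0 i).
Proof.
split; last by exists S => v; apply: (le_trans (entry_le_norm1 _ _)); exact: norm1_cest.
exact: (measurable_clipped_estimator wp A5 sigmaP mdsigma BR u beta phi_star
  (th := fun=> th) i (fun=> @measurable_cst _ _ _ _ _ _) (mxi k)).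
Qed.

Lemma expect_cest k th i : Theta th ->
  \int[Q]_v cest (fun j => xi k j v) th 0 i =
  grad_lossL th 0 i - M%:R^-1 * bias k th 0 i.
Proof.
move=> thT; rewrite (grad_lossE k thT).
exact: (expect_est (mxi k) (@same k) (@indep k) u beta p q (mX th) (mD th) (dD th) i M0).
Qed.

Let MV1 : 0 <= (M%:R^-1 : R) <= 1.
Proof. by rewrite invr_ge0 ler0n/= invf_le1 ?ltr0n// ler1n. Qed.

(** The gradient is the mean of the estimator plus 1/M times the bias, and S bounds both. Only
    boundedness matters here, for integrability. *)
Lemma grad_loss_entry_le th i : Theta th -> `|grad_lossL th 0 i| <= 2 * S.
Proof.
move=> thT; have -> : grad_lossL th 0 i =
    \int[Q]_v cest (fun j => xi 0 j v) th 0 i + M%:R^-1 * bias 0 th 0 i.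
  by rewrite expect_cest// subrK.
apply: (le_trans (ler_normD _ _)); rewrite mulr_natl mulr2n lerD//.
  apply: norm_expect_le; first exact: bcest.
  by move=> v; apply: (le_trans (entry_le_norm1 _ _)); exact: norm1_cest.
rewrite normrM ger0_norm; last by case/andP: MV1.
rewrite -[leRHS]mul1r ler_pM//; [by case/andP: MV1..|].
by apply: (le_trans (entry_le_norm1 _ _)); exact: norm1_bias.
Qed.

Let mint k (F : 'rV[R]_7 -> traj -> R) C :
  measurable_fun setT (fun vw : group_sigma xi2 (past k) * group_sigma xi2 (present k) =>
    F (proj k vw.1) (xi k x0 vw.2)) ->
  (forall th t, `|F th t| <= C) ->
  measurable_fun setT (fun v : group_sigma xi2 (past k) =>
    \int[Q]_w F (proj k v) (xi k x0 w)).
Proof.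
move=> mF FC.
exact: (fubini (@past_present k) mF (fun vw => FC _ _)).2.
Qed.

(** [grad_lossE] writes the gradient at the iterate through integrals over a present sample, whose
    measurability in the past is part of Fubini's theorem. *)
Let mgrad k i : measurable_fun setT (fun v : group_sigma xi2 (past k) =>
  grad_lossL (proj k v) 0 i).
Proof.
have mX1 := measurable_path_ret wp sigmaP (@mproj1 k) (@mxi_present k x0).
have muX l := measurable_funM (@measurable_cst _ _ _ _ setT (u l)) mX1.
have mD1 := measurable_clipped_grad wp A5 sigmaP mdsigma BR (@mproj1 k) (@mxi_present k x0) i.
have mc l : measurable_fun setT (fun v : group_sigma xi2 (past k) =>
    \int[Q]_w cos (u l * X (proj k v) (xi k x0 w))).
  apply: (@mint k (fun th t => cos (u l * X th t)) 1) => [|th t]; last exact: cos_max.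
  exact: measurable_fun_cos (muX l).
have ms l : measurable_fun setT (fun v : group_sigma xi2 (past k) =>
    \int[Q]_w sin (u l * X (proj k v) (xi k x0 w))).
  apply: (@mint k (fun th t => sin (u l * X th t)) 1) => [|th t]; last exact: sin_max.
  exact: measurable_fun_sin (muX l).
have le (a e b : R) : `|e| <= 1 -> `|b| <= BR -> `|a * e * b| <= `|a| * BR.
  move=> e1 bB; rewrite normrM ler_pM// normrM -[leRHS]mulr1 ler_wpM2l//.
have DB th t : `|D th t 0 i| <= BR by apply: (le_trans (entry_le_norm1 _ _)); exact: dD.
have mdc l : measurable_fun setT (fun v : group_sigma xi2 (past k) =>
    \int[Q]_w d_cos u (X (proj k v)) (D (proj k v)) l i (xi k x0 w)).
  apply: (@mint k (fun th t => d_cos u (X th) (D th) l i t) (`|u l| * BR)) => [|th t].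
    apply: measurable_funM mD1; apply: measurable_funM; first exact: measurable_cst.
    exact: measurable_fun_sin (muX l).
  by rewrite /d_cos mulNr -mulrN; apply: le => //; rewrite normrN sin_max.
have mds l : measurable_fun setT (fun v : group_sigma xi2 (past k) =>
    \int[Q]_w d_sin u (X (proj k v)) (D (proj k v)) l i (xi k x0 w)).
  apply: (@mint k (fun th t => d_sin u (X th) (D th) l i t) (`|u l| * BR)) => [|th t].
    apply: measurable_funM mD1; apply: measurable_funM; first exact: measurable_cst.
    exact: measurable_fun_cos (muX l).
  by apply: le => //; rewrite cos_max.
have -> : (fun v : group_sigma xi2 (past k) => grad_lossL (proj k v) 0 i) =
  (fun v => 2 * \sum_l beta l *
    ((\int[Q]_w cos (u l * X (proj k v) (xi k x0 w)) - p l)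
       * \int[Q]_w d_cos u (X (proj k v)) (D (proj k v)) l i (xi k x0 w)
    + (\int[Q]_w sin (u l * X (proj k v) (xi k x0 w)) - q l)
       * \int[Q]_w d_sin u (X (proj k v)) (D (proj k v)) l i (xi k x0 w))).
  by apply/funext => v; rewrite (grad_lossE k (projT k v)) mxE.
apply: measurable_funM; first exact: measurable_cst.
apply: measurable_sum => l; apply: measurable_funM; first exact: measurable_cst.
apply: measurable_funD.
- by apply: measurable_funM (mdc l); apply: measurable_funB (mc l) _; exact: measurable_cst.
- by apply: measurable_funM (mds l); apply: measurable_funB (ms l) _; exact: measurable_cst.
Qed.

Let to_past k : measurable_fun setT (id : V -> group_sigma xi2 (past k)).
Proof. exact: (@measurable_to_group_sigma _ _ _ _ _ xi2 mxi2 (past k)). Qed.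

Let to_present k : measurable_fun setT (id : V -> group_sigma xi2 (present k)).
Proof. exact: (@measurable_to_group_sigma _ _ _ _ _ xi2 mxi2 (present k)). Qed.

Let bgrad k i : bounded_measurable (fun v => grad_lossL (proj k v) 0 i).
Proof.
split; last by exists (2 * S) => v; exact: grad_loss_entry_le.
exact: (measurableT_comp (f := fun v : group_sigma xi2 (past k) =>
  grad_lossL (proj k v) 0 i) (@mgrad k i) (@to_past k)).
Qed.

Let bgrad2 k : bounded_measurable (fun v => dot (grad_lossL (proj k v)) (grad_lossL (proj k v))).
Proof. by apply: bm_sum => i; exact: bmM. Qed.

(** Past and present enter as separate arguments, so that Fubini can average over the second; on the
    diagonal this is the inner product of the gradient at the iterate with the estimator. *)
Let inner k (vw : group_sigma xi2 (past k) * group_sigma xi2 (present k)) : R :=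
  dot (grad_lossL (proj k vw.1)) (cest (fun j => xi k j vw.2) (proj k vw.1)).

Let minner k : measurable_fun setT (@inner k).
Proof.
apply: measurable_sum => i; apply: measurable_funM.
  exact: (measurableT_comp (@mgrad k i) measurable_fst).
exact: (measurable_clipped_estimator wp A5 sigmaP mdsigma BR u beta phi_star i
  (@mproj1 k) (@mxi_present k)).
Qed.

Let inner_le k vw : `|@inner k vw| <= \sum_(i < 7) (2 * S * S).
Proof.
apply: (le_trans (ler_norm_sum _ _ _)); apply: ler_sum => i _.
rewrite normrM; apply: ler_pM => //; first exact: grad_loss_entry_le.
by apply: (le_trans (entry_le_norm1 _ _)); exact: norm1_cest.
Qed.

Let binner k : bounded_measurable (fun v : V => @inner k (v, v)).
Proof.
split; last by exists (\sum_(i < 7) (2 * S * S)) => v; exact: inner_le.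
exact: (measurableT_comp (@minner k) (measurable_fun_pair (@to_past k) (@to_present k))).
Qed.

Lemma expect_step k :
  2^-1 * (\int[Q]_v dot (grad_lossL (proj k v)) (grad_lossL (proj k v)))
    - 2^-1 * (S ^+ 2 / M%:R ^+ 2) <= \int[Q]_v @inner k (v, v).
Proof.
have [E mI] := fubini (@past_present k) (@minner k) (@inner_le k).
have innerE v : \int[Q]_w @inner k (v, w) =
    dot (grad_lossL (proj k v)) (grad_lossL (proj k v))
    - M%:R^-1 * dot (grad_lossL (proj k v)) (bias k (proj k v)).
  rewrite /inner /dot /= expect_sum; last first.
    by move=> i; apply: bmM; [exact: bm_cst|exact: bcest].
  rewrite mulr_sumr -sumrB; apply: eq_bigr => i _.
  by rewrite expectZ ?expect_cest//; ring.
have bI : bounded_measurable (fun v : V => \int[Q]_w @inner k (v, w)).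
  split; first exact: (measurableT_comp mI (@to_past k)).
  exists (\sum_(i < 7) (2 * S * S)) => v; apply: norm_expect_le => [|w]; last exact: inner_le.
  split; last by exists (\sum_(i < 7) (2 * S * S)) => w; exact: inner_le.
  rewrite /inner; apply: measurable_sum => i; apply: measurable_funM.
    exact: (@measurable_cst _ _ _ _ _ (grad_lossL (proj k v) 0 i)).
  by case: (bcest k (proj k v) i).
rewrite [leRHS]E.
apply: (@le_trans _ _ (\int[Q]_v (2^-1 * dot (grad_lossL (proj k v)) (grad_lossL (proj k v))
    + - (2^-1 * (S ^+ 2 / M%:R ^+ 2))))).
  by rewrite expectD ?expectZ ?expect_cst//; [apply: bmM => //|]; exact: bm_cst.
apply: le_expect => // [|v].
  by apply: bmD; [apply: bmM => //|]; exact: bm_cst.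
rewrite innerE -norm2_sqr.
set n := norm2 _.
have n0 : 0 <= n by exact: norm2_ge0.
have nb : norm2 (bias k (proj k v)) <= S.
  by apply: (le_trans (norm2_le_norm1 _)); exact: norm1_bias.
have /andP[MV0 _] := MV1.
have H1 : M%:R^-1 * dot (grad_lossL (proj k v)) (bias k (proj k v)) <= M%:R^-1 * (n * S).
  by rewrite ler_wpM2l//; apply: (le_trans (dot_le_norm2 _ _)); rewrite ler_wpM2l.
(* Expanding this square bounds n S / M by half the sum of n^2 and S^2 / M^2. *)
have H2 : 0 <= (n - M%:R^-1 * S) ^+ 2 by exact: sqr_ge0.
have MR : (M%:R : R) != 0 by rewrite pnatr_eq0 -lt0n.
have H3 : S ^+ 2 / M%:R ^+ 2 = (M%:R^-1 * S) ^+ 2 by field.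
rewrite H3; move: H1 H2; rewrite !expr2; lra.
Qed.

Context (sgdT : {ae Q, forall v, forall k,
  Theta (sgd u beta phi_star alpha th0 (fun n j => xi n j v) k)}).
Context (segT : {ae Q, forall v, forall k (t : R), 0 <= t <= 1 ->
  Theta (sgd u beta phi_star alpha th0 (fun n j => xi n j v) k
    + t *: (sgd u beta phi_star alpha th0 (fun n j => xi n j v) k.+1
            - sgd u beta phi_star alpha th0 (fun n j => xi n j v) k))}).

(** For each k and j the gradient bound fails on a null set only, and countably many of these have a
    null union; off it and the exceptional set of [sgdT], [sgd_projected] applies. *)
Lemma ae_sgd_projected : {ae Q, forall v,
  (forall k, sgd u beta phi_star alpha th0 (fun n j => xi n j v) k = proj k v) /\
  (forall k, proj k.+1 v = proj k v - alpha k *: cest (fun j => xi k j v) (proj k v))}.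
Proof.
have ok : {ae Q, forall v, forall k j, norm1 (path_grad (proj k v) (xi k j v)) <= BR}.
  by apply: ae_foralln => k; apply: filter_forall => j; exact: ae_path_grad_le.
apply: filterS2 sgdT ok => v vT vB.
have E k : sgd u beta phi_star alpha th0 (fun n j => xi n j v) k = proj k v.
  by apply: (sgd_projected wp (BR := BR) M0 th0T vT) => k' j; exact: vB.
by split => // k; rewrite -(E k.+1) /= E (estimatorE (BR := BR) wp).
Qed.

Lemma expect_descent K :
  \sum_(0 <= k < K) alpha k * (\int[Q]_v @inner k (v, v)) <=
  lossL th0 + Lip / 2 * S ^+ 2 * \sum_(0 <= k < K) alpha k ^+ 2.
Proof.
rewrite big_mkord (eq_bigr (fun k : 'I_K => \int[Q]_v (alpha k * @inner k (v, v)))); last first.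
  by move=> k _; rewrite expectZ.
have bF (k : 'I_K) : bounded_measurable (fun v : V => alpha k * @inner k (v, v)).
  by apply: bmM; [exact: bm_cst|exact: binner].
rewrite -expect_sum//; apply: ae_le_expect; first exact: bm_sum.
apply: filterS2 ae_sgd_projected segT => v [E projS] seg.
(* The inequality is proved path by path. It keeps the loss at the last iterate for the induction;
   that term is dropped at the end because it is nonnegative. *)
suff H K' : lossL (proj K' v) + \sum_(k < K') alpha k * @inner k (v, v) <=
    lossL th0 + Lip / 2 * S ^+ 2 * \sum_(0 <= k < K') alpha k ^+ 2.
  by apply: le_trans (H K); rewrite lerDr; exact: loss_ge0.
elim: K' => [|k IH]; first by rewrite big_ord0 big_geq// mulr0 !addr0.
rewrite big_ord_recr big_nat_recr//= mulrDr !addrA.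
have segP t : 0 <= t <= 1 -> Theta (proj k v + t *: (proj k.+1 v - proj k v)).
  by rewrite -!E; exact: seg.
have := loss_descent segP.
have -> : proj k.+1 v - proj k v = - alpha k *: cest (fun j => xi k j v) (proj k v).
  by rewrite projS addrAC subrr add0r scaleNr.
have -> : dot (grad_lossL (proj k v)) (- alpha k *: cest (fun j => xi k j v) (proj k v))
    = - (alpha k * @inner k (v, v)).
  by rewrite /inner /dot mulr_sumr -sumrN; apply: eq_bigr => i _; rewrite [X in _ * X = _]mxE; ring.
rewrite norm2Z normrN gtr0_norm// exprMn.
set c := cest _ _ => H.
have cS : norm2 c ^+ 2 <= S ^+ 2.
  rewrite lerXn2r ?nnegrE ?norm2_ge0//.
  by apply: (le_trans (norm2_le_norm1 _)); exact: norm1_cest.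
have := ler_wpM2l (divr_ge0 Lip0 (ler0n R 2)) (ler_wpM2l (sqr_ge0 (alpha k)) cS).
lra.
Qed.

Context (K : nat) (K0 : (0 < K)%N).

Let A : R := \sum_(0 <= k < K) alpha k.

Let A0 : 0 < A.
Proof.
rewrite /A; case: (K) K0 => // n _; rewrite big_nat_recr//=.
by apply: ltr_wpDl => //; apply: sumr_ge0 => k _; exact: ltW.
Qed.

Lemma sgd_gradient_bound :
  (\sum_(0 <= k < K) (alpha k / A)%:E * 'E_Q[fun v =>
     (norm2 (grad_lossL (sgd u beta phi_star alpha th0 (fun n j => xi n j v) k)) ^+ 2)%R]
   <= (2 / A * lossL th0
       + Lip * S ^+ 2 * ((\sum_(0 <= k < K) alpha k ^+ 2) / A)
       + S ^+ 2 / M%:R ^+ 2)%:E)%E.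
Proof.
pose I k := \int[Q]_v dot (grad_lossL (proj k v)) (grad_lossL (proj k v)).
apply: (@le_trans _ _ (\sum_(0 <= k < K) (alpha k / A * I k)%:E)%E).
  rewrite !big_mkord; apply: lee_sum => k _; rewrite [X in (_ <= X)%E]EFinM.
  apply: lee_wpmul2l; first by rewrite lee_fin divr_ge0// ltW.
  (* The true iterate equals its projected version only off a null set, so measurability of the left
     integrand is not at hand. *)
  rewrite unlock; apply: ge0_le_integral_ae => //.
  - by move=> v; exact: sqr_ge0.
  - by move=> v; rewrite -norm2_sqr sqr_ge0.
  - by apply: filterS ae_sgd_projected => v [-> _]; rewrite norm2_sqr.
rewrite sumEFin lee_fin.
have H := expect_descent K.
have H1 : \sum_(0 <= k < K) alpha k * (2^-1 * I k - 2^-1 * (S ^+ 2 / M%:R ^+ 2)) <=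
    lossL th0 + Lip / 2 * S ^+ 2 * \sum_(0 <= k < K) alpha k ^+ 2.
  apply: le_trans H; rewrite !big_mkord; apply: ler_sum => k _.
  by rewrite ler_wpM2l ?expect_step// ltW.
(* The step sizes sum to A, so the term S^2 / M^2 comes out exactly once. *)
have E1 : \sum_(0 <= k < K) alpha k * (2^-1 * I k - 2^-1 * (S ^+ 2 / M%:R ^+ 2)) =
    A * 2^-1 * (\sum_(0 <= k < K) alpha k / A * I k - S ^+ 2 / M%:R ^+ 2).
  have A1 : A != 0 by rewrite gt_eqF.
  rewrite (eq_bigr (fun k => 2^-1 * A * (alpha k / A * I k)
      + alpha k * (- (2^-1 * (S ^+ 2 / M%:R ^+ 2))))); last first.
    by move=> k _; field; rewrite A1 andbT pnatr_eq0 -lt0n.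
  by rewrite big_split/= -mulr_sumr -mulr_suml -/A; ring.
rewrite E1 in H1.
set T1 := \sum_(0 <= k < K) alpha k / A * I k in H1 *.
set T2 := S ^+ 2 / _ in H1 *.
set T3 := \sum_(0 <= k < K) alpha k ^+ 2 in H1 *.
have -> : 2 / A * lossL th0 + Lip * S ^+ 2 * (T3 / A) + T2 =
    (2 * (lossL th0 + Lip / 2 * S ^+ 2 * T3)) / A + T2.
  by field; rewrite gt_eqF.
rewrite -lerBlDr ler_pdivlMr//; lra.
Qed.

End convergence.

Lemma bigO_le (R : realType) (T : Type) (F : filter_on T)
    (f g : T -> R) (C : R) : (forall x, `|f x| <= C * `|g x|) -> f =O_F g.
Proof.
move=> fg; apply/eqOP; near=> k; apply: nearW => x.
apply: (le_trans (fg x)); rewrite ler_wpM2r//.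
Unshelve. all: by end_near. Qed.

Theorem theorem8 (R : realType) (d : measure_display) (W : measurableType d)
    (P : probability W R) (P_complete : measure_is_complete P)
    (m : model R) (Theta : set 'rV[R]_7) (wp : well_posed m Theta)
    (eps z : nat -> {RV P >-> R}) (noiseP : standard_noise eps z)
    (alpha : nat -> R)
    (A1 : assumption1 m Theta) (A2 : assumption2 m) (A3 : assumption3 m)
    (A4 : assumption4 m) (A5 : assumption5 m) (A6 : assumption6 alpha)
    (eta : nat -> R)
    (eta_gt0 : forall t, (1 <= t <= horizon m)%N -> 0 < eta t)
    (Bz : R) (Bz_gt0 : 0 < Bz)
    (gamma : R) (gamma_gt0 : 0 < gamma) (gamma_lt1 : gamma < 1)
    (G := good_event P m eps z Theta eta Bz)
    (G_meas : measurable G) (PG : ((1 - gamma)%:E <= P G)%E)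
    (BR : R)
    (BR_bound : forall t th w, (t <= horizon m)%N -> Theta th -> G w ->
       norm1 (grad_ret m th (noise eps z w) t) <= BR)
    (L : nat) (u beta : 'I_L -> R) (beta_ge0 : forall l, 0 <= beta l)
    (mu_star : probability R R)
    (lossL := loss P m eps z G u beta (char_fun mu_star))
    (grad_lossL := grad_loss P m eps z G u beta (char_fun mu_star))
    (Lip : R) (Lip_gt0 : 0 < Lip)
    (LipP : forall th th', Theta th -> Theta th' ->
       norm2 (grad_lossL th - grad_lossL th') <= Lip * norm2 (th - th'))
    (th0 : 'rV[R]_7) (th0_in : Theta th0) :
  let A (K : nat) : R := \sum_(0 <= k < K) alpha k in
  let S : R := 4 * BR * \sum_l `|beta l * u l| in
  let bound (K M : nat) : R :=
    2 / A K * lossL th0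
    + Lip * S ^+ 2 * ((\sum_(0 <= k < K) alpha k ^+ 2) / A K)
    + S ^+ 2 / M%:R ^+ 2 in
  (forall (M : nat) (d' : measure_display) (V : measurableType d')
      (Q : probability V R)
      (xi : nat -> 'I_M -> V -> (horizon m).-tuple (R * R)),
    (0 < M)%N ->
    conditional_sampling P eps z G Q xi ->
    let theta (k : nat) (v : V) : 'rV[R]_7 :=
      sgd u beta (char_fun mu_star) alpha th0 (fun n j => xi n j v) k in
    {ae Q, forall v, forall k, Theta (theta k v)} ->
    {ae Q, forall v, forall k (t : R), 0 <= t <= 1 ->
       Theta (theta k v + t *: (theta k.+1 v - theta k v))} ->
    forall K : nat, (0 < K)%N ->
      (\sum_(0 <= k < K)
         (alpha k / A K)%:E * 'E_Q[fun v => (norm2 (grad_lossL (theta k v)) ^+ 2)%R]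
       <= (bound K M)%:E)%E)
  /\
  exists h1 h2 : nat * nat -> R,
    [/\ forall K M, bound K M = h1 (K, M) + h2 (K, M),
        h1 =O_ (filter_prod \oo \oo) (fun p => 1 / A p.1) &
        h2 =O_ (filter_prod \oo \oo) (fun p => 1 / (p.2%:R : R) ^+ 2)].
Proof.
move=> A S bound.
have [alpha_gt0 _ cvg_alpha2] := A6.
have [sigmaP mdsigma] := assumption1_activation A1.
have cTheta : closed Theta by have [cT _ _ _] := A1; exact: compact_closed (@norm_hausdorff _ _) cT.
have PG0 : (0 < P G)%E by apply: lt_le_trans PG; rewrite lte_fin subr_gt0.
(* [G] has positive probability, hence a point, and there the constant bounds a norm. *)
have BR0 : 0 <= BR.
  have [w Gw] : G !=set0.
    by apply/set0P/eqP => G0; move: PG0; rewrite G0 measure0 ltxx.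
  by apply: le_trans (BR_bound 0%N _ _ (leq0n _) th0_in Gw); exact: sumr_ge0.
split.
  move=> M d' V Q xi M0 sampling theta thetaT segT K K0.
  apply: (@sgd_gradient_bound _ _ _ _ _ _ wp A4 A5 cTheta sigmaP mdsigma
    _ _ _ _ _ G_meas PG0 _ BR0 _ _ _ _ _ beta_ge0 _ _ (ltW Lip_gt0) LipP _ M0
    _ _ _ _ sampling _ alpha_gt0 _ th0_in thetaT segT _ K0).
  - by move=> t; exact: measurable_funPT.
  - by move=> t; exact: measurable_funPT.
  - by move=> th w; exact: BR_bound.
  (* The target characteristic function is a mean of exp(ivx) under [mu_star], to which the phase
     bound applies. *)
  - by move=> v a; apply: norm_cis_expect_le; exact: measurable_funM.
have [B HB] : exists B : R, forall K, \sum_(0 <= k < K) alpha k ^+ 2 <= B.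
  exists (limn (series (fun k => alpha k ^+ 2))) => K.
  apply: (@nondecreasing_cvgn_le _ (series (fun k => alpha k ^+ 2))) => //.
  by apply: nondecreasing_series => n _ _; exact: sqr_ge0.
(* The first two terms are both of order 1 / A_K, because the sums of squared step sizes stay below
   [B]. *)
exists (fun p => 2 / A p.1 * lossL th0
  + Lip * S ^+ 2 * ((\sum_(0 <= k < p.1) alpha k ^+ 2) / A p.1)),
  (fun p => S ^+ 2 / p.2%:R ^+ 2); split => //.
- apply: (@bigO_le _ _ _ _ _ (2 * `|lossL th0| + Lip * S ^+ 2 * B)) => -[K M] /=.
  (* For K = 0 the sum A is 0 and so is its inverse, by convention; the estimate therefore holds at
     every index and not just eventually. *)
  have A0 : 0 <= (A K)^-1 by rewrite invr_ge0 sumr_ge0// => k _; exact: ltW.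
  have a20 : 0 <= \sum_(0 <= k < K) alpha k ^+ 2 by rewrite sumr_ge0// => k _; exact: sqr_ge0.
  have LS0 : 0 <= Lip * S ^+ 2 by rewrite mulr_ge0 ?sqr_ge0// ltW.
  rewrite div1r (ger0_norm A0) [leRHS]mulrDl; apply: (le_trans (ler_normD _ _)); apply: lerD.
    by rewrite !normrM (ger0_norm A0) (ger0_norm (ler0n _ 2)); lra.
  rewrite mulrA normrM (ger0_norm A0) ler_wpM2r//.
  by rewrite ger0_norm ?(mulr_ge0 LS0 a20)// ler_wpM2l.
- apply: (@bigO_le _ _ _ _ _ (S ^+ 2)) => -[K M] /=.
  by rewrite div1r normrM (ger0_norm (sqr_ge0 S)).
Qed.
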